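(* Let $1\leqslant p\leqslant\infty$ and $0<\xi<\omega_1$. (i) $\mathfrak{SM}_p^\xi\not\subset\bigcup_{0<\zeta<\xi}\mathfrak{SM}_p^\zeta$. (ii) $\mathfrak{WC}^\xi\not\subset\bigcup_{0<\zeta<\xi}\mathfrak{WC}^\zeta$. (iii) For $0<\zeta\leqslant\omega_1$ and $1\leqslant q\leqslant\infty$, $\mathfrak{SM}_q^\zeta\subset\mathfrak{SM}_p^\xi$ if and only if $p=q$ and $\zeta\leqslant\xi$.
   Context: ''Operator'' means bounded linear operator between Banach spaces. $(u_i)\lesssim_K(v_i)$ means $\|\sum a_iu_i\|\leqslant K\|\sum a_iv_i\|$ for all (finitely supported) scalars. Schreier families: for finite $E,F\subset\mathbb N$, $E<F$ means $\max E<\min F$, and $n\leqslant E$ means $n\leqslant\min E$. $\mathcal F[\mathcal G]=\{\bigcup_{i=1}^nE_i:E_1<\dots<E_n,\ (\min E_i)_{i=1}^n\in\mathcal F,\ E_i\in\mathcal G\}$; $\mathcal S=\{E:|E|\leqslant\min E\}\cup\{\varnothing\}$; $\mathcal S_0=\{\varnothing\}\cup\{\{n\}:n\in\mathbb N\}$; $\mathcal S_{\xi+1}=\mathcal S[\mathcal S_\xi]$; for a countable limit $\xi$ fix successors $\xi_n\uparrow\xi$ with $\mathcal S_{\xi_n}\subset\mathcal S_{\xi_{n+1}}$ and let $\mathcal S_\xi=\{E:\exists n\leqslant E,\ E\in\mathcal S_{\xi_n}\}\cup\{\varnothing\}$; $\mathcal S_{\omega_1}$ is the family of all finite subsets of $\mathbb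 N$. For $0<\xi\leqslant\omega_1$ and $(e_i)$ the canonical basis of $\ell_p$ ($c_0$ if $p=\infty$), $(x_i)$ is an $\ell_p^\xi$ ($c_0^\xi$ if $p=\infty$) spreading model if for some $a,b>0$, $(e_i)_{i\in E}\lesssim_a(x_i)_{i\in E}$ and $(x_i)_{i\in E}\lesssim_b(e_i)_{i\in E}$ for all $E\in\mathcal S_\xi$. $\mathfrak{SM}_p^\xi$ is the class of all operators $A:X\to Y$ such that whenever $(x_n)\subset X$ is an $\ell_p^\xi$ ($c_0^\xi$) spreading model, $(Ax_n)$ is not one. $\mathfrak{WC}^\xi$ is the class of weakly compact operators belonging to $\mathfrak{SM}_1^\xi$. *)

(* Defs.v *)
From HB Require Import structures.
From mathcomp Require Import all_boot all_order all_algebra finmap.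
From mathcomp Require Import all_classical all_reals all_analysis.
From mathcomp Require Import complex.

Set Implicit Arguments.
Unset Strict Implicit.
Unset Printing Implicit Defensive.

Import Order.TTheory GRing.Theory Num.Theory.
Import numFieldNormedType.Exports.

Local Open Scope classical_set_scope.
Local Open Scope ring_scope.

(** * Ordinals up to [omega_1] *)

(* [W] has order type [omega_1 + 1]: it is well-ordered, and its top element is
   the only one with uncountably many predecessors. Thus [W] is the set of
   ordinals [<= omega_1], with [\bot] standing for 0 and [\top] for [omega_1]. *)
Definition ordinals_upto_omega1 (d : Order.disp_t) (W : tbOrderType d) : Prop :=
  [/\ well_founded (fun x y : W => (x < y)%O),
      forall x : W, (x < \top)%O -> countable [set y : W | (y < x)%O]
    & ~ countable [set y : W | (y < \top)%O]].

Definition is_succ_of (d : Order.disp_t) (W : tbOrderType d) (y x : W) : Prop :=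
  (x < y)%O /\ forall z : W, (x < z)%O -> (y <= z)%O.

Definition is_successor (d : Order.disp_t) (W : tbOrderType d) (y : W) : Prop :=
  exists x, is_succ_of y x.

Definition is_limit (d : Order.disp_t) (W : tbOrderType d) (y : W) : Prop :=
  (\bot < y)%O /\ ~ is_successor y.

(** * Schreier families *)

(* The positive integers are the index set throughout: 0 belongs to no member
   of a Schreier family, so the term of index 0 of a sequence [nat -> X] plays
   no role below. *)

(* Meaningful for nonempty [E] only. *)
Definition fset_min (E : {fset nat}) : nat := head 0%N (sort leq E).

Definition fset_lt (E F : {fset nat}) : Prop :=
  forall i j, i \in E -> j \in F -> (i < j)%N.

Definition le_fset (n : nat) (E : {fset nat}) : Prop :=
  forall i, i \in E -> (n <= i)%N.

(* The blocks are nonempty, so that their minima make sense; [n = 0] yields the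
   empty set. *)
Definition schreier_conv (F G : set {fset nat}) : set {fset nat} :=
  [set E | exists (n : nat) (B : 'I_n -> {fset nat}),
     [/\ forall i, B i != fset0 /\ G (B i),
         forall i j : 'I_n, (i < j)%N -> fset_lt (B i) (B j),
         F [fset fset_min (B i) | i in 'I_n]%fset
       & E = (\bigcup_(i in 'I_n) B i)%fset]].

Definition schreier : set {fset nat} :=
  [set E | E = fset0 \/ (#|` E| <= fset_min E)%N].

Definition schreier0 : set {fset nat} :=
  [set E | E = fset0 \/ exists2 n, (0 < n)%N & E = [fset n]%fset].

(* [S] is a possible outcome of the transfinite recursion: at each countable
   limit ordinal [xi] some sequence [(u n)] (n >= 1) of successors is chosen. *)
Definition schreier_hierarchy (d : Order.disp_t) (W : tbOrderType d)
    (S : W -> set {fset nat}) : Prop :=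
  [/\ S \bot%O = schreier0,
      forall xi eta : W, (eta < \top)%O -> is_succ_of eta xi ->
        S eta = schreier_conv schreier (S xi),
      forall xi : W, (xi < \top)%O -> is_limit xi ->
        exists u : nat -> W,
        [/\ forall n, (0 < n)%N ->
              [/\ is_successor (u n), (u n < u n.+1)%O, (u n < xi)%O
                & S (u n) `<=` S (u n.+1)],
            forall z, (z < xi)%O -> exists2 n, (0 < n)%N & (z < u n)%O
          & S xi = [set E : {fset nat} | E = fset0 \/
                            exists n, [/\ (0 < n)%N, le_fset n E & S (u n) E]]]
    & S \top%O = [set E : {fset nat} | 0%N \notin E]].

(** * Scalars *)

Variant scalars : Set := RealScalars | ComplexScalars.

Definition scalar_field (R : realType) (s : scalars) : numFieldType :=
  match s with
  | RealScalars => R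
  | ComplexScalars => R[i]
  end.

(* Norms of a [normedModType K] are valued in [K]; this reads them in [R]. *)
Definition real_part (R : realType) (s : scalars) : scalar_field R s -> R :=
  match s with
  | RealScalars => fun x => x
  | ComplexScalars => fun z => complex.Re z
  end.

Definition normR (R : realType) (s : scalars)
    (X : normedModType (scalar_field R s)) (x : X) : R :=
  real_part `|x|.

Definition modulus (R : realType) (s : scalars) (a : scalar_field R s) : R :=
  real_part `|a|.

(** * Spreading models *)

(* Norm of [\sum_(i in E) a_i e_i], with [e] the canonical basis of [l_p], or of
   [c_0] if [p = +oo]. *)
Definition lp_norm (R : realType) (s : scalars) (p : \bar R) (E : {fset nat})
    (a : nat -> scalar_field R s) : R :=
  match p with
  | r%:E => (\sum_(i <- E) modulus (a i) `^ r) `^ r^-1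
  | +oo%E => \big[Num.max/0]_(i <- E) modulus (a i)
  | -oo%E => 0
  end.

Definition comb_norm (R : realType) (s : scalars)
    (X : normedModType (scalar_field R s)) (x : nat -> X) (E : {fset nat})
    (a : nat -> scalar_field R s) : R :=
  normR (\sum_(i <- E) a i *: x i).

Definition spreading_model (R : realType) (s : scalars) (p : \bar R)
    (F : set {fset nat}) (X : normedModType (scalar_field R s))
    (x : nat -> X) : Prop :=
  exists a b : R, [/\ 0 < a, 0 < b
    & forall E, F E -> forall c : nat -> scalar_field R s,
        lp_norm p E c <= a * comb_norm x E c /\
        comb_norm x E c <= b * lp_norm p E c].

(** * Classes of operators *)

Definition bounded_operator (K : numFieldType) (X Y : normedModType K)
    (A : {linear X -> Y}) : Prop :=
  exists M : K, forall x, `|A x| <= M * `|x|.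

Definition dual (K : numFieldType) (Y : normedModType K) : Type :=
  {f : {linear Y -> K^o} | bounded_operator f}.

(* [Y] with the topology generated by its bounded linear functionals *)
Definition weak_space (K : numFieldType) (Y : normedModType K) :
    topologicalType :=
  sup_topology (fun f : dual Y =>
    Topological.on (initial_topology (sval f : Y -> K^o))).

Definition weakly_compact_operator (K : numFieldType) (X Y : normedModType K)
    (A : {linear X -> Y}) : Prop :=
  bounded_operator A /\
  compact (closure (A @` [set x | `|x| <= 1] : set (weak_space Y))).

Definition operator_class (K : numFieldType) : Type :=
  forall X Y : completeNormedModType K, {linear X -> Y} -> Prop.

Definition class_sub (K : numFieldType) (C D : operator_class K) : Prop :=
  forall (X Y : completeNormedModType K) (A : {linear X -> Y}),
    C X Y A -> D X Y A.

Definition class_bigcup (K : numFieldType) (I : Type) (P : set I)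
    (C : I -> operator_class K) : operator_class K :=
  fun X Y A => exists2 i, P i & C i X Y A.

Section Classes.
Context (R : realType) (s : scalars) (d : Order.disp_t) (W : tbOrderType d).
Variable S : W -> set {fset nat}.

Definition SM (p : \bar R) (xi : W) : operator_class (scalar_field R s) :=
  fun X Y A => bounded_operator A /\
    forall x : nat -> X, spreading_model p (S xi) x ->
      ~ spreading_model p (S xi) (fun n => A (x n)).

Definition WC (xi : W) : operator_class (scalar_field R s) :=
  fun X Y A => weakly_compact_operator A /\ SM 1%E xi A.

End Classes.

Arguments SM R s {d W} S p xi X Y A.
Arguments WC R s {d W} S xi X Y A.

(* Main.v *)
From HB Require Import structures.
Require Import Defs.
From mathcomp Require Import all_boot all_order all_algebra finmap.
From mathcomp Require Import all_classical all_reals all_analysis.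
From mathcomp Require Import complex lra ring zify.

(** The inclusion in (iii) is a translation. If [zeta <= xi], all members of
    [S zeta] that lie far enough to the right are in [S xi]; so the translates of a
    spreading model of order [xi] are spreading models of order [zeta], for a
    sequence and for its image alike ([SM_monotone]).

    The rest asks for operators that separate the classes. Let [u] be a sequence
    of ordinals with increasing Schreier families, and let [P w E] mean that
    [w = 1 / n] and [E] is in [S (u n)] for some [n >= 1]. For [p] finite take the
    formal inclusion of [l_p] into the space of sequences normed by the supremum
    of [w] times the [l_p] norm on [E], over [P w E]. For [p = +oo] take the
    inclusion into [l_oo] of the dual of this Schreier space for [p = 1]. The unit
    vectors are a spreading model of each order [u n] on both sides. If all [u n]
    are below [xi], no sequence is one of order [xi] on both sides
    ([separating_operator]). With [u] cofinal in [xi] this gives (i); with [u]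
    constant equal to [xi] it gives the failure of the inclusion in (iii) for
    [p = q] and [xi < zeta].

    The reason is a difference of size between [S xi] and the [S (u n)], expressed
    by repeated averages ([repeated_average], [weighted_average]): some set in
    [S xi] carries a probability for which every [E] with [P w E] has mass at most
    [e / w]. A gliding hump argument ([gliding_hump]) replaces a sequence by
    differences of its terms that are close to disjoint blocks, and a set [E]
    that meets some of the blocks is no larger, in a spreading family, than the set
    of right ends of these blocks. For [p] finite the probability is used for the
    coefficients of a combination of blocks: it has norm 1 in [l_p] and a small
    norm in the target ([lp_no_common_spreading_model]). For [p = +oo] it is used
    as a functional that shows that the sum of the blocks has a large norm in the
    domain ([dual_no_common_spreading_model]).

    For (ii), where [p = 1], the same operator is weakly compact: the averages
    show that every functional on the target tends to 0 along the unit vectors,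
    hence is continuous on the unit ball of [l_1] for coordinatewise convergence,
    for which this ball is compact ([l1_incl_weakly_compact]).

    Finally, if [p] and [q] differ, the identity of [l_p] has no [l_q] spreading
    model in its range, because sums of [N] blocks grow like [N ^ (1 / p)]
    ([lp_no_spreading_model]). For [p = +oo] the identity of [c_0] is replaced by
    the inclusion of the dual Schreier space, whose elements tend to 0
    ([exponent_separating_operator]). *)

Set Implicit Arguments.
Unset Strict Implicit.
Unset Printing Implicit Defensive.

Import Order.TTheory GRing.Theory Num.Theory.
Import numFieldNormedType.Exports.

Local Open Scope classical_set_scope.
Local Open Scope ring_scope.

(** * Real and complex scalars *)

Definition of_real (R : realType) (s : scalars) : R -> scalar_field R s :=
  match s with
  | RealScalars => fun x => x
  | ComplexScalars => fun x => (x%:C)%C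
  end.
Arguments of_real {R} s x.

Section Scalars.
Context (R : realType) (s : scalars).
Local Notation K := (scalar_field R s).
Local Notation rp := (@real_part R s).

Lemma of_realK (r : R) : rp (of_real s r) = r. Proof. by case: s. Qed.

Lemma of_real_real_part (z : K) : 0 <= z -> of_real s (rp z) = z.
Proof.
case: s z => [//|z] /=; rewrite lecE /= => /andP[/eqP z0 _].
by case: z z0 => a b /= ->.
Qed.

Lemma le_of_real (x y : R) : (of_real s x <= of_real s y) = (x <= y).
Proof. by case: s => //=; rewrite lecR. Qed.

Lemma lt_of_real (x y : R) : (of_real s x < of_real s y) = (x < y).
Proof. by case: s => //=; rewrite ltcR. Qed.

Lemma of_realD (x y : R) : of_real s (x + y) = of_real s x + of_real s y.
Proof. by case: s => //=; rewrite rmorphD. Qed.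

Lemma of_realM (x y : R) : of_real s (x * y) = of_real s x * of_real s y.
Proof. by case: s => //=; rewrite rmorphM. Qed.

Lemma of_real0 : of_real s 0 = 0 :> K. Proof. by case: s. Qed.
Lemma of_real1 : of_real s 1 = 1 :> K. Proof. by case: s. Qed.

Lemma modulusE (x : K) : `|x| = of_real s (modulus x).
Proof. by rewrite /modulus of_real_real_part. Qed.

Lemma of_real_inj : injective (of_real s : R -> K).
Proof. exact: can_inj of_realK. Qed.

Lemma modulus_ge0 (x : K) : 0 <= modulus x.
Proof. by rewrite -le_of_real of_real0 -modulusE. Qed.

Lemma modulusM (x y : K) : modulus (x * y) = modulus x * modulus y.
Proof. by apply: of_real_inj; rewrite of_realM -!modulusE normrM. Qed.

Lemma ler_modulusD (x y : K) : modulus (x + y) <= modulus x + modulus y.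
Proof. by rewrite -le_of_real of_realD -!modulusE ler_normD. Qed.

Lemma modulus0 : modulus (0 : K) = 0.
Proof. by apply: of_real_inj; rewrite -modulusE normr0 of_real0. Qed.

Lemma modulus1 : modulus (1 : K) = 1.
Proof. by apply: of_real_inj; rewrite -modulusE normr1 of_real1. Qed.

Lemma modulusN (x : K) : modulus (- x) = modulus x.
Proof. by apply: of_real_inj; rewrite -!modulusE normrN. Qed.

Lemma modulus0_eq0 (x : K) : modulus x = 0 -> x = 0.
Proof. by move=> x0; apply/normr0_eq0; rewrite modulusE x0 of_real0. Qed.

Lemma modulus_of_real (r : R) : modulus (of_real s r) = `|r|.
Proof.
apply: of_real_inj; rewrite -modulusE; case: s => //=.
by rewrite normc_def /= expr0n addr0 sqrtr_sqr.
Qed.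

Lemma ler_modulus_sum (I : Type) (r : seq I) (P : pred I) (F : I -> K) :
  modulus (\sum_(i <- r | P i) F i) <= \sum_(i <- r | P i) modulus (F i).
Proof.
elim/big_ind2 : _ => [|x1 x2 y1 y2 h1 h2|//]; first by rewrite modulus0.
by rewrite (le_trans (ler_modulusD _ _))// lerD.
Qed.

Lemma exists_phase (x : K) :
  exists2 t : K, modulus t <= 1 & t * x = of_real s (modulus x).
Proof.
have [->|x0] := eqVneq x 0.
  by exists 0; rewrite ?mul0r ?modulus0 ?of_real0.
have mx0 : modulus x != 0.
  by apply/eqP => /modulus0_eq0 h; rewrite h eqxx in x0.
exists (of_real s (modulus x) / x); last by rewrite divfK.
rewrite -le_of_real -modulusE normf_div !modulusE modulus_of_real.
by rewrite ger0_norm ?modulus_ge0// of_real1 divff// -of_real0 (inj_eq of_real_inj).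
Qed.

Section NormedModule.
Variable X : normedModType K.
Implicit Types x y : X.

Lemma normRE x : `|x| = of_real s (normR x).
Proof. by rewrite /normR of_real_real_part. Qed.

Lemma normR_ge0 x : 0 <= normR x.
Proof. by rewrite -le_of_real of_real0 -normRE. Qed.

Lemma ler_normRD x y : normR (x + y) <= normR x + normR y.
Proof. by rewrite -le_of_real of_realD -!normRE ler_normD. Qed.

Lemma normRN x : normR (- x) = normR x.
Proof. by apply: of_real_inj; rewrite -!normRE normrN. Qed.

Lemma cvg_normRP (F : set_system X) (FF : Filter F) (l : X) :
  F --> l <-> forall e : R, 0 < e -> \forall x \near F, normR (l - x) < e.
Proof.
rewrite (_ : (F --> l) = (id @ F --> l))//; split => [/cvgrPdist_lt h e e0|h].
  have := h (of_real s e); rewrite -of_real0 lt_of_real => /(_ e0).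
  by apply: filterS => x; rewrite normRE lt_of_real.
apply/cvgrPdist_lt => e e0; have e0' := ltW e0.
rewrite -(of_real_real_part e0') -of_real0 lt_of_real in e0.
have := h _ e0; apply: filterS => x /=.
by rewrite -lt_of_real -normRE of_real_real_part.
Qed.

Lemma cauchy_normRP (F : set_system X) (FF : ProperFilter F) :
  cauchy F <-> forall e : R, 0 < e -> exists x, F [set y | normR (x - y) < e].
Proof.
rewrite cauchyP; split => h e e0.
  have [|x] := h (of_real s e); first by rewrite -of_real0 lt_of_real.
  by move=> hx; exists x; move: hx; apply: filterS => y;
    rewrite -ball_normE /ball_ /= normRE lt_of_real.
have e0' := ltW e0; rewrite -(of_real_real_part e0') -of_real0 lt_of_real in e0.
have [x hx] := h _ e0; exists x; move: hx; apply: filterS => y.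
by rewrite -ball_normE /ball_ /= normRE -{2}(of_real_real_part e0') lt_of_real.
Qed.

End NormedModule.

Lemma modulus_normR (x : K) : normR (x : K^o) = modulus x. Proof. by []. Qed.

End Scalars.

Section ScalarTopology.
Context (R : realType) (s : scalars).
Local Notation K := (scalar_field R s).

Lemma modulus_Re (z : R[i]) : `|complex.Re z| <= modulus (z : scalar_field R ComplexScalars).
Proof. by rewrite -(@le_of_real R ComplexScalars) -modulusE /=; exact: normc_ge_Re. Qed.

Lemma modulus_Im (z : R[i]) : `|complex.Im z| <= modulus (z : scalar_field R ComplexScalars).
Proof.
have -> : modulus (z : scalar_field R ComplexScalars) = Num.sqrt (complex.Re z ^+ 2 +
  complex.Im z ^+ 2).
  by apply: (@of_real_inj R ComplexScalars); rewrite -modulusE normc_def.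
by rewrite -sqrtr_sqr ler_wsqrtr// lerDr sqr_ge0.
Qed.

Lemma modulus_Re_Im (z : R[i]) : modulus (z : scalar_field R ComplexScalars) <=
  `|complex.Re z| + `|complex.Im z|.
Proof.
have -> : modulus (z : scalar_field R ComplexScalars) = Num.sqrt (complex.Re z ^+ 2 +
  complex.Im z ^+ 2).
  by apply: (@of_real_inj R ComplexScalars); rewrite -modulusE normc_def.
rewrite -[leRHS]ger0_norm ?addr_ge0// -sqrtr_sqr ler_wsqrtr//.
rewrite -[in leLHS](real_normK (num_real (complex.Re z))) -[in leLHS](real_normK (num_real
  (complex.Im z))).
rewrite sqrrD -addrA (addrC (_ *+ 2)) addrA lerDl mulrn_wge0// mulr_ge0//.
Qed.

(** For complex scalars the real and imaginary parts converge separately. *)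
Lemma scalar_complete (F : set_system K) : ProperFilter F ->
  (forall e : R, 0 < e -> exists x, F [set y | modulus (x - y) < e]) ->
  exists l : K, forall e : R, 0 < e -> \forall x \near F, modulus (l - x) < e.
Proof.
case: s F => [|] F FF hF.
  have : cvg (F : set_system R).
    apply: cauchy_cvg; apply/cauchyP => e e0.
    by have [x hx] := hF e e0; exists x; rewrite -ball_normE.
  case/cvg_ex => l hl; exists l => e e0.
  exact: ((@cvgrPdist_lt R R^o _ F _ id l).1 hl).
have part (f : R[i] -> R) : (forall z, `|f z| <= modulus (z : scalar_field R ComplexScalars)) ->
    (forall x y, f (x - y) = f x - f y) ->
    exists l : R, forall e : R, 0 < e -> \forall x \near F, `|l - f x| < e.
  move=> fm fB; have : cvg (f @ F).
    apply: cauchy_cvg; apply/cauchyP => e e0.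
    have [x hx] := hF e e0; exists (f x); rewrite -ball_normE /ball_ /=.
    move: hx; apply: filterS => y /=; apply: le_lt_trans.
    by rewrite -fB.
  case/cvg_ex => l hl; exists l => e e0.
  exact: ((@cvgrPdist_lt R R^o _ F _ f l).1 hl).
have [l1 h1] := part (@complex.Re R) modulus_Re (fun x y => raddfB _ x y).
have [l2 h2] := part (@complex.Im R) modulus_Im (fun x y => raddfB _ x y).
exists (l1 +i* l2)%C => e e0.
have e20 : 0 < e / 2 by rewrite divr_gt0.
near=> x; apply: le_lt_trans (modulus_Re_Im _) _.
rewrite !raddfB /= (splitr e) ltrD//; near: x; [exact: h1|exact: h2].
Unshelve. all: by end_near. Qed.

(** A complex disc is closed in the image of a square under the continuous map
    (a, b) |-> a + ib. *)
Lemma scalar_disc_compact (c : R) : compact [set z : K | modulus z <= c].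
Proof.
case: s => /=.
  rewrite (_ : [set z | _] = `[-c, c]%classic); first exact: segment_compact.
  apply/seteqP; split => z /=; rewrite in_itv /= -ler_norml//.
pose g (u : R * R) : scalar_field R ComplexScalars := (u.1 +i* u.2)%C.
have cg : continuous g.
  move=> u; apply/(@cvg_normRP R ComplexScalars (scalar_field R ComplexScalars)^o) => e e0.
  have e20 : 0 < e / 2 by rewrite divr_gt0.
  near=> v; rewrite modulus_normR; apply: le_lt_trans (modulus_Re_Im _) _.
  rewrite !raddfB /= (splitr e) ltrD//; near: v.
    by apply: (@cvgr_dist_lt _ R^o) => //; exact: cvg_fst.
  by apply: (@cvgr_dist_lt _ R^o) => //; exact: cvg_snd.
apply: (@subclosed_compact _ _ (g @` (`[-c, c] `*` `[-c, c]))).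
- move=> z zc; apply/ler_addgt0Pr => e e0.
  have [|y /= [yc zy]] := zc [set y | modulus (z - y) < e].
    pose X := (scalar_field R ComplexScalars)^o.
    exact: ((@cvg_normRP R ComplexScalars X (nbhs (z : X)) _ z).1 (fun A hA => hA) e e0).
  rewrite -(subrK y z) [leRHS]addrC (le_trans (@ler_modulusD R ComplexScalars _ _))// lerD// ltW//.
- apply: continuous_compact; first exact: continuous_subspaceT.
  by apply: compact_setX; exact: segment_compact.
- move=> z /= hz; exists (complex.Re z, complex.Im z); last by case: z hz.
  by rewrite !in_itv /= -!ler_norml (le_trans (modulus_Re _))//= (le_trans (modulus_Im _)).
Unshelve. all: by end_near. Qed.

End ScalarTopology.

(** * Banach spaces of sequences given by a family of seminorms *)

(** A norm on scalar sequences, presented as the supremum of the seminorms in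
    [gauge_set]. As each seminorm sees finitely many coordinates, a bound on it
    survives coordinatewise limits; as the norm controls each coordinate, Cauchy
    filters do have coordinatewise limits. Completeness follows in general,
    without separate proofs for each space below. *)
Record gauge (R : realType) (s : scalars) := Gauge {
  gauge_set : set ((nat -> (scalar_field R s)^o) -> R);
  gaugeD : forall phi, gauge_set phi -> forall a b, phi (a + b) <= phi a + phi b;
  gaugeZ : forall phi, gauge_set phi -> forall c a, phi (c *: a) = modulus c * phi a;
  gauge_finite : forall phi, gauge_set phi -> exists (N : nat) (C : R),
    0 <= C /\ forall a, phi a <= C * \sum_(i < N) modulus (a i);
  gauge_coord : forall i : nat, exists C : R, 0 <= C /\ forall a B,
    0 <= B -> (forall phi, gauge_set phi -> phi a <= B) -> modulus (a i) <= C * B }.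

Section GaugeSpace.
Context (R : realType) (s : scalars).
Local Notation K := (scalar_field R s).
Variable g : gauge R s.
Implicit Types (a b : nat -> K^o) (B : R).

Definition gball a B := forall phi, gauge_set g phi -> phi a <= B.

Lemma gauge0 phi : gauge_set g phi -> phi 0 = 0.
Proof. by move=> gp; rewrite -(scale0r 0) (gaugeZ gp) modulus0 mul0r. Qed.

Definition gbounded : {pred (nat -> K^o)} := fun a => `[< exists B, gball a B >].

Lemma gbounded_submod_closed : submod_closed gbounded.
Proof.
split=> [|c a b /asboolP[A hA] /asboolP[B hB]]; apply/asboolP.
  by exists 0 => phi gp; rewrite gauge0.
exists (modulus c * A + B) => phi gp.
rewrite (le_trans (gaugeD gp _ _))// (gaugeZ gp) lerD ?hB//.
by rewrite ler_wpM2l ?modulus_ge0// hA.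
Qed.

HB.instance Definition _ :=
  GRing.isSubmodClosed.Build K (nat -> K^o) gbounded gbounded_submod_closed.

Record seqsp := SeqSp { seqval :> nat -> K^o ; _ : seqval \in gbounded }.

HB.instance Definition _ := [isSub for seqval].
HB.instance Definition _ := [Choice of seqsp by <:].
HB.instance Definition _ := [SubChoice_isSubLmodule of seqsp by <:].

(** The value 0 is added so that the set is nonempty whatever the gauge is. *)
Definition gnorm_set (a : seqsp) : set R :=
  [set r | r = 0 \/ exists2 phi, gauge_set g phi & r = phi a].

Definition gnorm (a : seqsp) : R := sup (gnorm_set a).

Lemma gnorm_has_sup (a : seqsp) : has_sup (gnorm_set a).
Proof.
case: a => a /= ha; have /asboolP[B hB] := ha.
split; first by exists 0; left.
exists (Num.max 0 B) => r [->|[phi gp ->]]; rewrite le_max ?lexx//.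
by rewrite (hB _ gp) orbT.
Qed.

Lemma gnorm_ge0 (a : seqsp) : 0 <= gnorm a.
Proof. by apply: ub_le_sup; [exact: (gnorm_has_sup a).2|left]. Qed.

Lemma gauge_le_gnorm phi (a : seqsp) : gauge_set g phi -> phi a <= gnorm a.
Proof. by move=> gp; apply: ub_le_sup; [exact: (gnorm_has_sup a).2|right; exists phi]. Qed.

Lemma gnorm_le (a : seqsp) B : 0 <= B -> gball a B -> gnorm a <= B.
Proof.
move=> B0 aB; apply: ge_sup; first by exists 0; left.
by move=> r [->//|[phi gp ->]]; exact: aB.
Qed.

Lemma ler_gnormD (a b : seqsp) : gnorm (a + b) <= gnorm a + gnorm b.
Proof.
apply: gnorm_le => [|phi gp]; first by rewrite addr_ge0 ?gnorm_ge0.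
by rewrite (le_trans (gaugeD gp _ _))// lerD ?gauge_le_gnorm.
Qed.

Lemma gnormZ_le c (a : seqsp) : gnorm (c *: a) <= modulus c * gnorm a.
Proof.
apply: gnorm_le => [|phi gp]; first by rewrite mulr_ge0 ?gnorm_ge0 ?modulus_ge0.
by rewrite /= [leLHS](gaugeZ gp) ler_wpM2l ?modulus_ge0// gauge_le_gnorm.
Qed.

Lemma gnormZ c (a : seqsp) : gnorm (c *: a) = modulus c * gnorm a.
Proof.
apply/eqP; rewrite eq_le gnormZ_le/=.
have [->|c0] := eqVneq c 0; first by rewrite modulus0 mul0r gnorm_ge0.
have mc : 0 < modulus c.
  by rewrite lt_neqAle modulus_ge0 andbT eq_sym; apply: contraNneq c0 => /modulus0_eq0 ->.
rewrite -ler_pdivlMl//.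
have -> : (modulus c)^-1 = modulus c^-1.
  apply: (mulfI (lt0r_neq0 mc)); rewrite -modulusM !divff ?modulus1//.
  exact: lt0r_neq0.
by rewrite -[in leLHS](scalerK c0 a) gnormZ_le.
Qed.

Lemma coord_le_gnorm i : exists2 C : R, 0 <= C & forall a : seqsp, modulus (a i) <= C * gnorm a.
Proof.
have [C [C0 hC]] := gauge_coord g i; exists C => // a; apply: hC; first exact: gnorm_ge0.
by move=> phi gp; exact: gauge_le_gnorm.
Qed.

Definition gnormK (a : seqsp) : K := of_real s (gnorm a).

Fact gnormKD (a b : seqsp) : gnormK (a + b) <= gnormK a + gnormK b.
Proof. by rewrite /gnormK -of_realD le_of_real ler_gnormD. Qed.

Fact gnormKZ (c : K) (a : seqsp) : gnormK (c *: a) = `|c| * gnormK a.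
Proof. by rewrite /gnormK gnormZ of_realM -modulusE. Qed.

Fact gnormK0 (a : seqsp) : gnormK a = 0 -> a = 0.
Proof.
rewrite /gnormK -of_real0 => /of_real_inj a0; apply/val_inj/funext => i /=.
have [C _ /(_ a)] := coord_le_gnorm i; rewrite a0 mulr0 => h.
by apply: modulus0_eq0; apply/eqP; rewrite eq_le h modulus_ge0.
Qed.

HB.instance Definition _ := Lmodule_isNormed.Build K seqsp gnormKD gnormKZ gnormK0.

Lemma normR_gnorm (a : seqsp) : normR a = gnorm a.
Proof. by rewrite /normR (_ : `|a| = gnormK a) // of_realK. Qed.

(** The coordinatewise limit [l] of a Cauchy filter is its limit in norm: to
    bound [phi (l - x)], compare with one [y] that is norm-close to [x] and so
    near [l] on the finitely many coordinates seen by [phi] that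
    [phi (l - y)] is small. *)
Fact seqsp_complete (F : set_system seqsp) : ProperFilter F -> cauchy F -> cvg F.
Proof.
move=> FF /(@cauchy_normRP R s) Fc.
have FB (a b : seqsp) : seqval (a - b) = (a : nat -> K^o) - b by [].
have coord i : exists l : K, forall e : R, 0 < e ->
  \forall x \near F, modulus (l - (x : seqsp) i) < e.
  have [C C0 hC] := coord_le_gnorm i.
  have [e e0|l hl] := @scalar_complete R s _ (fmap_proper_filter (fun x : seqsp => (x i : K))
    FF); last by exists l.
  have C1 : 0 < C + 1 by rewrite ltr_wpDl.
  have [x hx] := Fc (e / (C + 1)) (divr_gt0 e0 C1).
  exists (x i); apply: (@filterS _ F _ _ _ _ hx) => y /=.
  rewrite normR_gnorm ltr_pdivlMr// mulrC => xy; apply: le_lt_trans (hC (x - y)) _.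
  by apply: le_lt_trans xy; rewrite ler_wpM2r ?gnorm_ge0// lerDl.
have {coord}[l hl] := choice coord.
have near_sum N (e : R) : 0 < e ->
  \forall x \near F, \sum_(i < N) modulus (l i - (x : seqsp) i) < e.
  elim: N e => [|N IH] e e0; first by apply: nearW => x; rewrite big_ord0.
  have e20 : 0 < e / 2 by rewrite divr_gt0.
  near=> x; rewrite big_ord_recr /= (splitr e) ltrD//; near: x; [exact: IH|exact: hl].
have near_gauge e : 0 < e -> \forall x \near F, gball (l - seqval x) e.
  move=> e0; have e40 : 0 < e / 2 / 2 by rewrite !divr_gt0.
  have [x0 hx0] := Fc _ e40.
  near=> x => phi gp.
  have [N [C [C0 hC]]] := gauge_finite gp.
  have C1 : 0 < C + 1 by rewrite ltr_wpDl.
  have e20 : 0 < e / 2 / (C + 1) by rewrite !divr_gt0.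
  have [y] : exists y, normR (x0 - y) < e / 2 / 2 /\ \sum_(i < N) modulus (l i - (y : seqsp) i)
    < e / 2 / (C + 1).
    near F => y; exists y; split; first by near: y; exact: hx0.
    by near: y; exact: near_sum.
  move=> [x0y ly].
  have -> : l - seqval x = (l - seqval y) + seqval (y - x) by rewrite FB addrA subrK.
  rewrite (le_trans (gaugeD gp _ _))// (splitr e) lerD//.
    rewrite (le_trans (hC _))// (le_trans _ (_ : (C + 1) * (e / 2 / (C + 1)) <= e / 2))//.
      by rewrite ler_pM// ?sumr_ge0// => [i _||]; rewrite ?modulus_ge0 ?lerDl// ltW.
    by rewrite mulrC divfK// gt_eqF.
  rewrite (le_trans (gauge_le_gnorm _ gp))// -normR_gnorm.
  have -> : y - x = - (x0 - y) + (x0 - x) by rewrite opprB addrA subrK.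
  rewrite (le_trans (ler_normRD _ _))// normRN (splitr (e / 2)) lerD// ltW//.
  by near: x; exact: hx0.
have lb : l \in gbounded.
  have [x hx] := filter_ex (near_gauge 1 ltr01).
  have -> : l = (l - seqval x) + seqval x by rewrite subrK.
  apply: rpredD; last exact: valP.
  by apply/asboolP; exists 1.
apply/cvg_ex; exists (SeqSp lb); apply/(@cvg_normRP R s) => e e0.
have e20 : 0 < e / 2 by rewrite divr_gt0.
apply: filterS (near_gauge _ e20) => x hx.
rewrite normR_gnorm; apply: (@le_lt_trans _ _ (e / 2)).
  by apply: gnorm_le => //; exact: ltW.
by rewrite ltr_pdivrMr// ltr_pMr// ltr1n.
Unshelve. all: by end_near. Qed.

HB.instance Definition _ := Uniform_isComplete.Build seqsp seqsp_complete.

Lemma seqval_sum (I : Type) (r : seq I) (P : pred I) (F : I -> seqsp) (j : nat) :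
  (\sum_(i <- r | P i) F i : seqsp) j = \sum_(i <- r | P i) F i j.
Proof. by elim/big_rec2 : _ => // i x y _ <-. Qed.

End GaugeSpace.

Section Inclusion.
Context (R : realType) (s : scalars).
Local Notation K := (scalar_field R s).
Variables g h : gauge R s.

Hypothesis gh : forall a B, 0 <= B -> gball g a B -> gball h a B.

Lemma incl_bounded (a : seqsp g) : seqval a \in gbounded h.
Proof.
apply/asboolP; exists (gnorm a); apply: gh; first exact: gnorm_ge0.
by move=> phi gp; exact: gauge_le_gnorm.
Qed.

Definition incl_fun (a : seqsp g) : seqsp h := SeqSp (incl_bounded a).

Fact incl_linear : linear incl_fun.
Proof. by move=> c a b; apply: val_inj. Qed.

HB.instance Definition _ := GRing.isLinear.Build K (seqsp g) (seqsp h) _ incl_fun incl_linear.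

Definition incl : {linear seqsp g -> seqsp h} := incl_fun.

Lemma incl_bounded_operator : bounded_operator incl.
Proof.
exists 1 => a; rewrite mul1r !normRE le_of_real !normR_gnorm gnorm_le ?gnorm_ge0//.
by apply: gh; [exact: gnorm_ge0|move=> phi gp; exact: gauge_le_gnorm].
Qed.

End Inclusion.

(** * Finite [l_p] norms *)

(** The formula of [lp_norm] on real sequences, so that the inequalities below
    need not be proved for each kind of scalars. *)
Definition rlp (R : realType) (p : \bar R) (E : {fset nat}) (x : nat -> R) : R :=
  match p with
  | r%:E => (\sum_(i <- E) x i `^ r) `^ r^-1
  | +oo%E => \big[Num.max/0]_(i <- E) x i
  | -oo%E => 0
  end.

Section RealLp.
Context (R : realType).
Implicit Types (p : \bar R) (E F : {fset nat}) (x y : nat -> R).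

Lemma exponentP p : (1%:E <= p)%E -> (exists2 r : R, 1 <= r & p = r%:E) \/ p = +oo%E.
Proof. by case: p => [r| |]; rewrite ?lee_fin// => r1; [left; exists r|right]. Qed.

Lemma rlp_fin (r : R) E x : rlp r%:E E x = (\sum_(i <- E) x i `^ r) `^ r^-1.
Proof. by []. Qed.

Lemma rlp_oo E x : rlp +oo%E E x = \big[Num.max/0]_(i <- E) x i.
Proof. by []. Qed.

Lemma ler_fsum_sub E F x : (forall i, 0 <= x i) -> (E `<=` F)%fset ->
  \sum_(i <- E) x i <= \sum_(i <- F) x i.
Proof.
move=> x0 /fsubsetP EF; rewrite [leRHS](big_fsetID _ [pred i | i \in E])/=.
have <- : \sum_(i <- E) x i = \sum_(i <- [fset i in F | i \in E]%fset) x i; last first.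
  by rewrite lerDl sumr_ge0.
apply: eq_fbigl => i.
by rewrite !inE/=; apply/idP/andP => [iE|[]//]; rewrite iE EF.
Qed.

Lemma le_bigmax_fset E x (C : R) : 0 <= C -> (forall i, i \in E -> x i <= C) ->
  \big[Num.max/0]_(i <- E) x i <= C.
Proof.
move=> C0 h; rewrite big_seq; elim/big_ind : _ => // a b ha hb.
by rewrite ge_max ha.
Qed.

Lemma bigmax_fset_ge E x i : i \in E -> x i <= \big[Num.max/0]_(j <- E) x j.
Proof. by move=> iE; rewrite (bigD1_seq i) ?fset_uniq//= le_max lexx. Qed.

Lemma rlp_ge0 p E x : 0 <= rlp p E x.
Proof.
case: p => [r| |]; [exact: powR_ge0| |exact: lexx].
by rewrite rlp_oo; elim/big_rec : _ => // i a _ ha; rewrite le_max ha orbT.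
Qed.

Lemma eq_rlp p E x y : {in E, x =1 y} -> rlp p E x = rlp p E y.
Proof.
case: p => [r| |] h; last by [].
  by rewrite !rlp_fin; congr (_ `^ _); apply: eq_big_seq => i iE; rewrite h.
by rewrite !rlp_oo; apply: eq_big_seq.
Qed.

Lemma ler_rlp p E x y : (1%:E <= p)%E -> (forall i, 0 <= x i) ->
  {in E, forall i, x i <= y i} -> rlp p E x <= rlp p E y.
Proof.
move=> p1 x0 h; have [[r r1 ->]|->] := exponentP p1; last first.
  rewrite !rlp_oo; apply: le_bigmax_fset => [|i iE];
    last by rewrite (le_trans (h _ iE)) ?bigmax_fset_ge.
  exact: (rlp_ge0 +oo%E E y).
rewrite !rlp_fin; have r0 : 0 <= r by rewrite (le_trans ler01).
have S0 z : 0 <= \sum_(i <- E) z i `^ r by rewrite sumr_ge0// => i _; exact: powR_ge0.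
apply: ge0_ler_powR; rewrite ?invr_ge0// ?nnegrE ?S0//.
rewrite big_seq [leRHS]big_seq; apply: ler_sum => i iE.
by apply: ge0_ler_powR; rewrite ?nnegrE// ?h// (le_trans (x0 i))// h.
Qed.

Lemma rlpZ p E x c : (1%:E <= p)%E -> 0 <= c -> (forall i, 0 <= x i) ->
  rlp p E (fun i => c * x i) = c * rlp p E x.
Proof.
move=> p1 c0 x0; have [[r r1 ->]|->] := exponentP p1; last first.
  by rewrite !rlp_oo; elim/big_rec2 : _ => [|i a b _ ->]; rewrite ?mulr0// maxr_pMr.
rewrite !rlp_fin; under eq_bigr do rewrite powRM//.
rewrite -mulr_sumr powRM ?powR_ge0//; last by rewrite sumr_ge0// => i _; exact: powR_ge0.
by rewrite -powRrM divff ?powRr1// gt_eqF// (lt_le_trans ltr01).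
Qed.

Lemma rlp_powR (r : R) E x : 1 <= r -> rlp r%:E E x `^ r = \sum_(i <- E) x i `^ r.
Proof.
move=> r1; rewrite rlp_fin -powRrM mulVf ?powRr1//.
  by rewrite sumr_ge0// => i _; exact: powR_ge0.
by rewrite gt_eqF// (lt_le_trans ltr01).
Qed.

Lemma rlp_le (r : R) E x C : 1 <= r -> 0 <= C ->
  \sum_(i <- E) x i `^ r <= C `^ r -> rlp r%:E E x <= C.
Proof.
move=> r1 C0; rewrite -rlp_powR//; apply: contraTT; rewrite -!ltNge => h.
by rewrite gt0_ltr_powR// ?nnegrE ?rlp_ge0// (lt_le_trans ltr01).
Qed.

Lemma le_rlp (r : R) E x C : 1 <= r -> 0 <= C ->
  C `^ r <= \sum_(i <- E) x i `^ r -> C <= rlp r%:E E x.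
Proof.
move=> r1 C0; rewrite -rlp_powR//; apply: contraTT; rewrite -!ltNge => h.
by rewrite gt0_ltr_powR// ?nnegrE ?rlp_ge0// (lt_le_trans ltr01).
Qed.

Lemma powR_convex (r t u v : R) : 1 <= r -> 0 <= t <= 1 -> 0 <= u -> 0 <= v ->
  (t * u + (1 - t) * v) `^ r <= t * u `^ r + (1 - t) * v `^ r.
Proof.
move=> r1 t01 u0 v0.
have := @convex_powR R r r1 (Itv01 (proj1 (andP t01)) (proj2 (andP t01))) u v.
by rewrite !inE /= !in_itv /= !andbT => /(_ u0 v0); rewrite !convRE.
Qed.

Lemma rlp_eq0 p E x : (1%:E <= p)%E -> (forall i, 0 <= x i) -> rlp p E x = 0 ->
  {in E, forall i, x i = 0}.
Proof.
move=> p1 x0 h i iE; move: h; have [[r r1 ->]|->] := exponentP p1 => h; last first.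
  by apply/eqP; rewrite eq_le x0 andbT -h rlp_oo bigmax_fset_ge.
have r0 : r != 0 by rewrite gt_eqF// (lt_le_trans ltr01).
have /esym/eqP := rlp_powR E x r1; rewrite h powR0//.
rewrite psumr_eq0; last by move=> j _; exact: powR_ge0.
by move=> /allP/(_ i iE) /= /eqP; exact: powR_eq0_eq0.
Qed.

(** Minkowski's inequality: normalize both vectors, write the sum as a convex
    combination scaled by the sum of the norms, and use convexity of the power. *)
Lemma ler_rlpD p E x y : (1%:E <= p)%E -> (forall i, 0 <= x i) -> (forall i, 0 <= y i) ->
  rlp p E (fun i => x i + y i) <= rlp p E x + rlp p E y.
Proof.
move=> p1 x0 y0.
have [A0|A0] := eqVneq (rlp p E x) 0.
  rewrite A0 add0r (@eq_rlp _ _ _ y)// => i iE.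
  by rewrite (rlp_eq0 p1 x0 A0)// add0r.
have [B0|B0] := eqVneq (rlp p E y) 0.
  rewrite B0 addr0 (@eq_rlp _ _ _ x)// => i iE.
  by rewrite (rlp_eq0 p1 y0 B0)// addr0.
have [[r r1 pE]|pE] := exponentP p1; rewrite pE in p1 A0 B0 *; last first.
  rewrite [leLHS]rlp_oo; apply: le_bigmax_fset => [|i iE]; first by rewrite addr_ge0 ?rlp_ge0.
  by rewrite !rlp_oo lerD// bigmax_fset_ge.
have : 0 < rlp r%:E E x by rewrite lt_neqAle eq_sym A0 rlp_ge0.
have : 0 < rlp r%:E E y by rewrite lt_neqAle eq_sym B0 rlp_ge0.
move: A0 B0 => _ _; move BE : (rlp r%:E E y) => B; move AE : (rlp r%:E E x) => A B0 A0.
have S0 : 0 < A + B by rewrite addr_gt0.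
apply: rlp_le => //; first exact: ltW.
pose t := A / (A + B).
have t01 : 0 <= t <= 1.
  by rewrite /t divr_ge0 ?(ltW A0) ?(ltW S0)//= ler_pdivrMr// mul1r lerDl ltW.
have t1 : 1 - t = B / (A + B) by rewrite /t; field; rewrite gt_eqF.
apply: (@le_trans _ _ (\sum_(i <- E) (A + B) `^ r * (t * (x i / A) `^ r +
  (1 - t) * (y i / B) `^ r))).
  apply: ler_sum => i _.
  have -> : x i + y i = (A + B) * (t * (x i / A) + (1 - t) * (y i / B)).
    by rewrite t1 /t; field; rewrite !gt_eqF.
  have [u0 v0] : 0 <= x i / A /\ 0 <= y i / B by rewrite !divr_ge0 ?(ltW A0) ?(ltW B0).
  have [t0 t1'] := andP t01.
  rewrite powRM ?(ltW S0)//; last by rewrite addr_ge0// mulr_ge0// subr_ge0.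
  by rewrite ler_wpM2l ?powR_ge0// powR_convex.
have aux (z : nat -> R) Z : (forall i, 0 <= z i) -> 0 < Z -> rlp r%:E E z = Z ->
  \sum_(i <- E) (z i / Z) `^ r = 1.
  move=> z0 Z0 zZ.
  under eq_bigr do rewrite mulrC.
  rewrite -rlp_powR// rlpZ// ?invr_ge0 ?ltW// ?zZ ?mulVf ?powR1//.
  by rewrite gt_eqF.
rewrite -mulr_sumr big_split /= -!mulr_sumr !aux// !mulr1 addrC subrK mulr1//.
Qed.

Lemma sub_rlp p E F x : (1%:E <= p)%E -> (forall i, 0 <= x i) -> (E `<=` F)%fset ->
  rlp p E x <= rlp p F x.
Proof.
move=> p1 x0 /fsubsetP EF; have [[r r1 ->]|->] := exponentP p1; last first.
  rewrite !rlp_oo; apply: le_bigmax_fset => [|i iE]; last by rewrite bigmax_fset_ge// EF.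
  exact: (rlp_ge0 +oo%E F x).
apply: rlp_le => //; first exact: rlp_ge0.
rewrite rlp_powR//.
by apply: ler_fsum_sub; [move=> i; exact: powR_ge0|exact/fsubsetP].
Qed.

Lemma rlp1 p i x : (1%:E <= p)%E -> 0 <= x i -> rlp p [fset i]%fset x = x i.
Proof.
move=> p1 xi; have [[r r1 ->]|->] := exponentP p1; last first.
  apply/eqP; rewrite eq_le rlp_oo le_bigmax_fset ?bigmax_fset_ge ?inE// => j.
  by rewrite inE => /eqP ->.
by rewrite rlp_fin big_seq_fset1 -powRrM divff ?powRr1// gt_eqF// (lt_le_trans ltr01).
Qed.

Lemma le_coord_rlp p E x i : (1%:E <= p)%E -> (forall i, 0 <= x i) -> i \in E -> x i <= rlp p E x.
Proof.
move=> p1 x0 iE; rewrite -(rlp1 p1 (x0 i)) sub_rlp//.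
by apply/fsubsetP => j; rewrite inE => /eqP ->.
Qed.

Lemma rlp0 p E x : (1%:E <= p)%E -> {in E, forall i, x i = 0} -> rlp p E x = 0.
Proof.
move=> p1 h; rewrite (@eq_rlp _ _ _ (fun i => 0 * (fun=> 0) i)); last by move=> i iE;
  rewrite mul0r h.
by rewrite rlpZ// mul0r.
Qed.

Lemma rlp_sum p E (I : Type) (r : seq I) (x : I -> nat -> R) :
  (1%:E <= p)%E -> (forall k i, 0 <= x k i) ->
  rlp p E (fun i => \sum_(k <- r) x k i) <= \sum_(k <- r) rlp p E (x k).
Proof.
move=> p1 x0; elim: r => [|k r IH].
  by rewrite big_nil rlp0// => i _; rewrite big_nil.
rewrite big_cons (@eq_rlp _ _ _ (fun i => x k i + \sum_(k <- r) x k i)) => [|i _];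
  last by rewrite big_cons.
by rewrite (le_trans (ler_rlpD _ p1 _ _))// ?lerD// => i; rewrite sumr_ge0.
Qed.

Lemma rlp_le_sum p E x : (1%:E <= p)%E -> (forall i, 0 <= x i) -> rlp p E x <= \sum_(i <- E) x i.
Proof.
move=> p1 x0.
rewrite (@eq_rlp _ _ _ (fun j => \sum_(i <- E) (if j == i then x i else 0))); last first.
  by move=> j jE; rewrite (bigD1_seq j) ?fset_uniq//= eqxx big1 ?addr0// => i /negbTE;
    rewrite eq_sym => ->.
rewrite (le_trans (rlp_sum _ _ _ _))//; first by move=> k i; case: ifP.
rewrite big_seq [leRHS]big_seq; apply: ler_sum => i iE.
rewrite (le_trans (sub_rlp p1 _ (F := E) _))//; first by move=> j; case: ifP.
have [[r r1 ->]|->] := exponentP p1; last first.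
  by rewrite rlp_oo; apply: le_bigmax_fset => // j _; case: ifP.
apply: rlp_le => //.
rewrite (bigD1_seq i) ?fset_uniq//= eqxx big1 ?addr0// => j /negbTE ->.
by rewrite powR0// gt_eqF// (lt_le_trans ltr01).
Qed.

End RealLp.

Section ScalarLp.
Context (R : realType) (s : scalars).
Local Notation K := (scalar_field R s).
Implicit Types (p : \bar R) (E F G H : {fset nat}) (a b c : nat -> K).

Lemma lp_normE p E a : lp_norm p E a = rlp p E (fun i => modulus (a i)).
Proof. by case: p. Qed.

Lemma lp_norm_ge0 p E a : 0 <= lp_norm p E a.
Proof. by rewrite lp_normE rlp_ge0. Qed.

Lemma ler_lp_norm p E a b : (1%:E <= p)%E ->
  {in E, forall i, modulus (a i) <= modulus (b i)} -> lp_norm p E a <= lp_norm p E b.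
Proof. by move=> p1 h; rewrite !lp_normE ler_rlp// => i; exact: modulus_ge0. Qed.

Lemma eq_lp_norm p E a b : {in E, a =1 b} -> lp_norm p E a = lp_norm p E b.
Proof. by move=> h; rewrite !lp_normE; apply: eq_rlp => i /h ->. Qed.

Lemma lp_normZ p E (t : K) a : (1%:E <= p)%E ->
  lp_norm p E (fun i => t * a i) = modulus t * lp_norm p E a.
Proof.
move=> p1; rewrite !lp_normE -rlpZ ?modulus_ge0// => [|i]; last exact: modulus_ge0.
by apply: eq_rlp => i _; rewrite modulusM.
Qed.

Lemma ler_lp_normD p E a b : (1%:E <= p)%E ->
  lp_norm p E (fun i => a i + b i) <= lp_norm p E a + lp_norm p E b.
Proof.
move=> p1; rewrite !lp_normE (le_trans _ (ler_rlpD _ p1 _ _))//; last 2 first.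
- by move=> i; exact: modulus_ge0.
- by move=> i; exact: modulus_ge0.
apply: ler_rlp => // [i|i _]; first exact: modulus_ge0.
exact: ler_modulusD.
Qed.

Lemma sub_lp_norm p E F a : (1%:E <= p)%E -> (E `<=` F)%fset -> lp_norm p E a <= lp_norm p F a.
Proof. by move=> p1 EF; rewrite !lp_normE sub_rlp// => i; exact: modulus_ge0. Qed.

Lemma lp_norm1 p i a : (1%:E <= p)%E -> lp_norm p [fset i]%fset a = modulus (a i).
Proof. by move=> p1; rewrite lp_normE rlp1// modulus_ge0. Qed.

Lemma le_coord_lp_norm p E a i : (1%:E <= p)%E -> i \in E -> modulus (a i) <= lp_norm p E a.
Proof.
by move=> p1 iE; rewrite lp_normE (@le_coord_rlp _ p E (fun i => modulus (a i)) i)// => j;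
  exact: modulus_ge0.
Qed.

Lemma lp_norm_le_sum p E a : (1%:E <= p)%E -> lp_norm p E a <= \sum_(i <- E) modulus (a i).
Proof. by move=> p1; rewrite lp_normE rlp_le_sum// => i; exact: modulus_ge0. Qed.

Lemma lp_norm0 p E a : (1%:E <= p)%E -> {in E, forall i, a i = 0} -> lp_norm p E a = 0.
Proof. by move=> p1 h; rewrite lp_normE rlp0// => i /h ->; rewrite modulus0. Qed.

Lemma lp_norm_sum p E (I : Type) (r : seq I) (x : I -> nat -> K) : (1%:E <= p)%E ->
  lp_norm p E (fun i => \sum_(k <- r) x k i) <= \sum_(k <- r) lp_norm p E (x k).
Proof.
move=> p1; elim: r => [|k r IH].
  by rewrite big_nil lp_norm0// => i _; rewrite big_nil.
rewrite big_cons (@eq_lp_norm _ _ _ (fun i => x k i + \sum_(k <- r) x k i)) => [|i _];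
  last by rewrite big_cons.
by rewrite (le_trans (ler_lp_normD _ _ _ p1))// lerD.
Qed.

Lemma lp_norm_support p E F a : (1%:E <= p)%E ->
  (forall i, i \in E -> i \notin F -> a i = 0) -> lp_norm p E a <= lp_norm p F a.
Proof.
move=> p1 h; rewrite (le_trans _ (sub_lp_norm a p1 (fsubsetIr E F)))//.
have [[r r1 ->]|->] := exponentP p1; rewrite !lp_normE; last first.
  rewrite [leLHS]rlp_oo; apply: le_bigmax_fset => [|i iE]; first exact: rlp_ge0.
  have [iF|/(h i iE) ->] := boolP (i \in F); last by rewrite modulus0 rlp_ge0.
  by rewrite rlp_oo (@bigmax_fset_ge _ _ (fun i => modulus (a i)))// inE iE.
apply: rlp_le => //; first exact: rlp_ge0.
rewrite rlp_powR// (big_fsetID _ [pred i | i \in F])/= [X in _ + X]big_seq [X in _ + X]big1 ?addr0.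
  by rewrite le_eqVlt; apply/orP; left; apply/eqP/eq_fbigl => i; rewrite !inE.
move=> i; rewrite !inE/= => /andP[iE iF]; rewrite h// modulus0 powR0//.
by rewrite gt_eqF// (lt_le_trans ltr01).
Qed.

Section Disjoint.
Variables (v : nat -> nat -> K) (G : {fset nat}).
Hypothesis v_disj : forall i k l, v k i != 0 -> v l i != 0 -> k = l.

(** Disjointness means that at each coordinate at most one summand is nonzero,
    so sums commute with moduli and powers there. *)
Lemma disjoint_coord c i : (forall k, k \in G -> v k i = 0) \/
  exists k, [/\ k \in G, v k i != 0, \sum_(k <- G) c k * v k i = c k * v k i &
    forall r : R, r != 0 ->
      \sum_(k <- G) modulus (c k * v k i) `^ r = modulus (c k * v k i) `^ r].
Proof.
have [h|] := pselect (forall k, k \in G -> v k i = 0); first by left.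
move=> /existsNP[k] /not_implyP[kG /eqP vk]; right; exists k.
have z l : l != k -> v l i = 0.
  by move=> lk; apply/eqP; apply: contraNT lk => /v_disj/(_ vk) ->.
split=> // [|r r0]; rewrite (bigD1_seq k) ?fset_uniq//= big1 ?addr0// => l /z ->; rewrite mulr0//.
by rewrite modulus0 powR0.
Qed.

(** Disjoint vectors of norm at most [C] are dominated by the unit vector basis.
    The set [H] may be smaller than [G]: only the vectors that meet [E] count,
    and this is what lets a Schreier set [E] see few of the blocks. *)
Lemma lp_norm_disjoint_le p E H c (C : R) : (1%:E <= p)%E -> 0 <= C ->
  (forall k, lp_norm p E (v k) <= C) ->
  (forall k i, k \in G -> i \in E -> v k i != 0 -> k \in H) ->
  lp_norm p E (fun i => \sum_(k <- G) c k * v k i) <= C * lp_norm p H c.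
Proof.
move=> p1 C0 vC GH; have CH0 : 0 <= C * lp_norm p H c by rewrite mulr_ge0 ?lp_norm_ge0.
have [[r r1 pE]|pE] := exponentP p1; rewrite {}pE in p1 vC CH0 *; last first.
  rewrite [leLHS]lp_normE rlp_oo; apply: le_bigmax_fset => // i iE.
  have [h|[k [kG vk -> _]]] := disjoint_coord c i.
    by rewrite big_seq big1 ?modulus0// => k /h ->; rewrite mulr0.
  rewrite modulusM mulrC ler_pM ?modulus_ge0//.
    by rewrite (le_trans (le_coord_lp_norm (v k) p1 iE)).
  by rewrite le_coord_lp_norm// (GH k i).
have r0 : r != 0 by rewrite gt_eqF// (lt_le_trans ltr01).
rewrite [leLHS]lp_normE; apply: rlp_le => //.
rewrite powRM ?lp_norm_ge0// lp_normE rlp_powR// mulr_sumr.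
apply: (@le_trans _ _ (\sum_(i <- E) \sum_(k <- H) modulus (c k) `^ r * modulus (v k i) `^ r)).
  rewrite big_seq [leRHS]big_seq; apply: ler_sum => i iE.
  have [h|[k [kG vk -> _]]] := disjoint_coord c i.
    rewrite big_seq big1 => [|k /h ->]; last by rewrite mulr0.
    rewrite modulus0 powR0//.
    by rewrite sumr_ge0// => k _; rewrite mulr_ge0 ?powR_ge0.
  rewrite (bigD1_seq k) ?fset_uniq ?(GH k i)//= modulusM powRM ?modulus_ge0// lerDl.
  by rewrite sumr_ge0// => l _; rewrite mulr_ge0 ?powR_ge0.
rewrite exchange_big /=; apply: ler_sum => k _; rewrite -mulr_sumr mulrC.
rewrite ler_wpM2r ?powR_ge0// -rlp_powR// ge0_ler_powR ?nnegrE ?rlp_ge0//.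
  by rewrite (le_trans ler01).
by rewrite -lp_normE.
Qed.

Lemma lp_norm_disjoint_ge (r : R) c (delta : R) : 1 <= r -> 0 <= delta ->
  (forall k, k \in G -> exists E, delta <= lp_norm r%:E E (v k)) ->
  exists E, delta * lp_norm r%:E G c <= lp_norm r%:E E (fun i => \sum_(k <- G) c k * v k i).
Proof.
move=> r1 d0 vd; have r0 : r != 0 by rewrite gt_eqF// (lt_le_trans ltr01).
have [k|e he] := @choice nat {fset nat} (fun k E => k \in G -> delta <= lp_norm r%:E E (v k)).
  by have [/vd[E hE]|kG] := boolP (k \in G); [exists E|exists fset0].
pose E := (\bigcup_(k <- G) e k)%fset; exists E.
rewrite [leRHS]lp_normE; apply: le_rlp => //; first by rewrite mulr_ge0 ?lp_norm_ge0.
rewrite powRM ?lp_norm_ge0// lp_normE rlp_powR// mulr_sumr.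
apply: (@le_trans _ _ (\sum_(i <- E) \sum_(k <- G) modulus (c k * v k i) `^ r)).
  rewrite exchange_big /= big_seq [leRHS]big_seq; apply: ler_sum => k kG.
  under eq_bigr do rewrite modulusM powRM ?modulus_ge0//.
  rewrite -mulr_sumr mulrC ler_wpM2l ?powR_ge0// -rlp_powR//.
  rewrite ge0_ler_powR ?nnegrE ?rlp_ge0// ?(le_trans ler01)// -lp_normE.
  rewrite (le_trans (he k kG))// sub_lp_norm ?lee_fin//.
  by apply/fsubsetP => i ie; apply/bigfcupP; exists k; rewrite ?kG.
apply: ler_sum => i _.
have [h|[k [kG vk -> ->//]]] := disjoint_coord c i.
by rewrite big_seq big1 ?powR_ge0// => k /h ->; rewrite mulr0 modulus0 powR0.
Qed.

End Disjoint.
End ScalarLp.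

(** * Covering numbers and Schreier families *)

Section Covering.
Implicit Types (E G H : {fset nat}) (F : set {fset nat}).

Definition fbelow (t : nat) E : {fset nat} := [fset i in E | (i < t)%N]%fset.
Definition fabove (t : nat) E : {fset nat} := [fset i in E | (t <= i)%N]%fset.

(** [covered F n E] says that [E] is a union of [n] successive members of [F],
    some possibly empty. Recording the points where [E] is cut, instead of the
    pieces, makes heredity and spreading plain inductions on [n]. *)
Fixpoint covered F (n : nat) E : Prop :=
  if n is n'.+1 then exists2 t, F (fbelow t E) & covered F n' (fabove t E)
  else E = fset0.

Definition hereditary F := forall E G, (G `<=` E)%fset -> F E -> F G.

Definition spreading F := forall E (f : nat -> nat), {in E &, {homo f : i j / (i < j)%N}} ->
  (forall i, i \in E -> (i <= f i)%N) -> F E -> F [fset f i | i in E]%fset.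

(** The least strict upper bound, which makes sense for the empty set. *)
Definition fsup E : nat := \max_(i <- E) i.+1.

Lemma lt_fsup E i : i \in E -> (i < fsup E)%N.
Proof. by move=> iE; rewrite /fsup (bigD1_seq i) ?fset_uniq//= leq_max ltnSn. Qed.

Lemma fsup_le E t : (forall i, i \in E -> (i < t)%N) -> (fsup E <= t)%N.
Proof.
move=> h; rewrite /fsup big_seq; elim/big_ind : _ => // i j it jt.
by rewrite geq_max it.
Qed.

Lemma fbelow_fsup E : fbelow (fsup E) E = E.
Proof. by apply/fsetP => i; rewrite !inE/=; case: (boolP (i \in E)) => // /lt_fsup ->. Qed.

Lemma fabove_fsup E : fabove (fsup E) E = fset0.
Proof.
apply/fsetP => i; rewrite !inE/=; case: (boolP (i \in E)) => //= /lt_fsup.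
by rewrite ltnNge => /negbTE.
Qed.

Lemma fbelowS t E G : (G `<=` E)%fset -> (fbelow t G `<=` fbelow t E)%fset.
Proof. by move=> /fsubsetP GE; apply/fsubsetP => i; rewrite !inE/= => /andP[/GE -> ->]. Qed.

Lemma faboveS t E G : (G `<=` E)%fset -> (fabove t G `<=` fabove t E)%fset.
Proof. by move=> /fsubsetP GE; apply/fsubsetP => i; rewrite !inE/= => /andP[/GE -> ->]. Qed.

Lemma covered_hereditary F n : hereditary F -> hereditary (covered F n).
Proof.
move=> hF; elim: n => [|n IH] E G GE /=; first by move=> E0; move: GE; rewrite E0 fsubset0 => /eqP.
by move=> [t Fb Fa]; exists t; [apply: hF Fb; exact: fbelowS|apply: IH Fa; exact: faboveS].
Qed.

(** If [E] is cut at [t], its image under [f] is cut just after the image of the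
    part of [E] below [t]. *)
Lemma covered_spreading F n : spreading F -> spreading (covered F n).
Proof.
move=> sF; elim: n => [|n IH] E f fE leE /=.
  move=> ->; apply/fsetP => i; rewrite inE; apply/negbTE/imfsetP => -[j]; by rewrite inE.
move=> [t Fb Fa].
have bE i : i \in fbelow t E -> i \in E by rewrite !inE/= => /andP[].
have aE i : i \in fabove t E -> i \in E by rewrite !inE/= => /andP[].
pose t' := fsup [fset f i | i in fbelow t E]%fset.
have lt1 i : i \in E -> (i < t)%N -> (f i < t')%N.
  by move=> iE it; apply: lt_fsup; apply: in_imfset; rewrite !inE/= iE it.
have lt2 i : i \in E -> (t <= i)%N -> (t' <= f i)%N.
  move=> iE ti; apply: fsup_le => j /imfsetP[k /=]; rewrite !inE/= => /andP[kE kt] ->.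
  by apply: fE => //; exact: leq_trans kt ti.
exists t'.
- rewrite (_ : fbelow _ _ = [fset f i | i in fbelow t E]%fset).
    by apply: sF Fb => [i j /bE iE /bE jE|i /bE]; [exact: fE|exact: leE].
  apply/fsetP => j; apply/idP/imfsetP => [|[i /= ib ->]].
    rewrite !inE/= => /andP[/imfsetP[i /= iE ->] it]; exists i => //.
    rewrite !inE/= iE ltnNge; apply/negP => /(lt2 _ iE); by rewrite leqNgt it.
  rewrite !inE/=; move: ib; rewrite !inE/= => /andP[iE it].
  by rewrite lt1// andbT; apply: in_imfset.
- rewrite (_ : fabove _ _ = [fset f i | i in fabove t E]%fset).
    by apply: IH Fa => [i j /aE iE /aE jE|i /aE]; [exact: fE|exact: leE].
  apply/fsetP => j; apply/idP/imfsetP => [|[i /= ib ->]].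
    rewrite !inE/= => /andP[/imfsetP[i /= iE ->] it]; exists i => //.
    rewrite !inE/= iE leqNgt; apply/negP => /(lt1 _ iE); by rewrite ltnNge it.
  rewrite !inE/=; move: ib; rewrite !inE/= => /andP[iE it].
  by rewrite lt2// andbT; apply: in_imfset.
Qed.

Lemma covered1 F E : F E -> covered F 1 E.
Proof. by exists (fsup E); rewrite ?fbelow_fsup//= fabove_fsup. Qed.

Lemma coveredS F n E : F fset0 -> covered F n E -> covered F n.+1 E.
Proof.
move=> F0 FE; exists 0%N.
  by rewrite (_ : fbelow _ _ = fset0)//; apply/fsetP => i; rewrite !inE/= andbF.
by rewrite (_ : fabove _ _ = E)//; apply/fsetP => i; rewrite !inE/= andbT.
Qed.

Lemma covered_cat F n m E G : fset_lt E G -> covered F n E -> covered F m G ->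
  covered F (n + m) (E `|` G)%fset.
Proof.
elim: n E => [|n IH] E EG /=; first by move=> ->; rewrite fset0U.
move=> [t Fb Fa] FG.
have bE i : i \in fbelow t E -> i \in E by rewrite !inE/= => /andP[].
have e1 i : i \in E -> (i < fsup (fbelow t E))%N = (i < t)%N.
  move=> iE; apply/idP/idP => it; last by apply: lt_fsup; rewrite !inE/= iE.
  apply: leq_trans it _; apply: fsup_le => j; by rewrite !inE/= => /andP[].
have e2 i : i \in G -> (fsup (fbelow t E) <= i)%N.
  by move=> iG; apply: fsup_le => j /bE jE; exact: EG.
exists (fsup (fbelow t E)).
  rewrite (_ : fbelow _ (E `|` G) = fbelow t E)%fset//; apply/fsetP => i; rewrite !inE/=.
  case: (boolP (i \in E)) => /= iE; first by rewrite e1.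
  by case: (boolP (i \in G)) => //= iG; rewrite ltnNge e2.
rewrite (_ : fabove _ (E `|` G) = fabove t E `|` G)%fset.
  by apply: IH => // i j; rewrite !inE/= => /andP[iE _]; exact: EG.
apply/fsetP => i; rewrite !inE/=; case: (boolP (i \in G)) => iG; first by rewrite !orbT e2.
by rewrite !orbF; case: (boolP (i \in E)) => //= iE; rewrite !(leqNgt _ i) e1.
Qed.

Lemma fset_min_in E : E != fset0 -> fset_min E \in E.
Proof.
move=> /fset0Pn[x xE]; rewrite /fset_min.
have : x \in sort leq E by rewrite mem_sort.
case h : (sort leq E) => [//|y l] _ /=.
by rewrite -(mem_sort leq) h mem_head.
Qed.

Lemma fset_min_le E i : i \in E -> (fset_min E <= i)%N.
Proof.
move=> iE; rewrite /fset_min; have : i \in sort leq E by rewrite mem_sort.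
have := sort_sorted leq_total E; case: (sort leq E) => [//|y l] /= yl.
by rewrite inE => /orP[/eqP ->//|il]; have /allP := order_path_min leq_trans yl; apply.
Qed.

Lemma covered_bigcup F n (B : 'I_n -> {fset nat}) :
  (forall i, F (B i)) -> (forall i j : 'I_n, (i < j)%N -> fset_lt (B i) (B j)) ->
  covered F n (\bigcup_(i in 'I_n) B i)%fset.
Proof.
elim: n B => [|n IH] B FB ltB; first by rewrite big_ord0.
rewrite big_ord_recr; move: (addn1 n) => en.
suff h : covered F (n + 1) (\bigcup_(i in 'I_n) B (widen_ord (leqnSn n) i) `|` B ord_max)%fset.
  by rewrite en in h.
apply: covered_cat; last exact: covered1.
  move=> i j /bigfcupP[k _ ik]; apply: ltB ik => /=.
  by rewrite ltn_ord.
by apply: IH => [i|i j ij]; [exact: FB|exact: ltB].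
Qed.

Lemma covered_blocks F n E : covered F n E -> exists m (B : 'I_m -> {fset nat}),
  [/\ (m <= n)%N, forall i, B i != fset0 /\ F (B i),
    forall i j : 'I_m, (i < j)%N -> fset_lt (B i) (B j) & E = (\bigcup_(i in 'I_m) B i)%fset].
Proof.
elim: n E => [|n IH] E /=.
  by move=> ->; exists 0%N, (fun=> fset0); split=> [//|[]//|[]//|]; rewrite big_ord0.
move=> [t Fb /IH[m [B [mn FB ltB aE]]]].
have EE : E = (fbelow t E `|` fabove t E)%fset.
  by apply/fsetP => i; rewrite !inE/= -andb_orr ltnNge orNb andbT.
have [b0|b0] := eqVneq (fbelow t E) fset0.
  exists m, B; split=> //; first exact: leqW.
  by rewrite EE b0 fset0U.
exists m.+1, (fun i => if unlift ord0 i is Some j then B j else fbelow t E); split => //.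
- by move=> i; case: unliftP => [j _|_] //; exact: FB.
- move=> i j; case: unliftP => [i' ->|->]; case: unliftP => [j' ->|->] //=.
    by rewrite /bump /= !add1n ltnS; exact: ltB.
  move=> _ x y; rewrite !inE/= => /andP[_ xt] yB.
  have : y \in fabove t E by rewrite aE; apply/bigfcupP; exists j' => //; rewrite mem_index_enum.
  by rewrite !inE/= => /andP[_]; exact: leq_trans.
rewrite big_ord_recl unlift_none [LHS]EE aE; congr (_ `|` _)%fset.
by apply: eq_bigr => i _; rewrite liftK.
Qed.

(** For the Schreier family, the condition on the set of minima of the blocks
    only bounds their number by the minimum of the union. *)
Lemma conv_schreierP F E : schreier_conv schreier F E <->
  E = fset0 \/ exists2 n, le_fset n E & covered F n E.
Proof.
split=> [[n [B [FB ltB sB ->]]]|].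
  have [n0|n0] := posnP n; first by left; subst n; rewrite big_ord0.
  right; exists n; last by apply: covered_bigcup => // i; exact: (FB i).2.
  set M := [fset fset_min (B i) | i in 'I_n]%fset in sB.
  have Min i : fset_min (B i) \in B i by apply: fset_min_in; exact: (FB i).1.
  have cM : #|` M| = n.
    rewrite card_in_imfset/= ?size_enum_ord -?cardE ?card_ord//.
    have lt_min (i j : 'I_n) : (i < j)%N -> fset_min (B i) <> fset_min (B j).
      by move=> lt ij; have := ltB _ _ lt _ _ (Min i) (Min j); rewrite ij ltnn.
    move=> i j _ _ ij; have [/lt_min/(_ ij)//|/lt_min/(_ (esym ij))//|] := ltngtP i j.
    exact: val_inj.
  move=> x /bigfcupP[i _ xi]; case: sB => [M0|]; first by move: n0; rewrite -cM M0 cardfs0.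
  rewrite cM => h; apply: leq_trans h _; apply: leq_trans (fset_min_le xi).
  by apply: fset_min_le; apply: in_imfset.
move=> [->|[n nE /covered_blocks[m [B [mn FB ltB EE]]]]].
  exists 0%N, (fun=> fset0); split=> [[]//|[]//||]; last by rewrite big_ord0.
  left; apply/fsetP => i; rewrite inE; apply/negbTE/imfsetP => -[[]]//.
exists m, B; split=> //.
set M := [fset fset_min (B i) | i in 'I_m]%fset.
have [M0|M0] := eqVneq M fset0; [by left|right].
apply: (@leq_trans n); last first.
  apply: nE; have /imfsetP[i _ ->] := fset_min_in M0.
  rewrite EE; apply/bigfcupP; exists i; first by rewrite mem_index_enum.
  by apply: fset_min_in; exact: (FB i).1.
apply: leq_trans mn; apply: leq_trans (leq_imfset_card _ _ _) _.
by rewrite /= -cardE card_ord.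
Qed.

End Covering.

Section SchreierHierarchy.
Context (d : Order.disp_t) (W : tbOrderType d) (hW : ordinals_upto_omega1 W).
Variable S : W -> set {fset nat}.
Hypothesis hS : schreier_hierarchy S.
Implicit Types (x y z zeta xi eta : W) (E G H : {fset nat}).

Lemma ordinal_ind (P : W -> Prop) : P \bot%O ->
  (forall y x, (y < \top)%O -> is_succ_of y x -> P x -> P y) ->
  (forall y, (y < \top)%O -> is_limit y -> (forall z, (z < y)%O -> P z) -> P y) ->
  P \top%O -> forall z, P z.
Proof.
case: hW => wf _ _ P0 PS PL PT; elim/(well_founded_ind wf) => y IH.
have [->//|y0] := eqVneq y \bot%O.
have [->//|yT] := eqVneq y \top%O.
have {}yT : (y < \top)%O by rewrite ltx1.
have [[x xy]|nS] := pselect (is_successor y).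
  by apply: (PS _ x) => //; apply: IH; case: xy.
by apply: PL => //; split=> //; rewrite lt0x.
Qed.

Lemma exists_succ x xi : (x < xi)%O -> exists2 eta, is_succ_of eta x & (eta <= xi)%O.
Proof.
case: hW => wf _ _; elim/(well_founded_ind wf) : xi => xi IH xxi.
have [h|] := pselect (forall z, (x < z)%O -> (xi <= z)%O).
  by exists xi => //; split.
move=> /existsNP[z /not_implyP[xz /negP]]; rewrite -ltNge => zxi.
by have [eta h1 h2] := IH z zxi xz; exists eta => //; exact: le_trans h2 (ltW zxi).
Qed.

Lemma S_botE : S \bot%O = schreier0. Proof. by case: hS. Qed.

Lemma S_topE E : S \top%O E <-> 0%N \notin E. Proof. by case: hS => _ _ _ ->. Qed.

Lemma S_succE eta x E : (eta < \top)%O -> is_succ_of eta x ->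
  S eta E <-> E = fset0 \/ exists2 n, le_fset n E & covered (S x) n E.
Proof. by case: hS => _ h _ _ et ex; rewrite (h _ _ et ex); exact: conv_schreierP. Qed.

Lemma S_family xi : [/\ hereditary (S xi), spreading (S xi), S xi fset0,
  forall E, S xi E -> 0%N \notin E & forall i, (0 < i)%N -> S xi [fset i]%fset].
Proof.
elim/ordinal_ind : xi => [|y x yT yx [hh hs h0 hz h1]|y yT yl IH|].
- rewrite S_botE; split.
  + move=> E G GE [E0|[n n0 En]]; first by left; move: GE; rewrite E0 fsubset0 => /eqP.
    by move: GE; rewrite En fsubset1 => /orP[/eqP ->|/eqP ->]; [right; exists n|left].
  + move=> E f _ fE [->|[n n0 En]].
      by left; apply/fsetP => i; rewrite inE; apply/negbTE/imfsetP => -[j]; rewrite inE.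
    right; exists (f n); first by apply: leq_trans n0 _; apply: fE; rewrite En inE.
    apply/fsetP => i; rewrite En !inE; apply/imfsetP/eqP => [[j /=]|->].
      by rewrite inE => /eqP ->.
    by exists n => //=; rewrite inE.
  + by left.
  + by move=> E [->|[n n0 ->]]; rewrite !inE// neq_ltn n0.
  + by move=> i i0; right; exists i.
- have SE E := S_succE E yT yx; split.
  + move=> E G GE /SE[E0|[n nE FE]]; apply/SE.
      by left; move: GE; rewrite E0 fsubset0 => /eqP.
    right; exists n; first by move=> i iG; apply: nE; exact: (fsubsetP GE).
    exact: covered_hereditary FE.
  + move=> E f fE leE /SE[E0|[n nE FE]]; apply/SE.
      by left; rewrite E0; apply/fsetP => i; rewrite inE; apply/negbTE/imfsetP => -[j]; rewrite inE.
    right; exists n; last exact: covered_spreading.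
    by move=> i /imfsetP[j /= jE ->]; apply: leq_trans (leE _ jE); exact: nE.
  + by apply/SE; left.
  + move=> E /SE[->|[[|n] nE]]; rewrite ?inE//=; first by move=> ->; rewrite inE.
    by move=> _; apply/negP => /nE.
  + move=> i i0; apply/SE; right; exists 1%N; first by move=> j; rewrite inE => /eqP ->.
    by apply: covered1; exact: h1.
- case: hS => _ _ /(_ y yT yl) [u [u1 u2 ->]] _.
  have u_fam n : (0 < n)%N -> [/\ hereditary (S (u n)), spreading (S (u n)), S (u n) fset0,
    forall E, S (u n) E -> 0%N \notin E & forall i, (0 < i)%N -> S (u n) [fset i]%fset].
    by move=> n0; apply: IH; have [] := u1 n n0.
  split=> [E G GE|E f fE leE|||i i0] /=.
  + move=> [E0|[n [n0 nE SE]]]; first by left; move: GE; rewrite E0 fsubset0 => /eqP.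
    right; exists n; split=> //; first by move=> i iG; apply: nE; exact: (fsubsetP GE).
    by have [h _ _ _ _] := u_fam n n0; exact: h SE.
  + move=> [->|[n [n0 nE SE]]].
      by left; apply/fsetP => i; rewrite inE; apply/negbTE/imfsetP => -[j]; rewrite inE.
    right; exists n; split=> //.
      by move=> i /imfsetP[j /= jE ->]; apply: leq_trans (leE _ jE); exact: nE.
    by have [_ h _ _ _] := u_fam n n0; exact: h SE.
  + by left.
  + move=> E [->|[n [n0 nE SE]]]; rewrite ?inE//.
    by have [_ _ _ h _] := u_fam n n0; exact: h SE.
  + right; exists 1%N; split=> //; first by move=> j; rewrite inE => /eqP ->.
    by have [_ _ _ _ h] := u_fam 1%N isT; exact: h.
- split.
  + move=> E G /fsubsetP GE /S_topE E0; apply/S_topE; apply: contra E0; exact: GE.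
  + move=> E f _ leE /S_topE E0; apply/S_topE/imfsetP => -[i /= iE i0].
    by have := leE i iE; rewrite -i0 leqn0 => /eqP i00; rewrite -i00 iE in E0.
  + by apply/S_topE; rewrite inE.
  + by move=> E /S_topE.
  + by move=> i i0; apply/S_topE; rewrite inE neq_ltn i0.
Qed.

Lemma S_hereditary xi : hereditary (S xi). Proof. by case: (S_family xi). Qed.
Lemma S_spreading xi : spreading (S xi). Proof. by case: (S_family xi). Qed.
Lemma S_fset0 xi : S xi fset0. Proof. by case: (S_family xi). Qed.
Lemma S_n0 xi E : S xi E -> 0%N \notin E.
Proof. by case: (S_family xi) => _ _ _ h _; exact: h. Qed.
Lemma S_fset1 xi i : (0 < i)%N -> S xi [fset i]%fset.
Proof. by case: (S_family xi) => _ _ _ _; exact. Qed.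

Lemma le_fsetW m n E : (m <= n)%N -> le_fset n E -> le_fset m E.
Proof. by move=> mn nE i /nE; exact: leq_trans. Qed.

Lemma le_fset_n0 E : le_fset 1 E -> 0%N \notin E.
Proof. by move=> h; apply/negP => /h. Qed.

(** Induction on [xi]: a set of [S x] whose minimum is at least 1 is one block of
    a set of [S (x + 1)], and at a limit the sets of [S (u n)] whose minimum is
    at least [n] are admitted. *)
Lemma S_eventually_sub zeta xi : (zeta <= xi)%O ->
  exists t, forall E, le_fset t E -> S zeta E -> S xi E.
Proof.
elim/ordinal_ind : xi => [|y x yT yx IH|y yT yl IH|] zx.
- by exists 0%N => E _; rewrite (le_anti (introT andP (conj zx (le0x _)))).
- move: zx; rewrite le_eqVlt => /orP[/eqP ->|zy]; first by exists 0%N.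
  have zx : (zeta <= x)%O.
    by rewrite leNgt; apply/negP => /yx.2; rewrite leNgt zy.
  have [t ht] := IH zx; exists (maxn 1 t) => E tE SE; apply/(S_succE E yT yx); right.
  exists 1%N; first by apply: le_fsetW tE; rewrite leq_maxl.
  by apply: covered1; apply: ht => //; apply: le_fsetW tE; rewrite leq_maxr.
- move: zx; rewrite le_eqVlt => /orP[/eqP ->|zy]; first by exists 0%N.
  case: hS => _ _ /(_ y yT yl) [u [u1 /(_ _ zy) [n n0 zu] ->]] _.
  have [_ _ uy _] := u1 n n0.
  have [t ht] := IH _ uy (ltW zu); exists (maxn n t) => E tE SE /=; right.
  exists n; split=> //; first by apply: le_fsetW tE; rewrite leq_maxl.
  by apply: ht => //; apply: le_fsetW tE; rewrite leq_maxr.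
- by exists 1%N => E /le_fset_n0 E0 _; apply/S_topE.
Qed.

(** The sets in question form [S (zeta + 1)], and [zeta + 1 <= xi]. *)
Lemma conv_eventually_sub zeta xi : (zeta < xi)%O ->
  exists t, forall E, le_fset t E -> forall n, le_fset n E -> covered (S zeta) n E -> S xi E.
Proof.
move=> zx; have [->|xT] := eqVneq xi \top%O.
  by exists 1%N => E /le_fset_n0 E0 _ _ _; apply/S_topE.
have [eta ez exi] := exists_succ zx.
have eT : (eta < \top)%O by rewrite (le_lt_trans exi)// ltx1.
have [t ht] := S_eventually_sub exi; exists t => E tE n nE FE; apply: ht => //.
by apply/(S_succE E eT ez); right; exists n.
Qed.

End SchreierHierarchy.

(** * Repeated averages *)

Section Doubled.
Implicit Types (E G H : {fset nat}) (n m : nat -> nat).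

Definition increasing n := {homo n : i j / (i < j)%N}.

Lemma increasing_inj n : increasing n -> injective n.
Proof.
by move=> hn i j ij; have [/hn|/hn|//] := ltngtP i j; rewrite ij ltnn.
Qed.

Lemma increasing_leq n i : increasing n -> (i <= n i)%N.
Proof. by move=> hn; elim: i => // i IH; apply: leq_ltn_trans IH _; exact: hn. Qed.

Lemma increasing_block n i j : increasing n -> (i < j)%N -> (n i.+1 <= n j)%N.
Proof.
by move=> hn; rewrite leq_eqVlt => /orP[/eqP <-|/hn/ltnW].
Qed.

(** An index [k] stands for the difference of the terms [n (2k)] and
    [n (2k + 1)] of a sequence; [pairs n G] collects the terms used by the
    indices in [G]. *)
Definition pairs n G : {fset nat} :=
  ([fset n i.*2 | i in G] `|` [fset n i.*2.+1 | i in G])%fset.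

Lemma pairsP n G x : reflect (exists2 i, i \in G & x = n i.*2 \/ x = n i.*2.+1) (x \in pairs n G).
Proof.
apply: (iffP idP) => [|[i iG h]]; rewrite !inE.
  by move=> /orP[/imfsetP[i /= iG ->]|/imfsetP[i /= iG ->]]; exists i => //; [left|right].
by case: h => ->; apply/orP; [left|right]; apply: in_imfset.
Qed.

Lemma pairsU n G H : pairs n (G `|` H)%fset = (pairs n G `|` pairs n H)%fset.
Proof.
apply/fsetP => x; rewrite inE; apply/pairsP/orP => [[k] | ].
  by rewrite inE => /orP[iG|iH] h; [left|right]; apply/pairsP; exists k.
by move=> [/pairsP[i iG h]|/pairsP[i iG h]]; exists i; rewrite ?inE ?iG ?orbT.
Qed.

Lemma le_fset_pairs n t G : increasing n -> le_fset t G -> le_fset t (pairs n G).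
Proof.
move=> hn tG x /pairsP[i iG h]; apply: leq_trans (tG _ iG) _.
have i2 : (i <= i.*2)%N by rewrite -addnn leq_addr.
by case: h => ->; apply: leq_trans (increasing_leq _ hn); rewrite // leqW.
Qed.

Lemma fset_lt_pairs n G H : increasing n -> fset_lt G H -> fset_lt (pairs n G) (pairs n H).
Proof.
move=> hn GH x y /pairsP[i iG hx] /pairsP[j jH hy].
have ij := GH _ _ iG jH.
have lt : (i.*2.+1 < j.*2)%N by lia.
by case: hx => ->; case: hy => ->; apply: hn; lia.
Qed.

End Doubled.

Section Averages.
Context (R : realType).
Implicit Types (E G H : {fset nat}) (n m : nat -> nat) (beta : nat -> R).

Definition probability_on G beta := (forall i, 0 <= beta i) /\ \sum_(i <- G) beta i = 1.

Lemma covered_sum_le (F : set {fset nat}) k m H G beta (e : R) : (forall i, 0 <= beta i) ->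
  (forall H', (H' `<=` H)%fset -> F [fset m i | i in H']%fset ->
    \sum_(i <- (H' `&` G)%fset) beta i <= e) ->
  covered F k [fset m i | i in H]%fset -> \sum_(i <- (H `&` G)%fset) beta i <= k%:R * e.
Proof.
move=> b0; elim: k H => [|k IH] H hF /=.
  move=> H0; rewrite (_ : (H `&` G)%fset = fset0) ?big_seq_fset0 ?mul0r//.
  apply/fsetP => i; rewrite !inE; case: (boolP (i \in H)) => //= iH.
  by have : m i \in [fset m i | i in H]%fset by [apply: in_imfset]; rewrite H0 inE.
move=> [t Fb Fa].
pose H1 := [fset i in H | (m i < t)%N]%fset; pose H2 := [fset i in H | (t <= m i)%N]%fset.
have e1 : fbelow t [fset m i | i in H]%fset = [fset m i | i in H1]%fset.
  apply/fsetP => x; rewrite !inE/=; apply/andP/imfsetP => [[/imfsetP[i /= iH ->] it]|[i /=]].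
    by exists i => //=; rewrite !inE/= iH.
  by rewrite !inE/= => /andP[iH it] ->; split=> //; apply: in_imfset.
have e2 : fabove t [fset m i | i in H]%fset = [fset m i | i in H2]%fset.
  apply/fsetP => x; rewrite !inE/=; apply/andP/imfsetP => [[/imfsetP[i /= iH ->] it]|[i /=]].
    by exists i => //=; rewrite !inE/= iH.
  by rewrite !inE/= => /andP[iH it] ->; split=> //; apply: in_imfset.
rewrite (big_fsetID _ [pred i | m i < t]%N)/= -natr1 mulrDl mul1r addrC lerD//.
- rewrite (@eq_fbigl _ _ _ _ _ (H2 `&` G)%fset); last first.
    by move=> i; rewrite !inE/= -leqNgt andbAC.
  apply: IH; last by rewrite -e2.
  move=> H' H'2; apply: hF; apply: fsubset_trans H'2 _.
  by apply/fsubsetP => i; rewrite !inE/= => /andP[].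
- rewrite (@eq_fbigl _ _ _ _ _ (H1 `&` G)%fset); last first.
    by move=> i; rewrite !inE/= andbAC.
  apply: hF; last by rewrite -e1.
  by apply/fsubsetP => i; rewrite !inE/= => /andP[].
Qed.

(** One step of the repeated averages. Choose blocks of mass 1 one after the
    other, each so thin for [F] that a set of [F] meeting an earlier block gets
    little mass from it. A set of [F] then gets mass at most 1 from the first
    block that it meets and little from all later ones; dividing by the number
    of blocks makes its mass small. *)
Lemma average_step (F : set {fset nat}) n m : hereditary F -> increasing n ->
  (forall (N L : nat) (e : R), 0 < e -> exists G beta,
    [/\ le_fset L G, probability_on G beta, covered F 2 (pairs n G) &
      forall H i, i \in H -> (m i <= N)%N -> F [fset m i | i in H]%fset ->
        \sum_(i <- (H `&` G)%fset) beta i <= e]) ->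
  forall (L : nat) (e : R), 0 < e -> exists G beta k,
    [/\ le_fset L G, probability_on G beta, le_fset k (pairs n G) /\ covered F k (pairs n G) &
      forall H, F [fset m i | i in H]%fset -> \sum_(i <- (H `&` G)%fset) beta i <= e].
Proof.
move=> hF hn step.
have blocks q L : forall e : R, 0 < e -> exists G beta,
    [/\ le_fset L G, (forall i, 0 <= beta i) /\ \sum_(i <- G) beta i = q%:R,
      covered F q.*2 (pairs n G) &
      forall H, F [fset m i | i in H]%fset -> \sum_(i <- (H `&` G)%fset) beta i <= 1 + e].
  elim: q => [|q IH] e e0.
    exists fset0, (fun=> 0); split=> //; first by split=> //; rewrite big_seq_fset0.
      by rewrite /= /pairs; apply/fsetP => x; rewrite !inE; apply/negbTE/norP; split;
        apply/imfsetP => -[j]; rewrite inE.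
    by move=> H _; rewrite big1// addr_ge0// ltW.
  have e20 : 0 < e / 2 by rewrite divr_gt0.
  have [G1 [b1 [LG1 [b10 b1S] cG1 hG1]]] := IH _ e20.
  have [G2 [b2 [LG2 [b20 b2S] cG2 hG2]]] := step (\max_(i <- G1) m i) (maxn L (fsup G1)) _ e20.
  have G12 : fset_lt G1 G2.
    by move=> i j /lt_fsup iG /LG2; rewrite geq_max => /andP[_]; exact: leq_trans.
  have dG i : i \in G2 -> i \notin G1.
    by move=> iG2; apply/negP => iG1; have := G12 _ _ iG1 iG2; rewrite ltnn.
  pose b i := if i \in G1 then b1 i else b2 i.
  have sumU H : \sum_(i <- (H `&` (G1 `|` G2))%fset) b i =
      \sum_(i <- (H `&` G1)%fset) b1 i + \sum_(i <- (H `&` G2)%fset) b2 i.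
    rewrite (big_fsetID _ [pred i | i \in G1])/=; congr (_ + _).
      apply: eq_fbig => i; last by rewrite !inE/= /b => /andP[_ ->].
      by rewrite !inE/=; case: (boolP (i \in G1)); rewrite ?andbF ?andbT.
    apply: eq_fbig => i; last by rewrite !inE/= /b => /andP[_ /negbTE ->].
    rewrite !inE/=; case: (boolP (i \in G1)) => /= iG1; rewrite ?andbF ?andbT//.
    by case: (boolP (i \in G2)) => [/dG|]; rewrite ?iG1 ?andbF.
  exists (G1 `|` G2)%fset, b; split.
  - move=> i; rewrite inE => /orP[/LG1//|/LG2]; apply: leq_trans; exact: leq_maxl.
  - split=> [i|]; first by rewrite /b; case: ifP.
    have := sumU (G1 `|` G2)%fset; rewrite fsetIid => ->.
    rewrite (_ : (_ `&` G1)%fset = G1); last by apply/fsetIidPr; exact: fsubsetUl.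
    rewrite (_ : (_ `&` G2)%fset = G2); last by apply/fsetIidPr; exact: fsubsetUr.
    by rewrite b1S b2S natr1.
  - by rewrite pairsU doubleS -addn2; apply: covered_cat => //; exact: fset_lt_pairs.
  - move=> H FH; rewrite sumU.
    have [h|/existsNP[i /not_implyP[iH /negP/negPn iG]]] := pselect (forall i, i \in H ->
      i \notin G1).
      rewrite (_ : (H `&` G1)%fset = fset0) ?big_seq_fset0 ?add0r.
        apply: (@le_trans _ _ (\sum_(i <- G2) b2 i)); last by rewrite b2S lerDl ltW.
        by apply: ler_fsum_sub => //; exact: fsubsetIr.
      apply/fsetP => i; rewrite !inE; case: (boolP (i \in H)) => //= /h.
      by move=> /negbTE.
    rewrite [e]splitr addrA lerD ?hG1//; apply: (hG2 _ i) => //.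
    by rewrite (bigD1_seq i) ?fset_uniq//= leq_maxl.
move=> L e e0.
(* A set gets mass at most 1 + 1 from [q] blocks, hence at most [2 / q] from their
   average. The support needs [q.*2] sets of [F], so it has to start beyond [q.*2]. *)
have [q q0 hq] : exists2 q : nat, (0 < q)%N & 2 <= q%:R * e.
  exists (Num.truncn (2 / e)).+1 => //.
  by rewrite -ler_pdivrMr// ltW// truncnS_gt.
have q0' : 0 < q%:R :> R by rewrite ltr0n.
have [G [b [LG [b0 bS] cG hG]]] := blocks q (maxn L q.*2) 1 ltr01.
exists G, (fun i => b i / q%:R), q.*2; split.
- by move=> i /LG; rewrite geq_max => /andP[].
- split=> [i|]; first by rewrite divr_ge0 ?b0 ?ltW.
  by rewrite -mulr_suml bS divff// gt_eqF.
- split=> //; apply: le_fset_pairs => // i /LG; by rewrite geq_max => /andP[].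
- move=> H /hG h; rewrite -mulr_suml ler_pdivrMr// (le_trans h)// mulrC//.
Qed.

Context (d : Order.disp_t) (W : tbOrderType d) (hW : ordinals_upto_omega1 W).
Variable S : W -> set {fset nat}.
Hypothesis hS : schreier_hierarchy S.

(** [S (zeta + 1)] is so much larger than [S zeta] that it contains the support of
    a probability giving little mass to each member of [S zeta]. The two
    reindexings are independent: the support is measured along [n], which will
    number the terms of a sequence, and the small sets along [m], which will
    locate the blocks made of these terms.

    Successors: a set of [S (x + 1)] meeting a point [m i <= N] is a union of at
    most [N] sets of [S x], so an average that is thin by [e / N] for [S x] is a
    valid block. Limits: such a set belongs to [S (u j)] for some [j <= N], so an
    average for [S (u (N + 1))] is a valid block. *)
Lemma repeated_average (zeta : W) n m : (zeta < \top)%O -> increasing n -> increasing m ->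
  forall (L : nat) (e : R), 0 < e -> exists G beta k,
    [/\ le_fset L G, probability_on G beta,
      le_fset k (pairs n G) /\ covered (S zeta) k (pairs n G) &
      forall H, S zeta [fset m i | i in H]%fset -> \sum_(i <- (H `&` G)%fset) beta i <= e].
Proof.
move=> + hn hm; elim/(ordinal_ind hW) : zeta => [_|y x yT yx IH _|y yT yl IH _|];
  last by rewrite ltxx.
- apply: average_step => //; first exact: S_hereditary.
  move=> N L e e0; pose i0 := (maxn L N).+1.
  exists [fset i0]%fset, (fun=> 1); split.
  + by move=> i; rewrite inE => /eqP ->; rewrite /i0 leqW// leq_maxl.
  + by split=> // ; rewrite big_seq_fset1.
  + have -> : pairs n [fset i0]%fset = ([fset n i0.*2] `|` [fset n i0.*2.+1])%fset.
      apply/fsetP => x; apply/pairsP/fsetUP => [[j]|h].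
        by rewrite inE => /eqP -> [->|->]; [left|right]; rewrite inE.
      by exists i0; rewrite ?inE//; case: h; rewrite inE => /eqP ->; [left|right].
    have i00 : (0 < i0.*2)%N by rewrite double_gt0.
    apply: (@covered_cat _ 1 1); last 2 first.
    * by apply/covered1/(S_fset1 hW hS); apply: leq_trans i00 (increasing_leq _ hn).
    * by apply/covered1/(S_fset1 hW hS); apply: leq_trans (increasing_leq _ hn).
    * by move=> a b; rewrite !inE => /eqP -> /eqP ->; exact: hn.
  + move=> H i iH iN; rewrite (S_botE hS) => -[H0|[a _ Ha]].
      by have : m i \in [fset m i | i in H]%fset by [apply: in_imfset]; rewrite H0 inE.
    rewrite (_ : (H `&` _)%fset = fset0) ?big_seq_fset0 ?ltW//.
    apply/fsetP => j; rewrite !inE; apply/negbTE/andP => -[jH /eqP ji].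
    have : m i \in [fset m i | i in H]%fset by [apply: in_imfset].
    have : m j \in [fset m i | i in H]%fset by [apply: in_imfset].
    rewrite Ha !inE => /eqP mj /eqP mi.
    have := increasing_leq i0 hm; rewrite -ji mj -mi ji => h.
    by have := leq_trans h iN; rewrite ltnNge leq_maxr.
- have xT : (x < \top)%O by apply: lt_trans yT; case: yx.
  apply: average_step => //; first exact: S_hereditary.
  move=> N L e e0; have eN : 0 < e / N.+1%:R by rewrite divr_gt0.
  have [G [b [k [LG bP [kG cG] hG]]]] := IH xT L _ eN.
  exists G, b; split=> //.
    apply: coveredS; first exact: S_fset0.
    by apply: covered1; apply/(S_succE hS _ yT yx); right; exists k.
  move=> H i iH iN /(S_succE hS _ yT yx)[H0|[j jH cH]].
    by have : m i \in [fset m i | i in H]%fset by [apply: in_imfset]; rewrite H0 inE.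
  have := covered_sum_le bP.1 (fun H' _ => hG H') cH; move=> /le_trans; apply.
  rewrite mulrA ler_pdivrMr// mulrC ler_wpM2l ?(ltW e0)// ler_nat.
  have : (j <= m i)%N by apply: jH; apply: in_imfset.
  by move=> /leq_trans; apply; exact: leqW.
- case: hS => _ _ /(_ y yT yl) [u [u1 _ Sy]] _.
  apply: average_step => //; first exact: S_hereditary.
  move=> N L e e0.
  have [_ _ uy _] := u1 N.+1 isT.
  have uT := lt_trans uy yT.
  have [t ht] := conv_eventually_sub hW hS uy.
  have [G [b [k [LG bP [kG cG] hG]]]] := IH _ uy uT (maxn L t) _ e0.
  exists G, b; split=> //.
  + by move=> i /LG; rewrite geq_max => /andP[].
  + apply: coveredS; first exact: S_fset0.
    apply: covered1; apply: ht cG => //.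
    by apply: le_fset_pairs => // i /LG; rewrite geq_max => /andP[].
  + move=> H i iH iN; rewrite Sy => -[H0|[j [j0 jH SH]]].
      by have : m i \in [fset m i | i in H]%fset by [apply: in_imfset]; rewrite H0 inE.
    apply: hG; have jN : (j <= N)%N.
      by apply: leq_trans iN; apply: jH; apply: in_imfset.
    elim: N jN {iN uy uT ht cG kG} => [|N IHN]; first by case: (j) j0.
    rewrite leq_eqVlt ltnS => /orP[/eqP <-|/IHN h].
      by have [_ _ _] := u1 j j0; exact.
    by have [_ _ _] := u1 N.+1 isT; apply.
Qed.

End Averages.

Section Weighted.
Context (R : realType) (d : Order.disp_t) (W : tbOrderType d) (hW : ordinals_upto_omega1 W).
Variable S : W -> set {fset nat}.
Hypothesis hS : schreier_hierarchy S.
Variable u : nat -> W.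
Implicit Types (E G H : {fset nat}) (w : R).

(** The sets of all the families [S (u n)], with a weight that makes those of
    large [n] negligible; this treats at once one family ([u] constant) and the
    families below a limit ordinal. *)
Definition weighted w E : Prop := exists2 n, (0 < n)%N & w = n%:R^-1 /\ S (u n) E.

Lemma weighted01 w E : weighted w E -> 0 < w <= 1.
Proof.
move=> [n n0 [-> _]]; rewrite invr_gt0 ltr0n n0/= invf_le1 ?ltr0n//.
by rewrite ler1n.
Qed.

Lemma weighted_hereditary w : hereditary (weighted w).
Proof. by move=> E G GE [n n0 [-> SE]]; exists n => //; split=> //;
  exact: (S_hereditary hW hS) SE. Qed.

Lemma weighted_spreading w : spreading (weighted w).
Proof. by move=> E f fE leE [n n0 [-> SE]]; exists n => //; split=> //;
  exact: (S_spreading hW hS) SE. Qed.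

Lemma weighted_fset1 i : (0 < i)%N -> weighted 1 [fset i]%fset.
Proof. by move=> i0; exists 1%N => //; rewrite invr1; split=> //; exact: (S_fset1 hW hS). Qed.

(** Let [q] be such that [1 / q <= e]. An average for [S (u q)] serves the sets of
    [S (u n)] with [n <= q], and for [n >= q] the weight is at most [e]. *)
Lemma weighted_average xi : (forall n, (0 < n)%N -> (u n < xi)%O) ->
  (forall n, (0 < n)%N -> S (u n) `<=` S (u n.+1)) ->
  forall n m, increasing n -> increasing m -> forall e : R, 0 < e -> exists G beta,
    [/\ probability_on G beta, S xi (pairs n G) &
      forall w H, weighted w [fset m i | i in H]%fset ->
        w * \sum_(i <- (H `&` G)%fset) beta i <= e].
Proof.
move=> uxi uS n m hn hm e e0.
have [q q0 qe] : exists2 q : nat, (0 < q)%N & q%:R^-1 <= e.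
  exists (Num.truncn e^-1).+1 => //.
  by rewrite -[leRHS]invrK lef_pV2 ?posrE ?invr_gt0// ltW// truncnS_gt.
have [t ht] := conv_eventually_sub hW hS (uxi q q0).
have uqT : (u q < \top)%O by rewrite (lt_le_trans (uxi q q0))// lex1.
have [G [b [k [tG bP [kG cG] hG]]]] := repeated_average hW hS uqT hn hm t e0.
exists G, b; split=> // [|w H [j j0 [-> SH]]].
  by apply: ht cG => //; exact: le_fset_pairs.
have sum1 : \sum_(i <- (H `&` G)%fset) b i <= 1.
  by rewrite -bP.2; apply: ler_fsum_sub; [exact: bP.1|exact: fsubsetIr].
have sum0 : 0 <= \sum_(i <- (H `&` G)%fset) b i by rewrite sumr_ge0// => i _; exact: bP.1.
have [qj|jq] := leqP q j.
  apply: le_trans qe; rewrite -[leRHS]mulr1 ler_pM ?invr_ge0// lef_pV2 ?posrE ?ltr0n//.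
  by rewrite ler_nat.
rewrite -[leRHS]mul1r ler_pM ?invr_ge0//; first by rewrite invf_le1 ?ltr0n// ler1n.
apply: hG; elim: q jq {q0 qe ht uqT cG} => // q IHq.
rewrite ltnS leq_eqVlt => /orP[/eqP <-|jq]; first exact: uS.
by apply: uS; [exact: leq_trans jq|exact: IHq].
Qed.

End Weighted.

(** * Gliding humps *)

Section Humps.
Context (R : realType) (s : scalars).
Local Notation K := (scalar_field R s).
Implicit Types (P Q : set nat) (M N : nat) (e : R).

Definition infinitely_many P := forall N, exists2 n, (N < n)%N & P n.

Lemma infinitely_many_increasing P : infinitely_many P ->
  exists m, [/\ increasing m, (0 < m 0)%N & forall k, P (m k)].
Proof.
move=> infP; have [N|f hf] := @choice nat nat (fun N n => (N < n)%N /\ P n).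
  by have [n] := infP N; exists n.
exists (fun k => iter k.+1 f 0%N); split; last by move=> k; have [] := hf (iter k f 0%N).
  by apply: homo_ltn; [exact: ltn_trans|move=> k; have [] := hf (iter k.+1 f 0%N)].
by have [] := hf 0%N.
Qed.

(** A cluster point of the values, which exists in a compact disc, is approached
    along infinitely many indices. *)
Lemma close_subsequence (z : nat -> K) (C : R) P e : 0 < e ->
  (forall n, modulus (z n) <= C) -> infinitely_many P ->
  exists Q, [/\ Q `<=` P, infinitely_many Q &
    forall a b, Q a -> Q b -> modulus (z a - z b) <= e].
Proof.
move=> e0 zC infP.
pose F : set_system K := fun A => exists N, forall n, (N < n)%N -> P n -> A (z n).
have FF : ProperFilter F.
  apply: Build_ProperFilter_ex.
    by move=> A [N h]; have [n Nn Pn] := infP N; exists (z n); exact: h.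
  split; first by exists 0%N.
    move=> A B [N1 h1] [N2 h2]; exists (maxn N1 N2) => n; rewrite gtn_max => /andP[n1 n2] Pn.
    by split; [exact: h1|exact: h2].
  by move=> A B AB [N h]; exists N => n Nn Pn; apply: AB; exact: h.
have [|l [_ hl]] := @scalar_disc_compact R s C F FF; first by exists 0%N => n _ _; exact: zC.
have e20 : 0 < e / 2 by rewrite divr_gt0.
exists [set n | P n /\ modulus (l - z n) < e / 2]; split=> [n [] //|N|a b [_ ha] [_ hb]].
  have [||x [[n [Nn Pn] <-] h]] :=
    hl [set z n | n in [set n | (N < n)%N /\ P n]] [set y | modulus (l - y) < e / 2].
  - by exists N => n Nn Pn; exists n.
  - exact: ((@cvg_normRP R s K^o (nbhs (l : K^o)) _ l).1 (fun A hA => hA) _ e20).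
  by exists n.
have -> : z a - z b = (l - z b) - (l - z a) by ring.
rewrite (le_trans (ler_modulusD _ _))// modulusN [e]splitr lerD// ltW//.
Qed.

Lemma close_coordinates (y : nat -> nat -> K) M P e : 0 < e ->
  (forall i, exists C, forall n, modulus (y n i) <= C) -> infinitely_many P ->
  exists Q, [/\ Q `<=` P, infinitely_many Q &
    forall a b, Q a -> Q b -> forall i, (i < M)%N -> modulus (y a i - y b i) <= e].
Proof.
move=> e0 yC infP; elim: M => [|M [Q [QP infQ hQ]]]; first by exists P; split=> //.
have [C hC] := yC M.
have [Q' [Q'Q infQ' hQ']] := close_subsequence e0 hC infQ.
exists Q'; split=> // [n /Q'Q/QP //|a b ha hb i].
rewrite ltnS leq_eqVlt => /orP[/eqP ->|iM]; first exact: hQ'.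
by apply: hQ => //; exact: Q'Q.
Qed.

Definition hump (a : nat -> K) M N i : K := if (M <= i < N)%N then a i else 0.

Lemma hump_disjoint (a : nat -> nat -> K) (M : nat -> nat) : increasing M ->
  forall i k l, hump (a k) (M k) (M k.+1) i != 0 -> hump (a l) (M l) (M l.+1) i != 0 -> k = l.
Proof.
move=> hM i k l; rewrite /hump.
case: ifP => [/andP[k1 k2] _|]; last by rewrite eqxx.
case: ifP => [/andP[l1 l2] _|]; last by rewrite eqxx.
have [kl|lk|//] := ltngtP k l.
  by have := leq_trans k2 (leq_trans (increasing_block hM kl) l1); rewrite ltnn.
by have := leq_trans l2 (leq_trans (increasing_block hM lk) k1); rewrite ltnn.
Qed.

Variables (p : \bar R) (p1 : (1%:E <= p)%E) (y : nat -> nat -> K).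

Definition small_tails (a : nat -> K) := forall e, 0 < e ->
  exists M, forall E, le_fset M E -> lp_norm p E a <= e.

Hypothesis y_bounded : forall i, exists C, forall n, modulus (y n i) <= C.
Hypothesis y_tails : forall n, small_tails (y n).

(** Two terms that nearly agree on the first [M] coordinates have a difference
    that is small there, and also beyond some [N], so it is nearly supported in
    [[M, N)]. *)
Lemma hump_step (b0 M : nat) e : 0 < e -> exists a b N, [/\ (b0 < a)%N, (a < b)%N, (M < N)%N &
  forall E, lp_norm p E (fun i => (y a i - y b i) - hump (fun i => y a i - y b i) M N i) <= e].
Proof.
move=> e0; have e40 : 0 < e / 4 by rewrite divr_gt0.
have eM0 : 0 < e / 2 / M.+1%:R by rewrite !divr_gt0.
have [|Q [_ infQ hQ]] := @close_coordinates y M setT _ eM0 y_bounded.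
  by move=> N; exists N.+1.
have [a b0a Qa] := infQ b0; have [b ab Qb] := infQ a.
have [N1 h1] := y_tails a e40; have [N2 h2] := y_tails b e40.
pose N := maxn M.+1 (maxn N1 N2); exists a, b, N; split=> //; first by rewrite /N leq_maxl.
move=> E.
have -> : e = e / 2 + (e / 4 + e / 4) by lra.
pose u i := y a i - y b i.
pose u1 i := if (i < M)%N then u i else 0.
pose u2 i := if (N <= i)%N then u i else 0.
have MN : (M < N)%N by rewrite /N leq_maxl.
apply: (@le_trans _ _ (lp_norm p E (fun i => u1 i + u2 i))).
  apply: ler_lp_norm => // i _; rewrite /hump /u1 /u2 -/(u i).
  have [iM|Mi] /= := ltnP i M.
    by rewrite leqNgt (ltn_trans iM MN)/= addr0 subr0.
  by have [iN|Ni] := ltnP i N; rewrite /= ?subrr ?subr0 add0r.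
apply: (le_trans (ler_lp_normD _ _ _ p1)); apply: lerD.
  apply: (le_trans (lp_norm_le_sum _ _ p1)).
  apply: (@le_trans _ _ (\sum_(i <- E | (i < M)%N) e / 2 / M.+1%:R)).
    rewrite [leRHS]big_mkcond /=; apply: ler_sum => i _; rewrite /u1.
    by case: ifP => iM; rewrite ?modulus0//; exact: hQ.
  apply: (@le_trans _ _ (e / 2 / M.+1%:R * M.+1%:R)); last by rewrite divfK ?pnatr_eq0.
  rewrite big_const_seq iter_addr_0.
  rewrite -[leLHS]mulr_natr.
  rewrite ler_wpM2l ?(ltW eM0)// ler_nat.
  rewrite -size_filter; apply: (@leq_trans (size (iota 0 M))); last by rewrite size_iota leqW.
  apply: uniq_leq_size; first by rewrite filter_uniq ?fset_uniq.
  by move=> i; rewrite mem_filter mem_iota => /andP[->].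
pose E' := [fset i in E | (N <= i)%N]%fset.
have tail c Nc : (Nc <= N)%N -> (forall E, le_fset Nc E -> lp_norm p E (y c) <= e / 4) ->
  lp_norm p E' (y c) <= e / 4.
  move=> NcN; apply => i; rewrite !inE/= => /andP[_]; exact: leq_trans.
apply: (@le_trans _ _ (lp_norm p E' (fun i => y a i + - 1 * y b i))); last first.
  apply: (le_trans (ler_lp_normD _ _ _ p1)); rewrite lp_normZ// modulusN modulus1 mul1r.
  by apply: lerD; [apply: tail h1|apply: tail h2]; rewrite /N; lia.
have -> : lp_norm p E' (fun i => y a i + - 1 * y b i) = lp_norm p E' u2.
  by apply: eq_lp_norm => i; rewrite !inE/= => /andP[_ Ni]; rewrite /u2 Ni /u mulN1r.
apply: lp_norm_support => // i iE; rewrite !inE/= iE/= /u2 => /negbTE ->//.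
Qed.

Definition difference (n : nat -> nat) k i : K := y (n k.*2) i - y (n k.*2.+1) i.

(** Differences are used instead of the terms because a bounded sequence need not
    have a small coordinatewise limit. *)
Lemma gliding_hump (e : nat -> R) : (forall k, 0 < e k) -> exists n M : nat -> nat,
  [/\ increasing n, increasing M, (0 < n 0)%N, (0 < M 0)%N &
    forall k E, lp_norm p E (fun i => difference n k i - hump (difference n k) (M k) (M k.+1) i)
      <= e k].
Proof.
move=> e0.
pose st := (nat * nat * nat)%type.
have [x|g hg] := @choice (nat * st) st (fun x z =>
  [/\ (x.2.1.2 < z.1.1)%N, (z.1.1 < z.1.2)%N, (x.2.2 < z.2)%N &
  forall E, lp_norm p E (fun i => (y z.1.1 i - y z.1.2 i) -
     hump (fun i => y z.1.1 i - y z.1.2 i) x.2.2 z.2 i) <= e x.1]).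
  have [a [b [N [h1 h2 h3 h4]]]] := hump_step x.2.1.2 x.2.2 (e0 x.1).
  by exists (a, b, N).
pose f := fix f k : st := if k is k'.+1 then g (k', f k') else (0, 0, 1)%N.
have fS k : f k.+1 = g (k, f k) by [].
pose n j := if odd j then (f j./2.+1).1.2 else (f j./2.+1).1.1.
pose M k := (f k).2.
have nE k : n k.*2 = (f k.+1).1.1 by rewrite /n odd_double doubleK.
have nO k : n k.*2.+1 = (f k.+1).1.2 by rewrite /n /= odd_double /= uphalf_double.
exists n, M; split => //.
- apply: homo_ltn; first exact: ltn_trans.
  move=> j; rewrite -[j]odd_double_half; case: (odd j) => /=.
    rewrite add1n -doubleS nE nO [in X in (_ < X)%N]fS.
    by have [] := hg (j./2.+1, f j./2.+1).
  by rewrite add0n nE nO fS; have [] := hg (j./2, f j./2).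
- apply: homo_ltn; first exact: ltn_trans.
  by move=> k; rewrite /M fS; have [] := hg (k, f k).
- have := nE 0%N; rewrite double0 => ->; rewrite fS.
  by have [h _ _ _] := hg (0%N, f 0%N); apply: leq_ltn_trans h.
- move=> k E; have [_ _ _ h] := hg (k, f k).
  rewrite (_ : difference n k = fun i => y (f k.+1).1.1 i - y (f k.+1).1.2 i); last first.
    by apply/funext => i; rewrite /difference nE nO.
  by rewrite /M fS; exact: h.
Qed.

End Humps.

(** * The two kinds of spaces and their unit vectors *)

Section Spaces.
Context (R : realType) (s : scalars).
Local Notation K := (scalar_field R s).
Implicit Types (E G H : {fset nat}) (w : R) (P : R -> set {fset nat}).

Lemma sum_fset_le_ord E (x : nat -> R) : (forall i, 0 <= x i) ->
  \sum_(i <- E) x i <= (size E)%:R * \sum_(i < fsup E) x i.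
Proof.
move=> x0; apply: (@le_trans _ _ (\sum_(i <- E) \sum_(j < fsup E) x j)).
  rewrite big_seq [leRHS]big_seq; apply: ler_sum => i iE.
  rewrite (bigD1 (Ordinal (lt_fsup iE)))//= lerDl.
  by rewrite sumr_ge0.
by rewrite big_const_seq count_predT iter_addr_0 mulr_natl.
Qed.

Section WeightedLp.
Variables (p : \bar R) (P : R -> set {fset nat}).
Hypothesis p1 : (1%:E <= p)%E.
Hypothesis P01 : forall w E, P w E -> 0 < w <= 1.
Hypothesis P_fset1 : forall i, P 1 [fset i]%fset.

(** For [P w E] iff [w = 1] this is the norm of [l_p] (of [l_oo] if [p = +oo]); for
    [P w E] iff [w = 1] and [E] is in the Schreier family of order [xi], that of
    the [p]-convex Schreier space of order [xi]. *)
Definition lp_gauge_set : set ((nat -> K^o) -> R) :=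
  [set phi | exists w E, P w E /\ phi = fun a => w * lp_norm p E (a : nat -> K)].

Fact lp_gaugeD phi : lp_gauge_set phi -> forall a b, phi (a + b) <= phi a + phi b.
Proof.
move=> [w [E [PE ->]]] a b; have /andP[w0 _] := P01 PE.
rewrite -mulrDr ler_wpM2l ?(ltW w0)//.
exact: (@ler_lp_normD _ _ p E a b p1).
Qed.

Fact lp_gaugeZ phi : lp_gauge_set phi -> forall c a, phi (c *: a) = modulus c * phi a.
Proof. by move=> [w [E [PE ->]]] c a; rewrite mulrCA -(@lp_normZ _ _ p E c a p1). Qed.

Fact lp_gauge_finite phi : lp_gauge_set phi -> exists (N : nat) (C : R),
    0 <= C /\ forall a, phi a <= C * \sum_(i < N) modulus (a i).
Proof.
move=> [w [E [PE ->]]]; have /andP[w0 _] := P01 PE.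
exists (fsup E), (w * (size E)%:R); split=> [|a]; first by rewrite mulr_ge0// ltW.
rewrite -mulrA ler_wpM2l ?(ltW w0)// (le_trans (lp_norm_le_sum _ _ p1))//.
by apply: (@sum_fset_le_ord E (fun i => modulus (a i))) => i; exact: modulus_ge0.
Qed.

Fact lp_gauge_coord i : exists C : R, 0 <= C /\ forall (a : nat -> K^o) B,
  0 <= B -> (forall phi, lp_gauge_set phi -> phi a <= B) -> modulus (a i) <= C * B.
Proof.
exists 1; split=> // a B _ h; rewrite mul1r.
have := h _ (ex_intro _ 1 (ex_intro _ _ (conj (P_fset1 i) erefl))).
by rewrite mul1r lp_norm1.
Qed.

Definition lp_gauge : gauge R s :=
  Gauge lp_gaugeD lp_gaugeZ lp_gauge_finite lp_gauge_coord.

Lemma lp_gauge_le (a : seqsp lp_gauge) w E : P w E -> w * lp_norm p E (a : nat -> K) <= gnorm a.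
Proof. by move=> PE; apply: (@gauge_le_gnorm _ _ lp_gauge (fun a => w * lp_norm p E a));
  exists w, E. Qed.

Lemma lp_gnorm_le (a : seqsp lp_gauge) B : 0 <= B ->
  (forall w E, P w E -> w * lp_norm p E (a : nat -> K) <= B) -> gnorm a <= B.
Proof. by move=> B0 h; apply: gnorm_le => // phi [w [E [PE ->]]]; exact: h. Qed.

Lemma coord_lp_gnorm (a : seqsp lp_gauge) i : modulus (a i) <= gnorm a.
Proof. by have := lp_gauge_le a (P_fset1 i); rewrite mul1r lp_norm1. Qed.

End WeightedLp.

Section DualGauge.
Variable P : R -> set {fset nat}.
Hypothesis P01 : forall w E, P w E -> 0 < w <= 1.

(** The unit ball of the dual norm is cut out by the positive measures giving
    mass at most [1 / w] to each [E] with [P w E]; such a measure is written as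
    the image under [m] of a measure [beta] on [G]. *)
Definition dual_gauge_set : set ((nat -> K^o) -> R) :=
  [set phi | exists G (beta : nat -> R) (m : nat -> nat), [/\ forall i, 0 <= beta i,
     forall w H, P w [fset m i | i in H]%fset -> w * \sum_(i <- (H `&` G)%fset) beta i <= 1 &
     phi = fun a => \sum_(i <- G) beta i * modulus (a (m i))]].

Fact dual_gaugeD phi : dual_gauge_set phi -> forall a b, phi (a + b) <= phi a + phi b.
Proof.
move=> [G [beta [m [b0 _ ->]]]] a b; rewrite -big_split /=.
by apply: ler_sum => i _; rewrite -mulrDr ler_wpM2l// ler_modulusD.
Qed.

Fact dual_gaugeZ phi : dual_gauge_set phi -> forall c a, phi (c *: a) = modulus c * phi a.
Proof.
move=> [G [beta [m [b0 _ ->]]]] c a; rewrite mulr_sumr.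
by apply: eq_bigr => i _; rewrite mulrCA -modulusM.
Qed.

Fact dual_gauge_finite phi : dual_gauge_set phi -> exists (N : nat) (C : R),
    0 <= C /\ forall a, phi a <= C * \sum_(i < N) modulus (a i).
Proof.
move=> [G [beta [m [b0 _ ->]]]].
exists (\max_(i <- G) (m i).+1)%N, (\sum_(i <- G) beta i); split=> [|a]; first by rewrite sumr_ge0.
rewrite mulr_suml big_seq [leRHS]big_seq; apply: ler_sum => i iG; rewrite ler_wpM2l//.
have lt : (m i < \max_(i <- G) (m i).+1)%N.
  by rewrite (bigD1_seq i) ?fset_uniq//= leq_max ltnSn.
rewrite (bigD1 (Ordinal lt))//= lerDl sumr_ge0// => j _; exact: modulus_ge0.
Qed.

Lemma dual_gauge_dirac i :
  dual_gauge_set (fun a => \sum_(j <- [fset 0%N]%fset) 1 * modulus (a i)).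
Proof.
exists [fset 0%N]%fset, (fun=> 1), (fun=> i); split=> // w H /P01/andP[w0 w1].
rewrite (le_trans _ w1)// ler_piMr ?(ltW w0)//.
rewrite (le_trans (ler_fsum_sub _ (fsubsetIr H [fset 0%N]%fset)))//.
by rewrite big_seq_fset1.
Qed.

Fact dual_gauge_coord i : exists C : R, 0 <= C /\ forall (a : nat -> K^o) B,
  0 <= B -> (forall phi, dual_gauge_set phi -> phi a <= B) -> modulus (a i) <= C * B.
Proof.
exists 1; split=> // a B _ h; rewrite mul1r.
have := h _ (dual_gauge_dirac i); by rewrite big_seq_fset1 mul1r.
Qed.

Definition dual_gauge : gauge R s :=
  Gauge dual_gaugeD dual_gaugeZ dual_gauge_finite dual_gauge_coord.

Lemma dual_gauge_le (a : seqsp dual_gauge) G (beta : nat -> R) (m : nat -> nat) (e : R) : 0 < e ->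
  (forall i, 0 <= beta i) ->
  (forall w H, P w [fset m i | i in H]%fset -> w * \sum_(i <- (H `&` G)%fset) beta i <= e) ->
  \sum_(i <- G) beta i * modulus (a (m i)) <= e * gnorm a.
Proof.
move=> e0 b0 h; rewrite -ler_pdivrMl// mulr_sumr.
under eq_bigr do rewrite mulrA.
apply: (@gauge_le_gnorm _ _ dual_gauge (fun a => \sum_(i <- G) e^-1 * beta i * modulus (a (m i)))).
exists G, (fun i => e^-1 * beta i), m; split=> // [i|w H /h hH].
  by rewrite mulr_ge0// invr_ge0 ltW.
by rewrite -mulr_sumr mulrCA ler_pdivrMl// mulr1.
Qed.

Lemma dual_gnorm_le (a : seqsp dual_gauge) B : 0 <= B ->
  (forall G (beta : nat -> R) (m : nat -> nat), (forall i, 0 <= beta i) ->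
    (forall w H, P w [fset m i | i in H]%fset -> w * \sum_(i <- (H `&` G)%fset) beta i <= 1) ->
    \sum_(i <- G) beta i * modulus (a (m i)) <= B) -> gnorm a <= B.
Proof. by move=> B0 h; apply: gnorm_le => // phi [G [beta [m [b0 hb ->]]]]; exact: h. Qed.

End DualGauge.

Section UnitVectors.
Variable g : gauge R s.

Definition unit_seq i : nat -> K^o := fun j => (j == i)%:R.

Lemma comb_unit (e : nat -> seqsp g) E (c : nat -> K) j :
  (forall i, i \in E -> seqval (e i) = unit_seq i) ->
  (\sum_(i <- E) c i *: e i : seqsp g) j = if j \in E then c j else 0.
Proof.
move=> he; rewrite seqval_sum big_seq.
transitivity (\sum_(i <- E | i \in E) c i * (j == i)%:R).
  by apply: eq_bigr => i iE; rewrite /= /GRing.scale /= he.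
rewrite -big_seq; case: ifP => jE.
  rewrite (bigD1_seq j) ?fset_uniq//= eqxx mulr1 big1 ?addr0// => i.
  by rewrite eq_sym => /negbTE ->; rewrite mulr0.
rewrite big_seq big1// => i iE; case: eqP => [ji|]; rewrite ?mulr0//.
by rewrite ji iE in jE.
Qed.

End UnitVectors.

End Spaces.

Section UnitSpreadingModels.
Context (R : realType) (s : scalars).
Local Notation K := (scalar_field R s).
Implicit Types (E G H : {fset nat}) (w : R) (F : set {fset nat}).

Section WeightedLp.
Variables (p : \bar R) (P : R -> set {fset nat}).
Hypothesis p1 : (1%:E <= p)%E.
Hypothesis P01 : forall w E, P w E -> 0 < w <= 1.
Hypothesis P_fset1 : forall i, P 1 [fset i]%fset.
Let g := lp_gauge s p1 P01 P_fset1.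

Lemma lp_unit_exists : exists e : nat -> seqsp g, forall i, seqval (e i) = unit_seq R s i.
Proof.
suff b i : unit_seq R s i \in gbounded g by exists (fun i => SeqSp (b i)).
apply/asboolP; exists 1 => phi [w [E [/P01/andP[w0 w1] ->]]].
apply: (@le_trans _ _ (1 * 1)); last by rewrite mulr1.
rewrite ler_pM ?lp_norm_ge0 ?(ltW w0)//.
rewrite (le_trans (lp_norm_support (F := [fset i]%fset) p1 _))//.
  by move=> j _; rewrite inE /unit_seq => /negbTE ->.
by rewrite lp_norm1// /unit_seq eqxx modulus1.
Qed.

Lemma lp_unit_spreading_model F (e : nat -> seqsp g) w0 : 0 < w0 ->
  (forall E, F E -> P w0 E) -> (forall E i, F E -> i \in E -> seqval (e i) = unit_seq R s i) ->
  spreading_model p F e.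
Proof.
move=> w00 FP he; exists w0^-1, 1; rewrite invr_gt0; split=> // E FE c.
have cE j : (\sum_(i <- E) c i *: e i : seqsp g) j = if j \in E then c j else 0.
  by apply: comb_unit => i; exact: he.
rewrite /comb_norm normR_gnorm mul1r; split.
  rewrite ler_pdivlMl// (le_trans _ (lp_gauge_le _ (FP _ FE)))// ler_wpM2l ?(ltW w00)//.
  by apply: ler_lp_norm => // i iE; rewrite cE iE.
apply: lp_gnorm_le; first exact: lp_norm_ge0.
move=> w H /P01/andP[w1 w2].
apply: (@le_trans _ _ (1 * lp_norm p H (fun j => if j \in E then c j else 0))).
  rewrite ler_pM ?(ltW w1) ?lp_norm_ge0//.
  by apply: ler_lp_norm => // i _; rewrite cE.
rewrite mul1r (le_trans (lp_norm_support (F := E) p1 _))//.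
  by move=> i _ /negbTE ->.
by apply: ler_lp_norm => // i ->.
Qed.

End WeightedLp.

Section Dual.
Variable P : R -> set {fset nat}.
Hypothesis P01 : forall w E, P w E -> 0 < w <= 1.
Hypothesis P_her : forall w, hereditary (P w).
Let g := dual_gauge s P01.

Lemma dual_unit_exists : (forall i, (0 < i)%N -> P 1 [fset i]%fset) ->
  exists e : nat -> seqsp g, forall i, (0 < i)%N -> seqval (e i) = unit_seq R s i.
Proof.
move=> P1; suff b i : (0 < i)%N -> unit_seq R s i \in gbounded g.
  have [i|e he] := @choice nat (seqsp g) (fun i z => (0 < i)%N -> seqval z = unit_seq R s i);
    last by exists e.
  by have [i0|i0] := posnP i; [exists 0|exists (SeqSp (b i i0))].
move=> i0; apply/asboolP; exists 1 => phi [G [beta [m [b0 hb ->]]]].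
pose H := [fset k in G | m k == i]%fset.
have PH : P 1 [fset m k | k in H]%fset.
  apply: P_her (P1 i i0); apply/fsubsetP => j /imfsetP[k /=].
  by rewrite !inE/= => /andP[_ /eqP ->] ->.
have := hb _ _ PH; rewrite mul1r; apply: le_trans.
rewrite (_ : (H `&` G)%fset = H); last first.
  by apply/fsetIidPl; apply/fsubsetP => k; rewrite !inE/= => /andP[].
rewrite (big_fsetID _ [pred k | m k == i])/= [X in _ + X]big_seq [X in _ + X]big1 ?addr0.
  apply: ler_sum => k _; rewrite ler_piMr// /unit_seq; case: eqP => _;
    by rewrite ?modulus1 ?modulus0.
by move=> k; rewrite !inE/= => /andP[_ /negbTE]; rewrite /unit_seq => ->; rewrite modulus0 mulr0.
Qed.

Lemma coord_dual_gnorm (a : seqsp g) i : modulus (a i) <= gnorm a.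
Proof.
have := @dual_gauge_le _ s P P01 a [fset 0%N]%fset (fun=> 1) (fun=> i) 1 ltr01.
rewrite big_seq_fset1 !mul1r; apply => // w H /P01/andP[w0 w1].
rewrite (le_trans _ w1)// ler_piMr ?(ltW w0)//.
rewrite (le_trans (ler_fsum_sub _ (fsubsetIr H [fset 0%N]%fset)))//.
by rewrite big_seq_fset1.
Qed.

Lemma dual_unit_spreading_model F (e : nat -> seqsp g) w0 : 0 < w0 ->
  (forall E, F E -> P w0 E) -> (forall E i, F E -> i \in E -> seqval (e i) = unit_seq R s i) ->
  spreading_model +oo%E F e.
Proof.
move=> w00 FP he; exists 1, w0^-1; rewrite invr_gt0; split=> // E FE c.
have cE j : (\sum_(i <- E) c i *: e i : seqsp g) j = if j \in E then c j else 0.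
  by apply: comb_unit => i; exact: he.
rewrite /comb_norm normR_gnorm mul1r; split.
  rewrite lp_normE rlp_oo; apply: le_bigmax_fset => [|i iE]; first exact: gnorm_ge0.
  by apply: (le_trans _ (coord_dual_gnorm _ i)); rewrite cE iE.
apply: dual_gnorm_le; first by rewrite mulr_ge0 ?lp_norm_ge0// invr_ge0 ltW.
move=> G beta m b0 hb.
pose H := [fset k in G | m k \in E]%fset.
have PH : P w0 [fset m k | k in H]%fset.
  apply: P_her (FP _ FE); apply/fsubsetP => j /imfsetP[k /=].
  by rewrite !inE/= => /andP[_ kE] ->.
have := hb _ _ PH; rewrite -ler_pdivlMl// mulr1 => /ler_wpM2r h.
apply: le_trans (h _ (lp_norm_ge0 _ _ _)).
rewrite (_ : (H `&` G)%fset = H); last first.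
  by apply/fsetIidPl; apply/fsubsetP => k; rewrite !inE/= => /andP[].
rewrite (big_fsetID _ [pred k | m k \in E])/= [X in _ + X]big_seq [X in _ + X]big1 ?addr0.
  rewrite mulr_suml -/H big_seq [leRHS]big_seq; apply: ler_sum => k.
  rewrite !inE/= => /andP[_ kE]; rewrite ler_wpM2l// cE kE.
  exact: (@le_coord_lp_norm R s +oo%E E c (m k) (leey _) kE).
by move=> k; rewrite !inE/= => /andP[_ /negbTE kE]; rewrite cE kE modulus0 mulr0.
Qed.

End Dual.
End UnitSpreadingModels.

Section PairCombinations.
Context (R : realType) (s : scalars).
Local Notation K := (scalar_field R s).
Implicit Types (E G H : {fset nat}) (F : set {fset nat}) (n : nat -> nat).

Lemma sum_pairs (V : nmodType) n G (f : nat -> V) : increasing n ->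
  \sum_(i <- pairs n G) f i = \sum_(k <- G) (f (n k.*2) + f (n k.*2.+1)).
Proof.
move=> hn; have inj := increasing_inj hn.
rewrite big_split /= (big_fsetID _ [pred i | i \in [fset n k.*2 | k in G]%fset])/=.
congr (_ + _).
  transitivity (\sum_(i <- [fset n k.*2 | k in G]%fset) f i).
    by apply: eq_fbigl => i; rewrite !inE/=; apply: andb_idl => ->.
  by rewrite big_imfset//= => i j _ _ /inj/double_inj.
transitivity (\sum_(i <- [fset n k.*2.+1 | k in G]%fset) f i).
  apply: eq_fbigl => i; rewrite !inE/=.
  case: (boolP (i \in [fset n k.*2 | k in G]%fset)) => //=; last by rewrite andbT.
  move=> /imfsetP[k /= kG ->]; apply/esym/imfsetP => -[l /= lG /inj kl].
  by have := congr1 odd kl; rewrite /= !odd_double.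
by rewrite big_imfset//= => i j _ _ /inj [] /double_inj.
Qed.

(** Coefficients on the terms [x (n j)] that produce the combination of the
    differences [x (n (2k)) - x (n (2k + 1))] with coefficients [c]. *)
Definition pair_coef n (c : nat -> K) (i : nat) : K :=
  let k := [set j | n j = i] in
  let j := xget 0%N k in if odd j then - c j./2 else c j./2.

Lemma pair_coefE n c k : increasing n ->
  pair_coef n c (n k.*2) = c k /\ pair_coef n c (n k.*2.+1) = - c k.
Proof.
move=> hn; have inj := increasing_inj hn.
have x j : xget 0%N [set j' | n j' = n j] = j by apply: xget_unique => // j' /inj.
by rewrite /pair_coef !x /= odd_double /= doubleK uphalf_double.
Qed.

Lemma comb_norm_pairs (X : normedModType K) (x : nat -> X) n G c : increasing n ->
  comb_norm x (pairs n G) (pair_coef n c) = normR (\sum_(k <- G) c k *: (x (n k.*2) - x (n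
    k.*2.+1))).
Proof.
move=> hn; rewrite /comb_norm sum_pairs//; congr normR; apply: eq_bigr => k _.
by have [-> ->] := pair_coefE c k hn; rewrite scalerBr scaleNr.
Qed.

Lemma lp_norm_pairs p n G c : (1%:E <= p)%E -> increasing n ->
  lp_norm p G c <= lp_norm p (pairs n G) (pair_coef n c) <= 2 * lp_norm p G c.
Proof.
move=> p1 hn; have [[r r1 ->]|->] := exponentP p1; last first.
  rewrite !lp_normE; apply/andP; split; rewrite [leLHS]rlp_oo; apply: le_bigmax_fset => [|i].
  - exact: rlp_ge0.
  - move=> iG; have [<- _] := pair_coefE c i hn.
    rewrite rlp_oo (@bigmax_fset_ge _ _ (fun i => modulus (pair_coef n c i)))//.
    by apply/pairsP; exists i => //; left.
  - by rewrite mulr_ge0// rlp_ge0.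
  - have h k : k \in G -> modulus (c k) <= 2 * rlp +oo%E G (fun i => modulus (c i)).
      move=> kG; apply: (@le_trans _ _ (rlp +oo%E G (fun i => modulus (c i)))).
        by rewrite rlp_oo (@bigmax_fset_ge _ _ (fun i => modulus (c i))).
      by rewrite ler_peMl ?rlp_ge0// ler1n.
    move=> /pairsP[k kG [->|->]]; have [e1 e2] := pair_coefE c k hn.
      by rewrite e1 h.
    by rewrite e2 modulusN h.
have S2 : \sum_(i <- pairs n G) modulus (pair_coef n c i) `^ r = 2 * \sum_(k <- G) modulus (c k)
  `^ r.
  rewrite sum_pairs// mulr_sumr; apply: eq_bigr => k _.
  by have [-> ->] := pair_coefE c k hn; rewrite modulusN mulr_natl mulr2n.
have S0 : 0 <= \sum_(k <- G) modulus (c k) `^ r.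
  by rewrite sumr_ge0// => k _; exact: powR_ge0.
rewrite !lp_normE; apply/andP; split.
  by apply: rlp_le; rewrite ?rlp_ge0// rlp_powR// S2 ler_peMl// ler1n.
apply: rlp_le; rewrite ?mulr_ge0 ?rlp_ge0// S2 powRM ?rlp_ge0// rlp_powR//.
by rewrite ler_wpM2r// -[leLHS]powRr1// ler_powR// ler1n.
Qed.

Lemma spreading_model_pairs p F (X : normedModType K) (x : nat -> X) : (1%:E <= p)%E ->
  spreading_model p F x -> exists a b : R, [/\ 0 < a, 0 < b &
    forall n G c, increasing n -> F (pairs n G) ->
      lp_norm p G c <= a * normR (\sum_(k <- G) c k *: (x (n k.*2) - x (n k.*2.+1))) /\
      normR (\sum_(k <- G) c k *: (x (n k.*2) - x (n k.*2.+1))) <= b * lp_norm p G c].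
Proof.
move=> p1 [a [b [a0 b0 h]]]; exists a, (b * 2); split=> [//||n G c hn FG];
  first by rewrite mulr_gt0.
have [h1 h2] := h _ FG (pair_coef n c); have /andP[l1 l2] := lp_norm_pairs G c p1 hn.
rewrite comb_norm_pairs// in h1 h2; split; first exact: le_trans l1 h1.
by rewrite (le_trans h2)// -mulrA ler_wpM2l// ltW.
Qed.

Lemma spreading_model_bounded p F (X : normedModType K) (x : nat -> X) : (1%:E <= p)%E ->
  (forall i, (0 < i)%N -> F [fset i]%fset) -> spreading_model p F x ->
  exists C, 0 <= C /\ forall i, normR (x i) <= C.
Proof.
move=> p1 F1 [a [b [a0 b0 h]]]; exists (b + normR (x 0%N)).
split=> [|i]; first by rewrite addr_ge0 ?normR_ge0// ltW.
have [->|i0] := posnP i; first by rewrite lerDr ltW.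
have [_] := h _ (F1 i i0) (fun=> 1).
rewrite lp_norm1// modulus1 mulr1 /comb_norm big_seq_fset1 scale1r => /le_trans; apply.
by rewrite lerDl normR_ge0.
Qed.

End PairCombinations.

(** * Spreading models common to a sequence and its image *)

Section Tails.
Context (R : realType) (s : scalars).
Local Notation K := (scalar_field R s).
Implicit Types (E G H : {fset nat}) (w : R).

(** Beyond a finite set that nearly attains the supremum of the sums of [r]-th
    powers, no finite set can have a large sum. *)
Lemma lp_small_tails (r C : R) (a : nat -> K) : 1 <= r ->
  (forall E, lp_norm r%:E E a <= C) -> small_tails r%:E a.
Proof.
move=> r1 aC e e0; have r0 : 0 < r by rewrite (lt_le_trans ltr01).
have C0 : 0 <= C by apply: le_trans (aC fset0); exact: lp_norm_ge0.
pose T E := \sum_(i <- E) modulus (a i) `^ r.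
have T_le E : T E <= C `^ r.
  rewrite /T -(rlp_powR E (fun i => modulus (a i)) r1) ge0_ler_powR ?nnegrE ?rlp_ge0// ?(ltW r0)//.
  by rewrite -lp_normE; exact: aC.
have hs : has_sup (range T).
  by split; [exists (T fset0), fset0|exists (C `^ r) => _ [E _ <-]; exact: T_le].
have [_ [E0 _ <-] hE0] := sup_adherent (powR_gt0 r e0) hs.
exists (fsup E0) => E hE.
rewrite lp_normE; apply: rlp_le => //; first exact: ltW.
rewrite -/(T E) -(lerD2l (T E0)).
have -> : T E0 + T E = T (E0 `|` E)%fset.
  rewrite /T [RHS](big_fsetID _ [pred i | i \in E0])/=; congr (_ + _); apply: eq_fbigl => i;
    rewrite !inE/=.
    by apply/esym/andb_idl => ->.
  case: (boolP (i \in E0)) => [iE0|]; rewrite ?andbF ?andbT//.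
  by apply/negbTE/negP => /hE; rewrite leqNgt lt_fsup.
apply: (@le_trans _ _ (sup (range T))); first by apply: ub_le_sup;
  [exact: hs.2|exists (E0 `|` E)%fset].
by rewrite -lerBlDr ltW.
Qed.

Lemma big_not_small_tails (a : nat -> K) : ~ small_tails +oo%E a ->
  exists e : R, 0 < e /\ exists m : nat -> nat, increasing m /\ forall k, e < modulus (a (m k)).
Proof.
move=> /existsNP[e /not_implyP[e0 /forallNP h]]; exists e; split=> //.
suff /infinitely_many_increasing[m [hm _ am]] : infinitely_many (fun i => e < modulus (a i)).
  by exists m.
move=> M; have /existsNP[E /not_implyP[ME /negP]] := h M.+1; rewrite -ltNge => lt.
apply: contrapT => hM; move: lt; apply/negP; rewrite -leNgt lp_normE rlp_oo.
apply: le_bigmax_fset => [|i iE]; first exact: ltW.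
by rewrite leNgt; apply/negP => ei; apply: hM; exists i => //; exact: ME.
Qed.

Lemma sum_geometric_le (delta : R) G : 0 <= delta -> \sum_(k <- G) delta / 2 ^+ k.+1 <= delta.
Proof.
move=> d0.
have -> : \sum_(k <- G) delta / 2 ^+ k.+1 = \sum_(k <- iota 0 (fsup G) | k \in G) delta / 2 ^+ k.+1.
  rewrite -[RHS]big_filter; apply: perm_big; apply: uniq_perm;
    rewrite ?fset_uniq ?filter_uniq ?iota_uniq//.
  by move=> k; rewrite mem_filter mem_iota/= add0n; apply/esym/andb_idr => /lt_fsup.
apply: (@le_trans _ _ (\sum_(k <- iota 0 (fsup G)) delta / 2 ^+ k.+1)).
  rewrite big_mkcond/=; apply: ler_sum => k _; case: ifP => // _.
  by rewrite divr_ge0// exprn_ge0.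
have -> : \sum_(k <- iota 0 (fsup G)) delta / 2 ^+ k.+1 = delta - delta / 2 ^+ fsup G.
  elim: (fsup G) => [|N IH]; first by rewrite big_nil expr0 divr1 subrr.
  rewrite -addn1 iotaD big_cat/= big_seq1 IH add0n addn1 exprS; field.
  by rewrite expf_neq0.
by rewrite gerBl divr_ge0// exprn_ge0.
Qed.

End Tails.

Section Combinations.
Context (R : realType) (s : scalars).
Local Notation K := (scalar_field R s).
Implicit Types (E G H : {fset nat}) (w : R).

Lemma comb_difference (g : gauge R s) (x : nat -> seqsp g) n G (c : nat -> K) i :
  (\sum_(k <- G) c k *: (x (n k.*2) - x (n k.*2.+1)) : seqsp g) i =
  \sum_(k <- G) c k * difference (fun j => seqval (x j) : nat -> K) n k i.
Proof. by rewrite seqval_sum; apply: eq_bigr => k _. Qed.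

Lemma lp_norm_comb_close p (u v : nat -> nat -> K) (e : nat -> R) G (c : nat -> K) E :
  (1%:E <= p)%E -> (forall k, k \in G -> modulus (c k) <= 1) ->
  (forall k, lp_norm p E (fun i => u k i - v k i) <= e k) ->
  lp_norm p E (fun i => \sum_(k <- G) c k * u k i) <=
    lp_norm p E (fun i => \sum_(k <- G) c k * v k i) + \sum_(k <- G) e k.
Proof.
move=> p1 c1 uv.
rewrite (@eq_lp_norm _ _ _ _ _ (fun i => \sum_(k <- G) c k * v k i +
  \sum_(k <- G) c k * (u k i - v k i))); last first.
  by move=> i _; rewrite -big_split/=; apply: eq_bigr => k _; ring.
rewrite (le_trans (ler_lp_normD _ _ _ p1))// lerD2l (le_trans (lp_norm_sum _ _ _ p1))//.
rewrite big_seq [leRHS]big_seq; apply: ler_sum => k kG.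
by rewrite lp_normZ// -[leRHS]mul1r ler_pM ?modulus_ge0 ?lp_norm_ge0 ?c1.
Qed.

Lemma lp_norm_distC p E (a b : nat -> K) : (1%:E <= p)%E ->
  lp_norm p E (fun i => a i - b i) <= lp_norm p E (fun i => b i - a i).
Proof. by move=> p1; apply: ler_lp_norm => // i _; rewrite -modulusN opprB. Qed.

Lemma lp_norm_hump_le p E (a : nat -> K) M N : (1%:E <= p)%E ->
  lp_norm p E (hump a M N) <= lp_norm p E a.
Proof.
move=> p1; apply: ler_lp_norm => // i _; rewrite /hump; case: ifP => // _.
by rewrite modulus0 modulus_ge0.
Qed.

(** A set [E] of a spreading family may meet the blocks [[M k, M k.+1)] anywhere;
    as it can be thinned to one point per block and moved to the right, the set
    of blocks that it meets is controlled by their right ends. *)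
Lemma spread_blocks (F : set {fset nat}) (M : nat -> nat) E H : hereditary F -> spreading F ->
  increasing M -> F E -> (forall k, k \in H -> exists2 i, i \in E & (M k <= i < M k.+1)%N) ->
  F [fset M k.+1 | k in H]%fset.
Proof.
move=> hF sF hM FE HE.
have mono k l i : (M k <= i < M k.+1)%N -> (M l <= i < M l.+1)%N -> k = l.
  move=> /andP[k1 k2] /andP[l1 l2].
  have [kl|lk|//] := ltngtP k l.
    by have := leq_trans k2 (leq_trans (increasing_block hM kl) l1); rewrite ltnn.
  by have := leq_trans l2 (leq_trans (increasing_block hM lk) k1); rewrite ltnn.
have [k|i hi] := @choice nat nat (fun k i => k \in H -> i \in E /\ (M k <= i < M k.+1)%N).
  by have [/HE[i iE ki]|kH] := boolP (k \in H); [exists i|exists 0%N].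
have [j|f hf] := @choice nat nat (fun j z => forall k, (M k <= j < M k.+1)%N -> z = M k.+1).
  have [[k hk]|/forallNP h] := pselect (exists k, (M k <= j < M k.+1)%N).
    by exists (M k.+1) => l hl; rewrite (mono _ _ _ hk hl).
  by exists 0%N => k /h.
have -> : [fset M k.+1 | k in H]%fset = [fset f j | j in [fset i k | k in H]]%fset.
  apply/fsetP => x; apply/imfsetP/imfsetP => [[k /= kH ->]|[_ /= /imfsetP[k /= kH ->] ->]].
    by exists (i k); [apply: in_imfset|rewrite (hf _ k)//; have [] := hi k kH].
  by exists k => //; apply: hf; have [] := hi k kH.
apply: sF.
- move=> _ _ /imfsetP[k /= kH ->] /imfsetP[l /= lH ->] kl.
  have [_ ik] := hi k kH; have [_ il] := hi l lH.
  rewrite (hf _ _ ik) (hf _ _ il); apply: (hM); rewrite ltnS ltnNge; apply/negP => lk.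
  move: lk; rewrite leq_eqVlt => /orP[/eqP lk|lk]; first by move: kl; rewrite lk ltnn.
  have := increasing_block hM lk.
  by case/andP: ik => k1 _; case/andP: il => _ l2; lia.
- move=> _ /imfsetP[k /= kH ->]; have [_ ik] := hi k kH.
  by rewrite (hf _ _ ik); case/andP: ik => _ /ltnW.
- apply: hF FE; apply/fsubsetP => _ /imfsetP[k /= kH ->]; by have [] := hi k kH.
Qed.

End Combinations.

Section NoCommonSpreadingModel.
Context (R : realType) (s : scalars).
Local Notation K := (scalar_field R s).
Implicit Types (E G H : {fset nat}) (w : R).

(** What [weighted_average] provides; the operators are studied for an abstract
    weighted family with this property. *)
Definition averaging (P : R -> set {fset nat}) (F : set {fset nat}) :=
  forall n m, increasing n -> increasing m -> forall e : R, 0 < e ->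
  exists G beta, [/\ probability_on G beta, F (pairs n G) &
    forall w H, P w [fset m i | i in H]%fset -> w * \sum_(i <- (H `&` G)%fset) beta i <= e].

Definition all_sets (w : R) (E : {fset nat}) := w = 1.

Fact all_sets01 w E : all_sets w E -> 0 < w <= 1.
Proof. by move=> ->; rewrite ltr01 lexx. Qed.

Fact all_sets_fset1 i : all_sets 1 [fset i]%fset. Proof. by []. Qed.

(** No Schreier set contains 0, so the coordinate 0 must be controlled separately
    for [lp_gauge] to define a norm. *)
Definition with_zero (P : R -> set {fset nat}) w E := P w E \/ w = 1 /\ E = [fset 0%N]%fset.

Fact with_zero01 P : (forall w E, P w E -> 0 < w <= 1) -> forall w E, with_zero P w E -> 0 < w <= 1.
Proof. by move=> P01 w E [/P01//|[-> _]]; rewrite ltr01 lexx. Qed.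

Fact with_zero_fset1 (P : R -> set {fset nat}) : (forall i, (0 < i)%N -> P 1 [fset i]%fset) ->
  forall i, with_zero P 1 [fset i]%fset.
Proof. by move=> P1 i; have [->|i0] := posnP i; [right|left; exact: P1]. Qed.

Lemma powR_le_inv (r x y : R) : 1 <= r -> 0 <= x -> 0 <= y -> x `^ r <= y `^ r -> x <= y.
Proof.
move=> r1 x0 y0; apply: contraTT; rewrite -!ltNge => h.
by rewrite gt0_ltr_powR// (lt_le_trans ltr01).
Qed.

Variables (P : R -> set {fset nat}) (F : set {fset nat}).
Hypothesis P01 : forall w E, P w E -> 0 < w <= 1.
Hypothesis P_her : forall w, hereditary (P w).
Hypothesis P_spr : forall w, spreading (P w).
Hypothesis P1 : forall i, (0 < i)%N -> P 1 [fset i]%fset.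
Hypothesis F_her : hereditary F.
Hypothesis F1 : forall i, (0 < i)%N -> F [fset i]%fset.
Hypothesis avg : averaging P F.

(** Suppose that [x] in [l_p] and its image [z] are both spreading models, and
    pass to differences close to blocks. The coefficients [beta k `^ (1 / r)] of a
    thin average [beta] have norm 1 in [l_p], and their support is admissible, so
    the combination has norm bounded below in the target. There its norm is
    computed on sets [E] with [P w E], and such a set meets blocks of small total
    mass, so the norm is small. *)
Lemma lp_no_common_spreading_model (p : \bar R) (p1 : (1%:E <= p)%E)
    (x : nat -> seqsp (lp_gauge s p1 all_sets01 all_sets_fset1))
    (z : nat -> seqsp (lp_gauge s p1 (with_zero01 P01) (with_zero_fset1 P1))) :
  (p < +oo)%E -> (forall n, seqval (z n) = x n) -> spreading_model p F x -> ~ spreading_model p F z.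
Proof.
move=> poo zx smx smz.
have [r r1 pE] : exists2 r : R, 1 <= r & p = r%:E by have [//|pE] := exponentP p1;
  rewrite pE in poo.
subst p; have r0 : 0 < r by rewrite (lt_le_trans ltr01).
have [C [C0 hC]] := spreading_model_bounded p1 F1 smx.
have xC n E : lp_norm r%:E E (x n : nat -> K) <= C.
  rewrite (le_trans _ (hC n))// normR_gnorm.
  by have := @lp_gauge_le _ _ _ _ _ _ _ (x n) 1 E erefl; rewrite mul1r.
have [a [b [a0 b0 hz]]] := spreading_model_pairs p1 smz.
(* With this value, the upper estimate [a * (2 * C * delta + delta)] obtained
   below is 1/2, whereas the lower estimate is 1. *)
pose delta := (2 * a * (1 + 2 * C))^-1.
have d0 : 0 < delta by rewrite invr_gt0 !mulr_gt0// ltr_wpDr ?mulr_ge0.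
have y_bounded i : exists C : R, forall n, modulus ((x n : nat -> K) i) <= C.
  by exists C => n; rewrite (le_trans _ (xC n [fset i]%fset))// lp_norm1.
have y_tails n : small_tails r%:E (x n : nat -> K).
  exact: (@lp_small_tails _ _ r C).
have e0 k : 0 < delta / 2 ^+ k.+1 by rewrite divr_gt0// exprn_gt0.
have [n [M [hn hM n0 M0 hump_err]]] := gliding_hump p1 y_bounded y_tails e0.
have hM1 : increasing (fun k => M k.+1) by move=> k l kl; apply: hM.
have [G [beta [[b_ge0 bS] FG hH]]] := avg hn hM1 (powR_gt0 r d0).
pose c k : K := of_real s (beta k `^ r^-1).
have cE k : modulus (c k) = beta k `^ r^-1 by rewrite modulus_of_real ger0_norm// powR_ge0.
have cr k : modulus (c k) `^ r = beta k.
  by rewrite cE -powRrM mulVf ?gt_eqF// powRr1.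
have c1 k : k \in G -> modulus (c k) <= 1.
  move=> kG; apply: (powR_le_inv r1); rewrite ?modulus_ge0// cr powR1 -bS.
  by rewrite (bigD1_seq k) ?fset_uniq//= lerDl sumr_ge0.
have lpG : lp_norm r%:E G c = 1.
  rewrite lp_normE rlp_fin; under eq_bigr do rewrite cr.
  by rewrite bS powR1.
have [+ _] := hz n G c hn FG; rewrite lpG; apply/negP; rewrite -ltNge.
apply: (@le_lt_trans _ _ (a * (2 * C * delta + delta))); last first.
  rewrite (_ : a * _ = 2^-1) ?invf_lt1 ?ltr1n//.
  by rewrite /delta; field; rewrite !gt_eqF// ltr_wpDr ?mulr_ge0.
rewrite ler_wpM2l ?(ltW a0)// normR_gnorm; apply: lp_gnorm_le.
  by rewrite addr_ge0 ?mulr_ge0// ltW.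
move=> w E PE; have /andP[w0 w1] := with_zero01 P01 PE.
pose y n := (x n : nat -> K).
rewrite (@eq_lp_norm _ _ _ _ _ (fun i => \sum_(k <- G) c k * difference y n k i)); last first.
  move=> i _; apply: (etrans (comb_difference z n G c i)); apply: eq_bigr => k _.
  by rewrite /difference !zx.
have close := @lp_norm_comb_close R s r%:E (difference y n)
  (fun k => hump (difference y n k) (M k) (M k.+1)) _ G c E p1 c1 (fun k => hump_err k E).
apply: (le_trans (ler_wpM2l (ltW w0) close)).
rewrite mulrDr lerD//; last first.
  rewrite -[leRHS]mul1r ler_pM ?(ltW w0)//; first by rewrite sumr_ge0// => k _; exact: ltW.
  by apply: sum_geometric_le; exact: ltW.
pose H := [fset k in G | has (fun i => M k <= i < M k.+1)%N E]%fset.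
apply: (@le_trans _ _ (w * (2 * C * lp_norm r%:E H c))).
  rewrite ler_wpM2l ?(ltW w0)//.
  apply: (@lp_norm_disjoint_le R s (fun k => hump (difference y n k) (M k) (M k.+1)) G
    (@hump_disjoint R s (difference y n) M hM) r%:E E H c (2 * C) p1).
  - by rewrite mulr_ge0.
  - move=> k; rewrite (le_trans (lp_norm_hump_le _ _ _ _ p1))//.
    rewrite (@eq_lp_norm _ _ _ _ _ (fun i => y (n k.*2) i + - 1 * y (n k.*2.+1) i)).
      by rewrite (le_trans (ler_lp_normD _ _ _ p1))// lp_normZ//
        modulusN modulus1 mul1r mulrDl mul1r; apply: lerD; exact: xC.
    by move=> i _; rewrite mulN1r.
  - move=> k i kG iE; rewrite /hump; case: ifP => [ki _|]; last by rewrite eqxx.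
    by rewrite !inE/= kG; apply/hasP; exists i.
rewrite mulrCA ler_wpM2l ?mulr_ge0//.
have HE k : k \in H -> exists2 i, i \in E & (M k <= i < M k.+1)%N.
  by rewrite !inE/= => /andP[_ /hasP].
case: PE => [PE|[_ E0]]; last first.
  rewrite (_ : H = fset0) ?lp_norm0 ?mulr0 ?(ltW d0)//.
  apply/fsetP => k; rewrite !inE; apply/negbTE/negP => kH.
  have [|i] := HE k; first by rewrite !inE.
  have Mk : (0 < M k)%N by case: (k) => // k'; apply: ltn_trans M0 (hM _ _ _).
  by rewrite E0 inE => /eqP ->; rewrite leqNgt Mk.
have := hH w H (spread_blocks (P_her (w:=w)) (P_spr (w:=w)) hM PE HE).
rewrite (_ : (H `&` G)%fset = H); last first.
  by apply/fsetIidPl; apply/fsubsetP => k; rewrite !inE/= => /andP[].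
move=> wH; apply: (powR_le_inv r1); rewrite ?mulr_ge0 ?lp_norm_ge0 ?(ltW w0) ?(ltW d0)//.
apply: (le_trans (ge1r_powRZ _ _ _)) => //; first by rewrite w0.
  exact: lp_norm_ge0.
apply: le_trans wH; rewrite ler_wpM2l ?(ltW w0)// lp_normE rlp_powR//.
by under eq_bigr do rewrite cr.
Qed.

End NoCommonSpreadingModel.

Section NoCommonSpreadingModelInfinity.
Context (R : realType) (s : scalars).
Local Notation K := (scalar_field R s).
Implicit Types (E G H : {fset nat}) (w : R).
Variables (P : R -> set {fset nat}) (F : set {fset nat}).
Hypothesis P01 : forall w E, P w E -> 0 < w <= 1.

(** If [a] were large along [m], a thin average along [m] would be a functional
    allowed in the dual norm after multiplication by a large factor, and its
    value at [a] would be too large. So the space is contained in [c_0]. *)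
Lemma dual_small_tails F' (a : seqsp (dual_gauge s P01)) : averaging P F' ->
  small_tails +oo%E (a : nat -> K).
Proof.
move=> avg; apply: contrapT => /big_not_small_tails[e [e0 [m [hm em]]]].
have e'0 : 0 < e / (gnorm a + 1) by rewrite divr_gt0// ltr_wpDl ?gnorm_ge0.
have hid : increasing id by [].
have [G [beta [[b0 bS] _ hH]]] := avg id m hid hm _ e'0.
have := dual_gauge_le a e'0 b0 hH; apply/negP; rewrite -ltNge.
apply: (@lt_le_trans _ _ e).
  by rewrite mulrAC ltr_pdivrMr ?ltr_wpDl ?gnorm_ge0// ltr_pM2l// ltrDl.
rewrite -[leLHS]mul1r -bS mulr_suml; apply: ler_sum => i _.
by rewrite ler_wpM2l// ltW.
Qed.

Hypothesis F_her : hereditary F.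
Hypothesis F1 : forall i, (0 < i)%N -> F [fset i]%fset.
Hypothesis avg : averaging P F.

(** Here the domain has the stronger norm. As the images are bounded below in the
    supremum norm, each block has a large coordinate [m k]. A thin average along
    [m], multiplied by a large factor, is a functional of the dual norm, and it is
    large at the sum of the blocks. But this sum has bounded norm by the upper
    [c_0] estimate in the domain. *)
Lemma dual_no_common_spreading_model (p1 : (1%:E <= +oo :> \bar R)%E)
    (x : nat -> seqsp (dual_gauge s P01))
    (z : nat -> seqsp (lp_gauge s p1 (@all_sets01 R) (@all_sets_fset1 R))) :
  (forall n, seqval (z n) = x n) -> spreading_model +oo%E F x -> ~ spreading_model +oo%E F z.
Proof.
move=> zx smx smz.
have [C [C0 hC]] := spreading_model_bounded p1 F1 smx.
have xC n i : modulus ((x n : nat -> K) i) <= C.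
  by rewrite (le_trans (coord_dual_gnorm (x n) i))// -normR_gnorm.
have [a1 [b [_ b0 hx]]] := spreading_model_pairs p1 smx.
have [a [b1 [a0 _ hz]]] := spreading_model_pairs p1 smz.
(* The blocks have norm at least [1 / a], hence a coordinate above [d]. The errors
   add up to at most [d / 2], which leaves [d / 2] for the sum at this coordinate. *)
pose d := (2 * a)^-1.
have d0 : 0 < d by rewrite invr_gt0 mulr_gt0.
have d20 : 0 < d / 2 by rewrite divr_gt0.
have e0 k : 0 < d / 2 / 2 ^+ k.+1 by rewrite divr_gt0// exprn_gt0.
pose y n := (x n : nat -> K).
have y_bounded i : exists C : R, forall n, modulus (y n i) <= C.
  by exists C => n; exact: xC.
have y_tails n : small_tails +oo%E (y n) := dual_small_tails (x n) avg.
have [n [M [hn hM n0 M0 hump_err]]] := gliding_hump p1 y_bounded y_tails e0.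
have small k i : ~~ (M k <= i < M k.+1)%N -> modulus (difference y n k i) <= d / 2 / 2 ^+ k.+1.
  move=> /negbTE ki; have := hump_err k [fset i]%fset.
  by rewrite lp_norm1// /hump ki subr0.
have [k|m hm] := @choice nat nat (fun k m => (M k <= m < M k.+1)%N /\
    ((exists2 i, (M k <= i < M k.+1)%N & d <= modulus (difference y n k i)) ->
       d <= modulus (difference y n k m))).
  have [[i ki di]|h] := pselect (exists2 i, (M k <= i < M k.+1)%N & d <=
    modulus (difference y n k i)).
    by exists i.
  by exists (M k); split=> //; rewrite leqnn/=; apply: hM.
have m_inc : increasing m.
  move=> k l kl; have [/andP[_ h1] _] := hm k; have [/andP[h2 _] _] := hm l.
  exact: leq_trans h1 (leq_trans (increasing_block hM kl) h2).
have eta0 : 0 < d / 4 / b by rewrite !divr_gt0.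
have [G [beta [[b_ge0 bS] FG hH]]] := avg hn m_inc eta0.
have large k : k \in G -> d <= modulus (difference y n k (m k)).
  move=> kG; have [_] := hm k; apply.
  have Fk : F (pairs n [fset k]%fset).
    apply: F_her FG; apply/fsubsetP => j /pairsP[l]; rewrite inE => /eqP ->.
    by move=> h; apply/pairsP; exists k.
  have [+ _] := hz n [fset k]%fset (fun=> 1) hn Fk.
  rewrite lp_norm1// modulus1 normR_gnorm => h.
  have [i hi] : exists i, d < modulus (difference y n k i).
    apply: contrapT => /forallNP hi; move: h; apply/negP; rewrite -ltNge.
    apply: (@le_lt_trans _ _ (a * d)); last first.
      by rewrite (_ : a * d = 2^-1) ?invf_lt1 ?ltr1n// /d; field; rewrite gt_eqF.
    rewrite ler_wpM2l ?(ltW a0)//; apply: lp_gnorm_le; first exact: ltW.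
    move=> w E ->; rewrite mul1r lp_normE rlp_oo; apply: le_bigmax_fset => [|i _]; first exact: ltW.
    rewrite (comb_difference z) big_seq_fset1 mul1r.
    by have := hi i; rewrite /difference !zx => /negP; rewrite -leNgt.
  exists i; last exact: ltW.
  apply: contraT => /small; move=> /(lt_le_trans hi); rewrite ltNge => /negP; case.
  rewrite ler_pdivrMr ?exprn_gt0// ler_pM ?(ltW d0)//.
  by rewrite (@le_trans _ _ 1) ?invf_le1 ?ler1n// exprn_ege1// ler1n.
have [_ +] := hx n G (fun=> 1) hn FG.
have lp1 : lp_norm +oo%E G (fun=> 1 : K) <= 1.
  by rewrite lp_normE rlp_oo; apply: le_bigmax_fset => // i _; rewrite modulus1.
move=> /le_trans/(_ (ler_wpM2l (ltW b0) lp1)); rewrite mulr1 normR_gnorm.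
set T := \sum_(k <- G) _ => Tb.
have := dual_gauge_le T eta0 b_ge0 hH; apply/negP; rewrite -ltNge.
apply: (@lt_le_trans _ _ (d / 2)).
  apply: (@le_lt_trans _ _ (d / 4 / b * b)); first by rewrite ler_wpM2l// ltW.
  by rewrite divfK ?gt_eqF//; lra.
apply: (@le_trans _ _ (\sum_(i <- G) beta i * (d / 2))); first by rewrite -mulr_suml bS mul1r.
rewrite big_seq [leRHS]big_seq; apply: ler_sum => k kG.
rewrite ler_wpM2l//.
have TE : T (m k) = \sum_(j <- G) difference y n j (m k).
  rewrite (comb_difference x); apply: eq_bigr => j _; by rewrite mul1r.
have -> : d / 2 = d - d / 2 by lra.
rewrite lerBlDr (le_trans (large k kG))//.
have -> : difference y n k (m k) = T (m k) + - \sum_(j <- (G `\ k)%fset) difference y n j (m k).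
  by rewrite TE (big_fsetD1 k)//= addrK.
rewrite (le_trans (ler_modulusD _ _))// lerD2l modulusN (le_trans (ler_modulus_sum _ _ _))//.
rewrite (le_trans _ (sum_geometric_le (G `\ k)%fset (ltW d20)))//.
rewrite big_seq [leRHS]big_seq; apply: ler_sum => j; rewrite !inE => /andP[jk jG].
apply: small; apply/negP => /andP[j1 j2]; have [/andP[k1 k2] _] := hm k.
have [kj|jk'|jk'] := ltngtP k j; last by rewrite jk' eqxx in jk.
  by have := leq_trans k2 (leq_trans (increasing_block hM kj) j1); rewrite ltnn.
by have := leq_trans j2 (leq_trans (increasing_block hM jk') k1); rewrite ltnn.
Qed.

End NoCommonSpreadingModelInfinity.

Section DistinctExponents.
Context (R : realType) (s : scalars).
Local Notation K := (scalar_field R s).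
Implicit Types (E G H : {fset nat}) (w : R) (p q : \bar R).

(** The growth exponent of the norm of a sum of [N] unit vectors. *)
Definition inv_exponent p : R := if p is r%:E then r^-1 else 0.

Lemma inv_exponent_ge0 p : (1%:E <= p)%E -> 0 <= inv_exponent p.
Proof. by move=> /exponentP[[r r1 ->]|->] //=; rewrite invr_ge0 (le_trans ler01). Qed.

Lemma inv_exponent_inj p q : (1%:E <= p)%E -> (1%:E <= q)%E ->
  inv_exponent p = inv_exponent q -> p = q.
Proof.
have n0 (r : R) : 1 <= r -> r^-1 != 0 by move=> r1; rewrite invr_eq0 gt_eqF// (lt_le_trans ltr01).
move=> /exponentP[[r r1 ->]|->] /exponentP[[r' r'1 ->]|->] //= h.
- by rewrite (invr_inj h).
- by have := n0 r r1; rewrite h eqxx.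
- by have := n0 r' r'1; rewrite -h eqxx.
Qed.

Lemma lp_norm_one p G : (1%:E <= p)%E -> G != fset0 ->
  lp_norm p G (fun=> 1 : K) = (size G)%:R `^ inv_exponent p.
Proof.
move=> p1 /fset0Pn[i iG]; have [[r r1 ->]|->] := exponentP p1.
  rewrite lp_normE rlp_fin; congr (_ `^ _); under eq_bigr do rewrite modulus1 powR1.
  by rewrite big_const_seq count_predT iter_addr_0.
rewrite powRr0; apply/eqP; rewrite eq_le; apply/andP; split.
  by rewrite lp_normE rlp_oo; apply: le_bigmax_fset => // j _; rewrite modulus1.
by have := @le_coord_lp_norm R s +oo%E G (fun=> 1) i (leey _) iG; rewrite modulus1.
Qed.

Lemma powR_outgrows (t u A B : R) : 0 <= t -> t < u -> 0 <= A -> 0 <= B ->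
  exists N : nat, forall n : nat, (N <= n)%N -> A + B * n%:R `^ t < n%:R `^ u.
Proof.
move=> t0 tu A0 B0; have ut0 : 0 < u - t by rewrite subr_gt0.
exists (Num.truncn ((A + B) `^ (u - t)^-1)).+1 => n hn.
have n1 : (0 < n)%N by apply: leq_trans hn.
have n1' : 1 <= n%:R :> R by rewrite ler1n.
have nt : 1 <= n%:R `^ t by rewrite -[leLHS](powRr0 n%:R) ler_powR.
have AB : A + B < n%:R `^ (u - t).
  have -> : A + B = ((A + B) `^ (u - t)^-1) `^ (u - t).
    by rewrite -powRrM mulVf ?gt_eqF// powRr1// addr_ge0.
  rewrite gt0_ltr_powR// ?nnegrE ?powR_ge0//.
  by rewrite (lt_le_trans (truncnS_gt _))// ler_nat.
rewrite -[u](subrK t) powRD; last by rewrite (gt_eqF (lt_le_trans ltr01 n1')) implybT.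
apply: (@le_lt_trans _ _ ((A + B) * n%:R `^ t)).
  by rewrite mulrDl lerD2r ler_peMr.
by rewrite ltr_pM2r// (lt_le_trans ltr01).
Qed.

Variables (P : R -> set {fset nat}) (F : set {fset nat}).
Hypothesis P1 : forall i, (0 < i)%N -> P 1 [fset i]%fset.
Hypothesis F_her : hereditary F.
Hypothesis F1 : forall i, (0 < i)%N -> F [fset i]%fset.
Hypothesis avg : averaging P F.

(** A probability whose atoms are small has a large support. *)
Lemma large_pairs n N : increasing n -> exists G, [/\ F (pairs n G), (N <= size G)%N & G != fset0].
Proof.
move=> hn; have e0 : 0 < N.+1%:R^-1 :> R by rewrite invr_gt0.
(* The shift by 1 avoids the singleton of 0, which no Schreier family contains. *)
have hS : increasing S by [].
have [G [beta [[b0 bS] FG hH]]] := avg hn hS e0; exists G; split=> //.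
  have : 1 <= (size G)%:R * N.+1%:R^-1 :> R.
    rewrite -[leLHS]bS; apply: (@le_trans _ _ (\sum_(k <- G) N.+1%:R^-1)); last first.
      by rewrite big_const_seq count_predT iter_addr_0 mulr_natl.
    rewrite big_seq [leRHS]big_seq; apply: ler_sum => k kG.
    have Pk : P 1 [fset i.+1 | i in [fset k]]%fset.
      rewrite (_ : [fset i.+1 | i in [fset k]]%fset = [fset k.+1]%fset); first exact: P1.
      apply/fsetP => i; rewrite inE; apply/imfsetP/eqP => [[j /=]|->];
        first by rewrite inE => /eqP ->.
      by exists k => //=; rewrite inE.
    have := hH _ _ Pk; rewrite mul1r (_ : ([fset k] `&` G)%fset = [fset k]%fset) ?big_seq_fset1//.
    by apply/fsetIidPl; apply/fsubsetP => i; rewrite inE => /eqP ->.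
  rewrite ler_pdivlMr ?mul1r// ler_nat; exact: ltnW.
by apply: contra_eq_neq bS => ->; rewrite big_seq_fset0 eq_sym oner_eq0.
Qed.

(** Sums of [N] almost disjoint blocks of [l_p], bounded above and below, have norm
    of order [N ^ (1 / p)]; those of an [l_q] spreading model have norm of order
    [N ^ (1 / q)]. For [1 / p < 1 / q] the upper estimate for the blocks and the
    lower one for the spreading model are incompatible as [N] grows, and for
    [1 / p > 1 / q] the other two are. *)
Lemma lp_no_spreading_model p q (p1 : (1%:E <= p)%E) (q1 : (1%:E <= q)%E)
    (z : nat -> seqsp (lp_gauge s p1 (@all_sets01 R) (@all_sets_fset1 R))) :
  p <> q -> (forall n, small_tails p (z n : nat -> K)) -> ~ spreading_model q F z.
Proof.
move=> pq z_tails smz.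
have [C [C0 hC]] := spreading_model_bounded q1 F1 smz.
pose y n := (z n : nat -> K).
have yC n E : lp_norm p E (y n) <= C.
  rewrite (le_trans _ (hC n))// normR_gnorm.
  by have := @lp_gauge_le _ _ _ _ _ _ _ (z n) 1 E erefl; rewrite mul1r.
have [a [b [a0 b0 hz]]] := spreading_model_pairs q1 smz.
(* The differences have norm at least [1 / a = 4 * d]; some finite set sees more
   than [2 * d] of it, and the hump at least [d] of that. *)
pose d := (4 * a)^-1.
have d0 : 0 < d by rewrite invr_gt0 mulr_gt0.
have e0 k : 0 < d / 2 ^+ k.+1 by rewrite divr_gt0// exprn_gt0.
have y_bounded i : exists C : R, forall n, modulus (y n i) <= C.
  by exists C => n; rewrite (le_trans _ (yC n [fset i]%fset))// lp_norm1.
have [n [M [hn hM n0 M0 hump_err]]] := gliding_hump p1 y_bounded z_tails e0.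
pose v k := hump (difference y n k) (M k) (M k.+1).
have v_disj := @hump_disjoint R s (difference y n) M hM.
have uC k E : lp_norm p E (difference y n k) <= 2 * C.
  rewrite (@eq_lp_norm _ _ _ _ _ (fun i => y (n k.*2) i + - 1 * y (n k.*2.+1) i)).
    by rewrite (le_trans (ler_lp_normD _ _ _ p1))// lp_normZ//
      modulusN modulus1 mul1r mulrDl mul1r; apply: lerD; exact: yC.
  by move=> i _; rewrite mulN1r.
have c1 G k : k \in G -> modulus (1 : K) <= 1 by rewrite modulus1.
have TE G i : (\sum_(k <- G) (1 : K) *: (z (n k.*2) - z (n k.*2.+1)) : seqsp _) i =
    \sum_(k <- G) 1 * difference y n k i by exact: comb_difference.
have [lt|lt|eq] := ltgtP (inv_exponent p) (inv_exponent q).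
- have ad0 : 0 <= a * d by rewrite mulr_ge0// ltW.
  have aC0 : 0 <= a * (2 * C) by rewrite !mulr_ge0// ltW.
  have [N hN] := powR_outgrows (inv_exponent_ge0 p1) lt ad0 aC0.
  have [G [FG NG G0]] := large_pairs N hn.
  have [+ _] := hz n G (fun=> 1) hn FG; apply/negP; rewrite -ltNge lp_norm_one//.
  apply: le_lt_trans (hN _ NG); rewrite -mulrA -mulrDr ler_wpM2l ?(ltW a0)// normR_gnorm.
  apply: lp_gnorm_le => [|w E ->]; first by rewrite addr_ge0 ?mulr_ge0 ?powR_ge0// ltW.
  rewrite mul1r (@eq_lp_norm _ _ _ _ _ (fun i => \sum_(k <- G) 1 * difference y n k i)) => [|i
    _]; last exact: TE.
  have close := @lp_norm_comb_close R s p (difference y n) v _ G (fun=> 1) E p1 (c1 G) (fun k =>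
    hump_err k E).
  rewrite (le_trans close)// addrC lerD//; first by rewrite sum_geometric_le// ltW.
  rewrite -lp_norm_one//.
  apply: (@lp_norm_disjoint_le R s v G v_disj p E G (fun=> 1) (2 * C) p1) => //;
    first by rewrite mulr_ge0.
  by move=> k; rewrite (le_trans (lp_norm_hump_le _ _ _ _ p1)).
- have [r r1 pE] : exists2 r : R, 1 <= r & p = r%:E.
    have [//|pE] := exponentP p1; move: lt; rewrite pE /= => /lt_geF.
    by rewrite inv_exponent_ge0.
  have bd0 : 0 <= b / d by rewrite divr_ge0// ltW.
  have [N hN] := powR_outgrows (inv_exponent_ge0 q1) lt ler01 bd0.
  have [G [FG NG G0]] := large_pairs N hn.
  have vd k : k \in G -> exists E, d <= lp_norm p E (v k).
    move=> kG; have Fk : F (pairs n [fset k]%fset).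
      apply: F_her FG; apply/fsubsetP => j /pairsP[l]; rewrite inE => /eqP ->.
      by move=> h; apply/pairsP; exists k.
    have [+ _] := hz n [fset k]%fset (fun=> 1) hn Fk.
    rewrite lp_norm1// modulus1 normR_gnorm => h.
    have [E hE] : exists E, 2 * d < lp_norm p E (difference y n k).
      apply: contrapT => /forallNP hE; move: h; apply/negP; rewrite -ltNge.
      apply: (@le_lt_trans _ _ (a * (2 * d))); last first.
        by rewrite (_ : a * (2 * d) = 2^-1) ?invf_lt1 ?ltr1n// /d; field; rewrite gt_eqF.
      rewrite ler_wpM2l ?(ltW a0)//; apply: lp_gnorm_le; first by rewrite mulr_ge0// ltW.
      move=> w E ->; rewrite mul1r (@eq_lp_norm _ _ _ _ _ (difference y n k)); last first.
        by move=> i _; rewrite TE big_seq_fset1 mul1r.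
      by have := hE E => /negP; rewrite -leNgt.
    exists E; rewrite -(lerD2r (d / 2 ^+ k.+1)); apply: (@le_trans _ _ (2 * d)).
      have -> : 2 * d = d + d by ring.
      rewrite lerD2l ler_pdivrMr ?exprn_gt0// ler_peMr ?(ltW d0)//.
      by rewrite exprn_ege1// ler1n.
    rewrite (le_trans (ltW hE))//.
    rewrite (@eq_lp_norm _ _ _ _ _ (fun i => v k i + (difference y n k i - v k i))).
      by rewrite (le_trans (ler_lp_normD _ _ _ p1))// lerD2l; exact: hump_err.
    by move=> i _; rewrite addrC subrK.
  have [E hE] : exists E : {fset nat}, d * lp_norm p G (fun=> 1 : K) <=
    lp_norm p E (fun i => \sum_(k <- G) (1 : K) * v k i).
    by move: vd; rewrite pE => vd;
      exact: (@lp_norm_disjoint_ge R s v G v_disj r (fun=> 1) d r1 (ltW d0) vd).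
  have := hN _ NG; apply/negP; rewrite -leNgt -(ler_pM2l d0) mulrDr mulr1.
  rewrite mulrA [d * (b / d)]mulrC divfK ?gt_eqF// -!lp_norm_one//.
  have [_ Tb] := hz n G (fun=> 1) hn FG.
  apply: (le_trans hE); rewrite addrC; apply: le_trans (lerD Tb (lexx _)).
  have err k : lp_norm p E (fun i => v k i - difference y n k i) <= d / 2 ^+ k.+1.
    by rewrite (le_trans (lp_norm_distC _ _ _ p1))//; exact: hump_err.
  have close := @lp_norm_comb_close R s p v (difference y n) _ G (fun=> 1) E p1 (c1 G) err.
  apply: (le_trans close); apply: lerD; last by apply: sum_geometric_le; exact: ltW.
  rewrite normR_gnorm -[leLHS]mul1r.
  rewrite (@eq_lp_norm _ _ _ _ _ (\sum_(k <- G) (1 : K) *: (z (n k.*2) - z (n k.*2.+1)) : seqsp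
    _)) => [|i _]; last by rewrite TE.
  exact: lp_gauge_le.
- by apply: pq; exact: inv_exponent_inj eq.
Qed.

End DistinctExponents.

(** * Weak compactness *)

Section WeakTopology.
Context (R : realType) (s : scalars).
Local Notation K := (scalar_field R s).
Variable Y : normedModType K.

Lemma dual_bound (f : dual Y) : exists2 C : R, 0 <= C & forall y, modulus (sval f y) <= C * normR y.
Proof.
case: f => f [M hM] /=; exists (modulus M); first exact: modulus_ge0.
move=> y; rewrite -(@le_of_real R s) of_realM -!modulusE -normRE.
have := hM y => h; rewrite (le_trans h)//.
have M0 : 0 <= M * `|y| by apply: le_trans h.
by rewrite -(ger0_norm M0) normrM normr_id.
Qed.

Lemma cvg_weakP (F : set_system Y) (t : Y) : Filter F ->
  (F --> (t : weak_space Y)) <->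
  forall f : dual Y, sval f @ F --> (sval f t : K^o).
Proof.
move=> FF; split=> [Ft f|h].
  have := (cvg_sup (fun f : dual Y => Topological.on (initial_topology (sval f : Y ->
    K^o))) t FF).1 Ft f.
  move=> h A nA; apply: (h); exact: (@initial_continuous Y K^o (sval f : Y -> K^o) t A nA).
apply/cvg_sup => f U; rewrite nbhsE => -[B [[A oA <-] At] BU].
by apply: filterS BU _; apply: h; exact: open_nbhs_nbhs.
Qed.

Lemma weak_continuous (f : dual Y) (t : weak_space Y) :
  (sval f : Y -> K^o) @ nbhs t --> (sval f t : K^o).
Proof. by apply: (cvg_weakP t (nbhs_filter t)).1. Qed.

(** The functionals are continuous into a Hausdorff space, so points that they
    separate have disjoint weak neighbourhoods. *)
Lemma weak_hausdorff :
  (forall y y' : Y, (forall f : dual Y, sval f y = sval f y') -> y = y') ->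
  hausdorff_space (weak_space Y).
Proof.
move=> sep y y' yy'; apply: sep => f.
apply: (@norm_hausdorff K K^o) => A B nA nB.
have [||t [tA tB]] := yy' (sval f @^-1` A) (sval f @^-1` B).
- exact: weak_continuous nA.
- exact: weak_continuous nB.
by exists (sval f t).
Qed.

End WeakTopology.

Local Arguments lp_norm : simpl never.

Section WeaklyCompactInclusion.
Context (R : realType) (s : scalars).
Local Notation K := (scalar_field R s).
Implicit Types (E G H : {fset nat}) (w : R).
Variables (P : R -> set {fset nat}) (F : set {fset nat}).
Hypothesis P01 : forall w E, P w E -> 0 < w <= 1.
Hypothesis P_her : forall w, hereditary (P w).
Hypothesis P1 : forall i, (0 < i)%N -> P 1 [fset i]%fset.
Hypothesis avg : averaging P F.
Variable p1 : (1%:E <= 1%:E :> \bar R)%E.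
Local Notation X := (seqsp (lp_gauge s p1 (@all_sets01 R) (@all_sets_fset1 R))).
Local Notation Y := (seqsp (lp_gauge s p1 (with_zero01 P01) (with_zero_fset1 P1))).

Lemma lp_norm_unit E j : lp_norm 1%:E E (unit_seq R s j : nat -> K) = (j \in E)%:R.
Proof.
case: (boolP (j \in E)) => jE; last first.
  by rewrite lp_norm0// => i iE; rewrite /unit_seq; case: eqP => // ij; rewrite -ij iE in jE.
apply/eqP; rewrite eq_le; apply/andP; split.
  rewrite (le_trans (lp_norm_support (F := [fset j]%fset) p1 _))//.
    by move=> i _; rewrite inE /unit_seq => /negbTE ->.
  by rewrite lp_norm1// /unit_seq eqxx modulus1.
by have := le_coord_lp_norm (unit_seq R s j : nat -> K) p1 jE; rewrite /unit_seq eqxx modulus1.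
Qed.

Section Functional.
Variables (e : nat -> Y) (f : dual Y).
Hypothesis he : forall i, seqval (e i) = unit_seq R s i.

(** Averages of the unit vectors have small norm, so no functional can stay away
    from zero along them. *)
Lemma unit_weakly_null (eps : R) : 0 < eps ->
  exists N, forall i, (N <= i)%N -> modulus (sval f (e i)) <= eps.
Proof.
move=> eps0; apply: contrapT => /forallNP h.
have /infinitely_many_increasing[m [hm m0 fm]] : infinitely_many (fun i => eps < modulus (sval f
  (e i))).
  move=> N; have /existsNP[i /not_implyP[Ni /negP]] := h N.+1; rewrite -ltNge => lt.
  by exists i.
have mk k : (0 < m k)%N by case: k => // k; apply: ltn_trans m0 (hm _ _ _).
have [C C0 hC] := dual_bound f.
have d0 : 0 < eps / (C + 1) by rewrite divr_gt0// ltr_wpDl.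
have hid : increasing id by [].
have [G [beta [[b0 bS] _ hH]]] := avg hid hm d0.
have [th hth] := @choice nat K (fun k t => modulus t <=
  1 /\ t * sval f (e (m k)) = of_real s (modulus (sval f (e (m k)))))
  (fun k => let: ex_intro2 t h1 h2 :=
    exists_phase (sval f (e (m k)) : K) in ex_intro _ t (conj h1 h2)).
pose y : Y := \sum_(k <- G) (of_real s (beta k) * th k) *: e (m k).
have fy : sval f y = of_real s (\sum_(k <- G) beta k * modulus (sval f (e (m k)))).
  rewrite /y linear_sum /=.
  have -> : forall h : nat -> R, of_real s (\sum_(k <- G) h k) = \sum_(k <- G) of_real s (h k).
    by move=> g; elim/big_rec2 : _ => [|i u v _ <-]; rewrite ?of_real0 ?of_realD.
  apply: eq_bigr => k _; rewrite linearZ /= /GRing.scale /= -mulrA (hth k).2.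
  by rewrite of_realM.
have S0 : 0 <= \sum_(k <- G) beta k * modulus (sval f (e (m k))).
  by rewrite sumr_ge0// => k _; rewrite mulr_ge0 ?modulus_ge0.
have := hC y; rewrite fy modulus_of_real ger0_norm//; apply/negP; rewrite -ltNge.
apply: (@lt_le_trans _ _ eps); last first.
  apply: (@le_trans _ _ (\sum_(k <- G) beta k * eps)); first by rewrite -mulr_suml bS mul1r.
  by apply: ler_sum => k _; rewrite ler_wpM2l// ltW.
apply: (@le_lt_trans _ _ (C * (eps / (C + 1)))); last first.
  by rewrite mulrA ltr_pdivrMr ?ltr_wpDl// mulrC ltr_pM2l// ltrDl.
rewrite ler_wpM2l// normR_gnorm; apply: lp_gnorm_le; first exact: ltW.
move=> w E PE; have /andP[w0 w1] := with_zero01 P01 PE.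
pose H := [fset k in G | m k \in E]%fset.
have yE i : y i = \sum_(k <- G) (of_real s (beta k) * th k) * unit_seq R s (m k) i.
  by rewrite seqval_sum; apply: eq_bigr => k _; rewrite /= /GRing.scale /= he.
pose v k i : K := (of_real s (beta k) * th k) * (unit_seq R s (m k) i : K).
have unitZ k : lp_norm 1%:E E (v k) = modulus (of_real s (beta k) * th k) * (m k \in E)%:R.
  by rewrite (@lp_normZ R s 1%:E E _ (unit_seq R s (m k)) p1) lp_norm_unit.
apply: (@le_trans _ _ (w * \sum_(k <- H) beta k)).
  rewrite ler_wpM2l ?(ltW w0)// (@eq_lp_norm _ _ _ _ _ (fun i => \sum_(k <- G) v k i)) => [|i
    _]; last exact: yE.
  rewrite (le_trans (lp_norm_sum _ _ _ p1))//.
  rewrite (big_fsetID _ [pred k | m k \in E])/= [X in _ + X]big_seq [X in _ + X]big1 ?addr0.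
    rewrite -/H big_seq [leRHS]big_seq; apply: ler_sum => k; rewrite !inE/= => /andP[_ kE].
    rewrite unitZ kE mulr1 modulusM modulus_of_real ger0_norm// ler_piMr//.
    exact: (hth k).1.
  by move=> k; rewrite !inE/= => /andP[_ /negbTE kE]; rewrite unitZ kE mulr0.
case: PE => [PE|[_ E0]].
  have := hH w H; rewrite (_ : (H `&` G)%fset = H); last first.
    by apply/fsetIidPl; apply/fsubsetP => k; rewrite !inE/= => /andP[].
  apply; apply: P_her PE; apply/fsubsetP => j /imfsetP[k /=].
  by rewrite !inE/= => /andP[_ kE] ->.
rewrite big_seq big1 ?mulr0 ?(ltW d0)// => k; rewrite !inE/= E0 inE => /andP[_ /eqP k0].
by have := mk k; rewrite k0.
Qed.

Definition segment N : {fset nat} := [fset i in iota 0 N]%fset.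

(** Beyond [N] the functional is at most [eta] on unit vectors, so by the [l_1]
    bound the coordinates beyond [N] contribute at most [eta]. *)
Lemma functional_approx (a : Y) N (eta : R) : (forall E, lp_norm 1%:E E (a : nat -> K) <= 1) ->
  0 <= eta -> (forall i, (N <= i)%N -> modulus (sval f (e i)) <= eta) ->
  modulus (sval f a - \sum_(i <- segment N) (a i : K) * sval f (e i)) <= eta.
Proof.
move=> a1 eta0 hN; apply/ler_addgt0Pr => eps eps0.
have [C C0 hC] := dual_bound f.
have d0 : 0 < eps / (C + 1) by rewrite divr_gt0// ltr_wpDl.
have [M hM] := lp_small_tails (lexx 1) a1 d0.
pose L := maxn M N; pose b : Y := \sum_(i <- segment L) (a i : K) *: e i.
have bE j : b j = if j \in segment L then a j else 0 by apply: comb_unit.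
have fb : sval f b = \sum_(i <- segment L) (a i : K) * sval f (e i).
  by rewrite /b linear_sum /=; apply: eq_bigr => i _; rewrite linearZ.
have -> : sval f a - \sum_(i <- segment N) (a i : K) * sval f (e i) =
    \sum_(i <- [fset i in segment L | ~~ (i < N)%N]%fset) (a i : K) * sval f (e i) + sval f (a - b).
  rewrite linearB /= fb [in RHS](big_fsetID _ [pred i | (i < N)%N] (segment L))/=.
  have -> : \sum_(i <- [fset i in segment L | (i < N)%N]%fset) (a i : K) * sval f (e i) =
      \sum_(i <- segment N) (a i : K) * sval f (e i).
    apply: eq_fbigl => i; rewrite !inE/= !mem_iota /= !add0n; apply: andb_idl => iN.
    by apply: leq_trans iN _; exact: leq_maxr.
  by ring.
rewrite (le_trans (ler_modulusD _ _))// lerD//.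
  rewrite (le_trans (ler_modulus_sum _ _ _))//.
  apply: (@le_trans _ _ (eta * lp_norm 1%:E [fset i in segment L | ~~ (i < N)%N]%fset (a : nat
    -> K))); last first.
    by rewrite -[leRHS]mulr1 ler_wpM2l.
  rewrite lp_normE rlp_fin invr1 powRr1; last by rewrite sumr_ge0// => i _; exact: powR_ge0.
  rewrite mulr_sumr big_seq [leRHS]big_seq; apply: ler_sum => i;
    rewrite !inE/= -leqNgt => /andP[_ Ni].
  by rewrite modulusM mulrC powRr1 ?modulus_ge0// ler_wpM2r ?modulus_ge0// hN.
rewrite (le_trans (hC _))// (@le_trans _ _ (C * (eps / (C + 1))))//; last first.
  by rewrite mulrA ler_pdivrMr ?ltr_wpDl// mulrC ler_wpM2l ?(ltW eps0)// lerDl.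
rewrite ler_wpM2l// normR_gnorm; apply: lp_gnorm_le; first exact: ltW.
move=> w E PE; have /andP[w0 w1] := with_zero01 P01 PE.
have abE : {in E, (a - b : Y) =1 (fun j => if j \in segment L then 0 else a j)}.
  move=> j _; rewrite [LHS]/= -[LHS]/(a j - b j) bE; case: ifP => _; by rewrite ?subrr ?subr0.
rewrite (eq_lp_norm _ abE).
pose E' := [fset i in E | (M <= i)%N]%fset.
apply: (@le_trans _ _ (1 * lp_norm 1%:E E' (a : nat -> K))); last first.
  by rewrite mul1r; apply: hM => i; rewrite !inE/= => /andP[].
rewrite ler_pM ?(ltW w0) ?lp_norm_ge0//.
apply: (@le_trans _ _ (lp_norm 1%:E E' (fun j => if j \in segment L then 0 else (a j : K)))).
  apply: lp_norm_support; first exact: p1.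
  move=> i iE; rewrite !inE/= iE/= -ltnNge mem_iota/= add0n => iM.
  by rewrite (leq_trans iM (leq_maxl _ _)).
apply: ler_lp_norm; first exact: p1.
by move=> i _; case: ifP => _; rewrite ?modulus0 ?modulus_ge0.
Qed.

End Functional.
Definition l1_ball : set (prod_topology (fun _ : nat => (K^o : topologicalType))) :=
  [set a | forall E, lp_norm 1%:E E (a : nat -> K) <= 1].

Lemma near_coordinates (x : prod_topology (fun _ : nat => (K^o : topologicalType))) E (d : R) :
  0 < d ->
  \forall a \near x, forall i, i \in E -> modulus ((x : nat -> K) i - (a : nat -> K) i) < d.
Proof.
move=> d0.
have coord i : \forall a \near x, modulus ((x : nat -> K) i - (a : nat -> K) i) < d.
  have cont := @proj_continuous nat (fun _ : nat => (K^o : topologicalType)) i x.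
  have FF := fmap_filter (proj i) (nbhs_filter x).
  exact: ((@cvg_normRP R s K^o _ FF (proj i x)).1 cont d d0).
suff : forall l : seq nat, \forall a \near x, forall i, i \in l -> modulus ((x : nat ->
  K) i - (a : nat -> K) i) < d.
  by apply.
elim=> [|j l IH]; first by apply: (@filterE _ _ (nbhs_filter x)) => a i; rewrite in_nil.
apply: (@filterS2 _ _ (nbhs_filter x) _ _ _ _ (coord j) IH) => a aj al i.
by rewrite inE => /orP[/eqP ->|/al].
Qed.

(** Tychonoff's theorem: the ball is closed in a product of discs. *)
Lemma l1_ball_compact : compact l1_ball.
Proof.
pose B : set (prod_topology (fun _ : nat => (K^o : topologicalType))) :=
  [set a | forall i, modulus ((a : nat -> K) i) <= 1].
apply: (@subclosed_compact _ _ B).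
- move=> a ha E; apply/ler_addgt0Pr => eps eps0.
  have d0 : 0 < eps / (size E).+1%:R by rewrite divr_gt0.
  have [b [b1 ab]] := ha _ (near_coordinates a E d0).
  rewrite (@eq_lp_norm _ _ _ _ _ (fun i => (b : nat -> K) i + ((a : nat -> K) i - (b : nat ->
    K) i))); last first.
    by move=> i _; rewrite addrC subrK.
  rewrite (le_trans (ler_lp_normD _ _ _ p1))// lerD//.
  rewrite (le_trans (lp_norm_le_sum _ _ p1))//.
  apply: (@le_trans _ _ (\sum_(i <- E) eps / (size E).+1%:R)).
    by rewrite big_seq [leRHS]big_seq; apply: ler_sum => i /ab/ltW.
  rewrite big_const_seq count_predT iter_addr_0 -[leLHS]mulr_natr mulrAC ler_pdivrMr// ler_pM2l//.
  by rewrite ler_nat.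
- exact: (@tychonoff _ (fun _ : nat => (K^o : topologicalType)) _ (fun=> @scalar_disc_compact R
  s 1)).
- move=> a a1 i /=; have := a1 [fset i]%fset; by rewrite lp_norm1.
Qed.

Lemma l1_bounded (a : nat -> K^o) : (forall E, lp_norm 1%:E E (a : nat -> K) <= 1) ->
  a \in gbounded (lp_gauge s p1 (with_zero01 P01) (with_zero_fset1 P1)).
Proof.
move=> a1; apply/asboolP; exists 1 => phi [w [E [PE ->]]].
have /andP[w0 w1] := with_zero01 P01 PE.
by rewrite -[leRHS]mul1r ler_pM ?(ltW w0) ?lp_norm_ge0.
Qed.

Definition to_Y (a : prod_topology (fun _ : nat => (K^o : topologicalType))) : weak_space Y :=
  if pselect (forall E, lp_norm 1%:E E (a : nat ->
    K) <= 1) is left h then SeqSp (l1_bounded h) else 0.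

Lemma to_YE a : l1_ball a -> seqval (to_Y a : Y) = a.
Proof. by move=> ha; rewrite /to_Y; case: pselect. Qed.

(** On the [l_1] ball, pairing with a functional is a uniform limit of finite sums
    of coordinates, because the functional tends to zero along the unit vectors. *)
Lemma to_Y_continuous : {within l1_ball, continuous to_Y}.
Proof.
apply/subspace_continuousP => x x1; apply/(@cvg_weakP R s Y) => f.
have [e he] := lp_unit_exists s p1 (with_zero01 P01) (with_zero_fset1 P1).
apply/(@cvg_normRP R s K^o) => eps eps0.
have eps40 : 0 < eps / 4 by rewrite divr_gt0.
have [N hN] := unit_weakly_null f he eps40.
have [C C0 hC] := dual_bound f.
pose D : R := \sum_(i <- segment N) modulus (sval f (e i)).
have D0 : 0 <= D by rewrite sumr_ge0// => i _; exact: modulus_ge0.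
have d0 : 0 < eps / 4 / (D + 1) by rewrite divr_gt0// ltr_wpDl.
apply: (@filterS _ _ (nbhs_filter x) _ _ _ (near_coordinates x (segment N) d0)) => a ha a1 /=.
have approx b : l1_ball b -> modulus (sval f (to_Y b) - \sum_(i <- segment N) ((b : nat ->
  K) i) * sval f (e i)) <= eps / 4.
  move=> b1; have ball E : lp_norm 1%:E E (seqval (to_Y b : Y)) <= 1 by rewrite to_YE.
  by have := functional_approx he ball (ltW eps40) hN; rewrite to_YE.
change (modulus ((sval f (to_Y x) : K) - sval f (to_Y a)) < eps).
have split4 (u v z t : K) : u - v = (u - z) + ((z - t) - (v - t)) by ring.
pose T (b : nat -> K) := \sum_(i <- segment N) b i * (sval f (e i) : K).
have TB : T x - T a = \sum_(i <- segment N) ((x : nat -> K) i - (a : nat -> K) i) * sval f (e i).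
  by rewrite -sumrB; apply: eq_bigr => i _; rewrite mulrBl.
rewrite (split4 (sval f (to_Y x)) (sval f (to_Y a)) (T x) (T a)) TB.
apply: (@le_lt_trans _ _ (eps / 4 + (eps / 4 + eps / 4))); last by lra.
rewrite (le_trans (ler_modulusD _ _))// lerD ?approx// (le_trans (ler_modulusD _ _))//.
rewrite lerD ?modulusN ?approx//.
rewrite (le_trans (ler_modulus_sum _ _ _))//.
apply: (@le_trans _ _ (\sum_(i <- segment N) (eps / 4 / (D + 1)) * modulus (sval f (e i)))).
  rewrite big_seq [leRHS]big_seq; apply: ler_sum => i iN.
  by rewrite modulusM ler_wpM2r ?modulus_ge0// ltW// ha.
rewrite -mulr_sumr -/D -mulrA ler_piMr ?(ltW eps40)// mulrC ler_pdivrMr ?ltr_wpDl//.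
by rewrite mul1r lerDl.
Qed.

Fact coord_linear i : linear (fun a : Y => (a i : K^o)).
Proof. by []. Qed.

Lemma Y_weak_hausdorff : hausdorff_space (weak_space Y).
Proof.
apply: weak_hausdorff => y y' h; apply/val_inj/funext => i /=.
pose fi : {linear Y -> K^o} := HB.pack (fun a : Y => (a i : K^o))
  (GRing.isLinear.Build K Y K^o _ _ (coord_linear i)).
have fb : bounded_operator fi.
  exists 1 => a; rewrite mul1r normRE normRE le_of_real modulus_normR normR_gnorm.
  exact: coord_lp_gnorm.
exact: (h (exist _ fi fb)).
Qed.

(** The image of the unit ball lies in the image of a compact set of sequences
    under a map that is continuous for the weak topology, and this image is
    closed since the weak topology is Hausdorff. *)
Lemma l1_incl_weakly_compact (gh : forall a B, 0 <= B ->
    gball (lp_gauge s p1 (@all_sets01 R) (@all_sets_fset1 R)) a B ->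
    gball (lp_gauge s p1 (with_zero01 P01) (with_zero_fset1 P1)) a B) :
  weakly_compact_operator (incl gh).
Proof.
split; first exact: incl_bounded_operator.
have cK : compact (to_Y @` l1_ball).
  by apply: continuous_compact l1_ball_compact; exact: to_Y_continuous.
apply: (subclosed_compact _ cK); first exact: closed_closure.
apply: subset_trans (compact_closed Y_weak_hausdorff cK).
apply: closureS => _ [a /= a1 <-].
have aB : l1_ball (seqval a).
  move=> E; have := @lp_gauge_le _ _ _ _ _ _ _ a 1 E erefl; rewrite mul1r => /le_trans; apply.
  by rewrite -normR_gnorm -(@le_of_real R s) -normRE of_real1.
exists (seqval a) => //; apply: val_inj; exact: (to_YE aB).
Qed.

End WeaklyCompactInclusion.

(** * The operators separating the classes *)

Section Shift.
Context (R : realType) (s : scalars).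
Local Notation K := (scalar_field R s).

Lemma spreading_model_shift p (F F' : set {fset nat}) t (X : normedModType K) (x : nat -> X) :
  (forall E, F E -> F' [fset (i + t)%N | i in E]%fset) ->
  spreading_model p F' x -> spreading_model p F (fun i => x (i + t)%N).
Proof.
move=> FF' [a [b [a0 b0 h]]]; exists a, b; split=> // E FE c.
have inj : {in E &, injective (fun i => i + t)%N} by move=> i j _ _ /addIn.
have := h _ (FF' E FE) (fun i => c (i - t)%N).
have -> : comb_norm x [fset (i +
  t)%N | i in E]%fset (fun i => c (i - t)%N) = comb_norm (fun i => x (i + t)%N) E c.
  by rewrite /comb_norm big_imfset//=; congr normR; apply: eq_bigr => i _; rewrite addnK.
have -> : lp_norm p [fset (i + t)%N | i in E]%fset (fun i => c (i - t)%N) = lp_norm p E c.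
  case: p {h} => [r| |]; last by [].
    by congr (_ `^ _); rewrite big_imfset//=; apply: eq_bigr => i _; rewrite addnK.
  rewrite !lp_normE; apply/eqP; rewrite eq_le; apply/andP; split; rewrite [leLHS]rlp_oo.
    apply: le_bigmax_fset => [|_ /imfsetP[i /= iE ->]]; first exact: rlp_ge0.
    by rewrite addnK; exact: (bigmax_fset_ge (fun i => modulus (c i)) iE).
  apply: le_bigmax_fset => [|i iE]; first exact: rlp_ge0.
  have iE' : (i + t)%N \in [fset (i + t)%N | i in E]%fset by apply: in_imfset.
  by have := bigmax_fset_ge (fun j => modulus (c (j - t)%N)) iE'; rewrite addnK.
by [].
Qed.

End Shift.

Section Separation.
Context (R : realType) (s : scalars) (d : Order.disp_t) (W : tbOrderType d).
Local Notation K := (scalar_field R s).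
Hypothesis hW : ordinals_upto_omega1 W.
Variable S : W -> set {fset nat}.
Hypothesis hS : schreier_hierarchy S.
Implicit Types (p q : \bar R) (zeta xi : W) (u : nat -> W).

(** Translating a spreading model of order [xi] far enough gives one of order
    [zeta], since [S zeta] is contained in [S xi] far to the right. *)
Lemma SM_monotone p zeta xi (X Y : completeNormedModType K) (A : {linear X -> Y}) :
  (zeta <= xi)%O -> SM R s S p zeta X Y A -> SM R s S p xi X Y A.
Proof.
move=> zx [bA hA]; split=> // x smx smAx.
have [t ht] := S_eventually_sub hW hS zx.
have FF' E : S zeta E -> S xi [fset (i + t)%N | i in E]%fset.
  move=> SE; apply: ht; first by move=> _ /imfsetP[i /= _ ->]; rewrite leq_addl.
  apply: (S_spreading hW hS _ _ SE); first by move=> i j _ _; rewrite ltn_add2r.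
  by move=> i _; rewrite leq_addr.
exact: (hA _ (spreading_model_shift FF' smx) (spreading_model_shift FF' smAx)).
Qed.

(** The predecessor repeated if [xi] is a successor, and the sequence defining
    [S xi] if [xi] is a limit. *)
Lemma cofinal_sequence xi : (\bot < xi)%O -> (xi < \top)%O -> exists u,
  [/\ forall n, (0 < n)%N -> S (u n) `<=` S (u n.+1), forall n, (0 < n)%N -> (u n < xi)%O &
      forall z, (z < xi)%O -> exists2 n, (0 < n)%N & (z <= u n)%O].
Proof.
move=> xi0 xiT; have [[x xix]|nS] := pselect (is_successor xi).
  exists (fun=> x); split=> [n _|n _|z zxi]; [by []|by case: xix|].
  by exists 1%N => //; rewrite leNgt; apply/negP => /xix.2; rewrite leNgt zxi.
case: hS => _ _ /(_ xi xiT (conj xi0 nS)) [u [u1 u2 _]] _.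
exists u; split=> [n n0|n n0|z /u2[n n0 zu]]; [by have [] := u1 n n0|by have [] := u1 n n0|].
by exists n => //; exact: ltW.
Qed.

Lemma lp_incl_gball p (p1 : (1%:E <= p)%E) (P : R -> set {fset nat})
    (P01 : forall w E, P w E -> 0 < w <= 1) (P1 : forall i, P 1 [fset i]%fset) a B :
  0 <= B -> gball (lp_gauge s p1 (@all_sets01 R) (@all_sets_fset1 R)) a B ->
  gball (lp_gauge s p1 P01 P1) a B.
Proof.
move=> B0 aB phi [w [E [/P01/andP[w0 w1] ->]]].
have := aB (fun a => 1 * lp_norm p E (a : nat ->
  K)) (ex_intro _ 1 (ex_intro _ E (conj erefl erefl))).
by rewrite mul1r; apply: le_trans; rewrite ler_piMl ?lp_norm_ge0.
Qed.

Lemma dual_incl_gball (p1 : (1%:E <= +oo :> \bar R)%E) (P : R -> set {fset nat})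
    (P01 : forall w E, P w E -> 0 < w <= 1) a B :
  0 <= B -> gball (dual_gauge s P01) a B ->
  gball (lp_gauge s p1 (@all_sets01 R) (@all_sets_fset1 R)) a B.
Proof.
move=> B0 aB phi [w [E [-> ->]]]; rewrite mul1r lp_normE rlp_oo.
apply: le_bigmax_fset => // i _.
have := aB (fun a => \sum_(j <- [fset 0%N]%fset) 1 * modulus (a i)).
rewrite big_seq_fset1 mul1r; apply; exact: dual_gauge_dirac.
Qed.

(** For [p] finite the operator is the inclusion of [l_p] into its weighted
    Schreier variant, for [p = +oo] that of the dual of the weighted Schreier
    space into [l_oo]. The unit vectors show that it is not in the class of
    order [u n], the weight [1 / n] being harmless as [n] is fixed. *)
Lemma separating_operator p u : (1%:E <= p)%E ->
  (forall n, (0 < n)%N -> S (u n) `<=` S (u n.+1)) ->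
  (forall n, (0 < n)%N -> (u n < \top)%O) ->
  exists (X Y : completeNormedModType K) (A : {linear X -> Y}),
  [/\ forall xi, (forall n, (0 < n)%N -> (u n < xi)%O) -> SM R s S p xi X Y A,
      forall n, (0 < n)%N -> ~ SM R s S p (u n) X Y A &
      p = 1%:E -> weakly_compact_operator A].
Proof.
move=> p1 uS uT.
have P01 := @weighted01 R d W S u.
have P_her := @weighted_hereditary R d W hW S hS u.
have P_spr := @weighted_spreading R d W hW S hS u.
have P1 := @weighted_fset1 R d W hW S hS u.
have w_gt0 n : (0 < n)%N -> 0 < n%:R^-1 :> R by rewrite invr_gt0 ltr0n.
have FP n : (0 < n)%N -> forall E, S (u n) E -> weighted S u (n%:R^-1 : R) E.
  by move=> n0 E SE; exists n.
have S_gt0 xi E i : S xi E -> i \in E -> (0 < i)%N.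
  by move=> /(S_n0 hW hS) E0 iE; rewrite lt0n; apply: contraNneq E0 => <-.
have avg xi : (forall n, (0 < n)%N -> (u n < xi)%O) -> averaging (@weighted R d W S u) (S xi).
  by move=> uxi n m hn hm e e0; exact: (weighted_average hW hS uxi uS hn hm e0).
have [poo|poo] := eqVneq p +oo%E.
  move: p1; rewrite {}poo => p1; pose A := incl (@dual_incl_gball p1 _ P01).
  exists (seqsp (dual_gauge s P01)), (seqsp (lp_gauge s p1 (@all_sets01 R) (@all_sets_fset1 R))), A.
  split=> // [xi uxi|n n0 [_ hA]].
    split=> [|x smx]; first exact: incl_bounded_operator.
    by apply: (dual_no_common_spreading_model (S_hereditary hW hS (xi:=xi)) (S_fset1 hW hS xi)
      (avg _ uxi)) smx.
  have [e he] := @dual_unit_exists R s _ P01 P_her P1.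
  have he' E i : S (u n) E -> i \in E ->
    seqval (e i) = unit_seq R s i by move=> SE /(S_gt0 _ _ _ SE)/he.
  apply: (hA e).
    exact: (dual_unit_spreading_model P_her (w_gt0 n n0) (FP n n0) he').
  apply: (lp_unit_spreading_model (w0 := 1)) => //; exact: he'.
pose A := incl (@lp_incl_gball p p1 _ (with_zero01 P01) (with_zero_fset1 P1)).
exists (seqsp (lp_gauge s p1 (@all_sets01 R) (@all_sets_fset1 R))),
  (seqsp (lp_gauge s p1 (with_zero01 P01) (with_zero_fset1 P1))), A.
split=> [xi uxi|n n0 [_ hA]|pE].
- split=> [|x smx]; first exact: incl_bounded_operator.
  apply: (lp_no_common_spreading_model P_her P_spr (S_fset1 hW hS xi) (avg _ uxi)) smx => //.
  by rewrite lt_neqAle poo leey.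
- have [e he] := @lp_unit_exists R s p _ p1 (@all_sets01 R) (@all_sets_fset1 R).
  apply: (hA e).
    by apply: (lp_unit_spreading_model (w0 := 1)) => // E i _ _; exact: he.
  apply: (lp_unit_spreading_model (w_gt0 n n0)) => [E SE|E i _ _]; [by left; exact: FP|exact: he].
- rewrite /A; move: (@lp_incl_gball p p1 _ (with_zero01 P01) (with_zero_fset1 P1)).
  move: p1 A poo; rewrite pE => p1 _ _ gh.
  exact: (l1_incl_weakly_compact P_her (avg _ uT)).
Qed.

(** For [p] finite the operator is the identity of [l_p]. For [p = +oo] the
    identity of [l_oo] would not do, as this space contains all sequence spaces;
    the inclusion of the dual Schreier space has its image in [c_0]. *)
Lemma exponent_separating_operator p q zeta xi : (1%:E <= p)%E -> (1%:E <= q)%E -> p <> q ->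
  (\bot < zeta)%O -> (xi < \top)%O ->
  exists (X Y : completeNormedModType K) (A : {linear X -> Y}),
    SM R s S q zeta X Y A /\ ~ SM R s S p xi X Y A.
Proof.
move=> p1 q1 pq zeta0 xiT.
have avg : averaging (@weighted R d W S (fun=> \bot%O)) (S zeta).
  by move=> n m hn hm e e0; exact: (weighted_average hW hS (fun _ _ => zeta0) (fun _ _ _ h => h)
    hn hm e0).
have none := @lp_no_spreading_model R s _ _ (@weighted_fset1 R d W hW S hS (fun=> \bot%O))
  (S_hereditary hW hS (xi:=zeta)) (S_fset1 hW hS zeta) avg.
have S_gt0 E i : S xi E -> i \in E -> (0 < i)%N.
  by move=> /(S_n0 hW hS) E0 iE; rewrite lt0n; apply: contraNneq E0 => <-.
have [poo|poo] := eqVneq p +oo%E.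
  move: p1 pq; rewrite {}poo => p1 pq.
  pose P := @weighted R d W S (fun=> xi).
  have P01 := @weighted01 R d W S (fun=> xi) : forall w E, P w E -> 0 < w <= 1.
  have P_her := @weighted_hereditary R d W hW S hS (fun=> xi).
  have P1 := @weighted_fset1 R d W hW S hS (fun=> xi).
  have avgP : averaging P (S \top%O).
    by move=> n m hn hm e e0; exact: (weighted_average hW hS (fun _ _ => xiT) (fun _ _ _ h => h)
      hn hm e0).
  pose A := incl (@dual_incl_gball p1 P P01).
  exists (seqsp (dual_gauge s P01)), (seqsp (lp_gauge s p1 (@all_sets01 R) (@all_sets_fset1 R))), A.
  split.
    split=> [|x _]; first exact: incl_bounded_operator.
    by apply: (none _ _ p1 q1 _ pq) => n; exact: (dual_small_tails (x n) avgP).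
  move=> [_ hA]; have [e he] := @dual_unit_exists R s _ P01 P_her P1.
  have he' E i : S xi E -> i \in E -> seqval (e i) = unit_seq R s i by move=> SE /(S_gt0 _ _ SE)/he.
  apply: (hA e).
    apply: (dual_unit_spreading_model P_her ltr01 _ he') => E SE.
    by exists 1%N => //; rewrite invr1.
  apply: (lp_unit_spreading_model (w0 := 1)) => //; exact: he'.
have [r r1 pE] : exists2 r : R, 1 <= r & p = r%:E by have [//|pE] := exponentP p1;
  rewrite pE eqxx in poo.
pose A := incl (@lp_incl_gball p p1 _ (@all_sets01 R) (@all_sets_fset1 R)).
exists (seqsp (lp_gauge s p1 (@all_sets01 R) (@all_sets_fset1 R))),
  (seqsp (lp_gauge s p1 (@all_sets01 R) (@all_sets_fset1 R))), A.
split.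
  split=> [|x _]; first exact: incl_bounded_operator.
  apply: (none _ _ p1 q1 _ pq) => n; subst p.
  apply: (@lp_small_tails _ _ r (gnorm (x n))) => // E.
  by have := @lp_gauge_le _ _ _ _ _ _ _ (x n) 1 E erefl; rewrite mul1r.
move=> [_ hA]; have [e he] := @lp_unit_exists R s p _ p1 (@all_sets01 R) (@all_sets_fset1 R).
by apply: (hA e); apply: (lp_unit_spreading_model (w0 := 1)) => // E i _ _; exact: he.
Qed.

End Separation.

Theorem theorem7p2 (R : realType) (s : scalars)
    (d : Order.disp_t) (W : tbOrderType d) (hW : ordinals_upto_omega1 W)
    (S : W -> set {fset nat}) (hS : schreier_hierarchy S)
    (p : \bar R) (hp : (1%:E <= p)%E)
    (xi : W) (xi_gt0 : (\bot < xi)%O) (xi_lt_omega1 : (xi < \top)%O) :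
  [/\ ~ class_sub (SM R s S p xi)
          (class_bigcup (fun zeta : W => (\bot < zeta)%O /\ (zeta < xi)%O)
             (fun zeta => SM R s S p zeta)),
      ~ class_sub (WC R s S xi)
          (class_bigcup (fun zeta : W => (\bot < zeta)%O /\ (zeta < xi)%O)
             (fun zeta => WC R s S zeta))
    & forall (zeta : W) (q : \bar R),
        (\bot < zeta)%O -> (zeta <= \top)%O -> (1%:E <= q)%E ->
        (class_sub (SM R s S q zeta) (SM R s S p xi) <->
         p = q /\ (zeta <= xi)%O)].
Proof.
have [u [uS uxi u_cof]] := cofinal_sequence hS xi_gt0 xi_lt_omega1.
have uT n : (0 < n)%N -> (u n < \top)%O by move=> /uxi h; exact: lt_trans h xi_lt_omega1.
split.
- have [X [Y [A [A_SM A_nSM _]]]] := separating_operator s hW hS hp uS uT.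
  move=> /(_ X Y A (A_SM _ uxi)) [zeta [_ /u_cof[n n0 zu]] A_zeta].
  exact: (A_nSM n n0 (SM_monotone hW hS zu A_zeta)).
- have [X [Y [A [A_SM A_nSM A_wc]]]] := separating_operator s hW hS (lexx (1%:E : \bar R)) uS uT.
  move=> /(_ X Y A (conj (A_wc erefl) (A_SM _ uxi))) [zeta [_ /u_cof[n n0 zu]] [_ A_zeta]].
  exact: (A_nSM n n0 (SM_monotone hW hS zu A_zeta)).
move=> zeta q zeta0 _ q1; split=> [sub|[<- zx] X Y A]; last exact: SM_monotone.
have pq : p = q.
  apply: contrapT => pq.
  have [X [Y [A [A1 A2]]]] := exponent_separating_operator s hW hS hp q1 pq zeta0 xi_lt_omega1.
  exact: A2 (sub X Y A A1).
split=> //; rewrite leNgt; apply/negP => xz.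
have [X [Y [A [A_SM A_nSM _]]]] :=
  separating_operator s (u := fun=> xi) hW hS hp (fun _ _ _ h => h) (fun _ _ => xi_lt_omega1).
by apply: (A_nSM 1%N isT); apply: sub; rewrite -pq; exact: A_SM.
Qed.
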